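(* Let $\bm P$ and $\bm P^{(n)}$ ($n\ge1$) be proper lazy Markov stick-breaking processes with parameters $(\rho,\bm\pi,P_0)$ and $(\rho^{(n)},\bm\pi^{(n)},P_0^{(n)})$, and let $\bm w,\bm w^{(n)}$ be their weights. If $\rho^{(n)}\to\rho$ in $[0,1]$, $P_0^{(n)}\to P_0$ weakly, and $\pi_j^{(n)}\to\pi_j$ weakly for every $j\ge1$, then $\bm P^{(n)}\to\bm P$ weakly in distribution and $\bm w^{(n)}\to\bm w$ in distribution. In particular: (i) if $\rho=0$, the length variables of $\bm P$ are independent with $v_j\sim\pi_j$; if moreover $\pi_j=\mathrm{Beta}(1-\sigma,\theta+j\sigma)$ with $0\le\sigma<1$, $\theta>-\sigma$, then $\bm P$ is a Pitman–Yor process and $\bm w$ is invariant under size-biased permutations; (ii) if $\rho=1$, $\bm P$ is the completely dependent stick-breaking process with parameters $(\bm\pi,P_0)$; if moreover $\pi_j=\mathrm{Beta}(1-\sigma,\theta+j\sigma)$ with $0\le\sigma<1$, $\theta>-\sigma$, then $\bm w$ is a.s. non-increasing.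
   Context: For probability measures $\pi_j$ on $[0,1]$ with continuous strictly increasing distribution functions $F_j$ (assumed for all $\bm\pi$ and $\bm\pi^{(n)}$), $\Upsilon_j=F_{j+1}^{-1}\circ F_j$. A lazy Markov stick-breaking process with parameters $(\rho,\bm\pi,P_0)$, $\rho\in[0,1]$, is $\bm P=\sum_jw_j\delta_{\theta_j}+(1-\sum_jw_j)P_0$, where $w_1=v_1$, $w_j=v_j\prod_{i<j}(1-v_i)$, $\bm v$ is a Markov chain with $v_1\sim\pi_1$ and $\mathbb P[v_{j+1}\in\cdot\mid v_j]=\rho\,\delta_{\Upsilon_j(v_j)}+(1-\rho)\pi_{j+1}$, $P_0$ diffuse on a complete separable metric space $\mathbb X$, $\theta_j$ iid $P_0$ independent of $\bm w$. Proper: $\sum_jw_j=1$ a.s. The completely dependent stick-breaking process uses $v_1\sim\pi_1$, $v_{j+1}=\Upsilon_j(v_j)$. Pitman–Yor process: independent $v_j\sim\mathrm{Beta}(1-\sigma,\theta+j\sigma)$. Size-biased permutation: $(w_{\varrho_j})$ with $\mathbb P[\varrho_1=j\mid\bm w]=w_j$, $\mathbb P[\varrho_{k+1}=j\mid\bm w,\varrho_{1..k}]=w_j(1-\sum_{i\le k}w_{\varrho_i})^{-1}\mathbb 1\{j\notin\{\varrho_1,\dots,\varrho_k\}\}$; invariance means $(w_{\varrho_j})\overset d=(w_j)$. Weak convergence in distribution: $\int f d\bm P^{(n)}\to\int fd\bm P$ in distribution for all bounded continuous $f$. *)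

(* Defs.v *)
From HB Require Import structures.
From mathcomp Require Import all_boot all_order all_algebra.
From mathcomp Require Import all_classical all_reals all_analysis.
Set Implicit Arguments.
Unset Strict Implicit.
Unset Printing Implicit Defensive.
Import Order.TTheory GRing.Theory Num.Theory.
Import numFieldTopology.Exports numFieldNormedType.Exports.
Local Open Scope classical_set_scope.
Local Open Scope ring_scope.

(* Conventions: all sequences are indexed from 0, i.e. Rocq index j stands for
   the paper's index j+1 (pis 0 = pi_1, v 0 = v_1, Upsilon j = Upsilon_{j+1}, ...). *)

Section LMSB.
Variable R : realType.

Definition cdf (pi : probability R R) (x : R) : R := fine (pi `]-oo, x]%classic).

Definition cdf_inv (pi : probability R R) (u : R) : R :=
  inf [set x : R | u <= cdf pi x].

Definition nice_prob (pi : probability R R) : Prop :=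
  pi `[0, 1]%classic = 1%E /\ continuous (cdf pi) /\
  (forall x y : R, 0 <= x -> x < y -> y <= 1 -> cdf pi x < cdf pi y).

Definition Upsilon (pis : nat -> probability R R) (j : nat) (x : R) : R :=
  cdf_inv (pis j.+1) (cdf (pis j) x).

Definition beta_dens (a b x : R) : R := x `^ (a - 1) * (1 - x) `^ (b - 1).

Definition beta_law (a b : R) (A : set R) : \bar R :=
  (fine (\int[lebesgue_measure]_(x in A `&` `]0, 1[%classic) (beta_dens a b x)%:E) /
   fine (\int[lebesgue_measure]_(x in `]0, 1[%classic) (beta_dens a b x)%:E))%:E.

Definition is_beta (pi : probability R R) (a b : R) : Prop :=
  forall A : set R, measurable A -> pi A = beta_law a b A.

(** Markov kernel of the lazy chain:
    K_j(x, .) = rho delta_{Upsilon_j x} + (1 - rho) pi_{j+1}.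
    mc_fdd_from rho pis A m j x = P[v_{j+1} in A_{j+1}, ..., v_{j+m} in A_{j+m} | v_j = x] *)
Fixpoint mc_fdd_from (rho : R) (pis : nat -> probability R R) (A : nat -> set R)
    (m j : nat) (x : R) : \bar R :=
  match m with
  | 0 => 1%E
  | m'.+1 =>
      ((rho * \1_(A j.+1) (Upsilon pis j x))%:E
         * mc_fdd_from rho pis A m' j.+1 (Upsilon pis j x)
       + (1 - rho)%:E
         * \int[pis j.+1]_(y in A j.+1) mc_fdd_from rho pis A m' j.+1 y)%E
  end.

Definition mc_fdd (rho : R) (pis : nat -> probability R R) (A : nat -> set R)
    (k : nat) : \bar R :=
  match k with
  | 0 => 1%E
  | k'.+1 => (\int[pis 0%N]_(x in A 0%N) mc_fdd_from rho pis A k' 0 x)%E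
  end.

Definition sb_weight (v : nat -> R) (j : nat) : R :=
  v j * \prod_(i < j) (1 - v i).

Variable X : completePseudoMetricType R.

Definition polish : Prop :=
  hausdorff_space X /\ exists D : set X, countable D /\ dense D.

Definition XB := g_sigma_algebraType (@open X).

Definition diffuse (P0 : probability XB R) : Prop := forall x : XB, P0 [set x] = 0%E.

Section process.
Context {d : measure_display} {Omega : measurableType d}.
Variable (P : probability Omega R).

(** (v, theta) defined on (Omega, P) are the length variables and atoms of a
    lazy Markov stick-breaking process with parameters (rho, pis, P0):
    v is a Markov chain with v_0 ~ pi_0 and transition kernels K_j,
    theta iid ~ P0, independent of v. This is stated through the finite
    dimensional distributions of (v, theta). *)
Definition lazy_msb (rho : R) (pis : nat -> probability R R) (P0 : probability XB R)
    (v : nat -> Omega -> R) (th : nat -> Omega -> XB) : Prop :=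
  [/\ 0 <= rho <= 1, (forall j, nice_prob (pis j)), diffuse P0,
      (forall j, measurable_fun setT (v j) /\ measurable_fun setT (th j)) &
      forall (k : nat) (A : nat -> set R) (B : nat -> set XB),
        (forall i, measurable (A i)) -> (forall i, measurable (B i)) ->
        P (\bigcap_(i in `I_k) ([set w | A i (v i w)] `&` [set w | B i (th i w)]))
        = (mc_fdd rho pis A k * \prod_(i < k) P0 (B i))%E].

Definition proper_sb (v : nat -> Omega -> R) : Prop :=
  {ae P, forall w, series (fun j => sb_weight (v ^~ w) j) @ \oo --> (1 : R)}.

(** integral of a bounded f against the random measure
    P = sum_j w_j delta_{theta_j} + (1 - sum_j w_j) P0 :
    int f dP = sum_j w_j f(theta_j) + (1 - sum_j w_j) int f dP0 *)
Definition sb_integral (P0 : probability XB R) (v : nat -> Omega -> R)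
    (th : nat -> Omega -> XB) (f : X -> R) (w : Omega) : R :=
  limn (series (fun j => sb_weight (v ^~ w) j * f (th j w)) : R^nat)
  + (1 - limn (series (fun j => sb_weight (v ^~ w) j) : R^nat))
    * Rintegral P0 setT (fun x : XB => f x).

(** independence of the v_j with v_j ~ pi_j (product rule on all finite
    initial families of events, which covers every finite subfamily) *)
Definition indep_with_laws (pis : nat -> probability R R) (v : nat -> Omega -> R) : Prop :=
  forall (k : nat) (A : nat -> set R), (forall i, measurable (A i)) ->
    P (\bigcap_(i in `I_k) [set w | A i (v i w)]) = (\prod_(i < k) pis i (A i))%E.

(** Pitman--Yor process PY(sigma, theta, P0): the stick-breaking process with
    independent v_j ~ Beta(1 - sigma, theta + j sigma) (paper index j >= 1,
    i.e. Rocq index j gets theta + (j+1) sigma), atoms iid P0 independent of v *)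
Definition pitman_yor (sig tht : R) (P0 : probability XB R)
    (v : nat -> Omega -> R) (th : nat -> Omega -> XB) : Prop :=
  [/\ (forall j, measurable_fun setT (v j)), (forall j, measurable_fun setT (th j)) &
  forall (k : nat) (A : nat -> set R) (B : nat -> set XB),
    (forall i, measurable (A i)) -> (forall i, measurable (B i)) ->
    P (\bigcap_(i in `I_k) ([set w | A i (v i w)] `&` [set w | B i (th i w)]))
    = (\prod_(i < k) beta_law (1 - sig) (tht + i.+1%:R * sig) (A i)
       * \prod_(i < k) P0 (B i))%E].

Definition cd_sb (pis : nat -> probability R R) (P0 : probability XB R)
    (v : nat -> Omega -> R) (th : nat -> Omega -> XB) : Prop :=
  [/\ (forall j, measurable_fun setT (v j)), (forall j, measurable_fun setT (th j)),
      {ae P, forall w, forall j, v j.+1 w = Upsilon pis j (v j w)} &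
      forall (k : nat) (A : set R) (B : nat -> set XB),
        measurable A -> (forall i, measurable (B i)) ->
        P ([set w | A (v 0%N w)] `&` \bigcap_(i in `I_k) [set w | B i (th i w)])
        = (pis 0%N A * \prod_(i < k) P0 (B i))%E].

(** size-biased permutation: sbp_fdd k used A ww is the conditional probability,
    given the weights ww and already chosen indices used = [rho_1; ...; rho_m],
    that w_{rho_{m+1}} in A_m, ..., w_{rho_{m+k}} in A_{m+k-1} *)
Fixpoint sbp_fdd (k : nat) (used : seq nat) (A : nat -> set R) (ww : nat -> R)
    : \bar R :=
  match k with
  | 0 => 1%E
  | k'.+1 =>
      (\sum_(0 <= j <oo | j \notin used)
         ((ww j / (1 - \sum_(i <- used) ww i)) * \1_(A (size used)) (ww j))%:E
         * sbp_fdd k' (rcons used j) A ww)%E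
  end.

Definition sbp_invariant (W : nat -> Omega -> R) : Prop :=
  forall (k : nat) (A : nat -> set R), (forall i, measurable (A i)) ->
    (\int[P]_w sbp_fdd k [::] A (W ^~ w))%E
    = P (\bigcap_(i in `I_k) [set w | A i (W i w)]).

Definition as_nonincreasing (W : nat -> Omega -> R) : Prop :=
  {ae P, forall w, forall j, W j.+1 w <= W j w}.

End process.

Definition cvg_dist_R {d} {Omega : measurableType d} (P : probability Omega R)
    (dn : nat -> measure_display) (Omegan : forall n, measurableType (dn n))
    (Pn : forall n, probability (Omegan n) R)
    (Yn : forall n, Omegan n -> R) (Y : Omega -> R) : Prop :=
  forall g : R -> R, continuous g -> (exists M : R, forall x, `|g x| <= M) ->
    (fun n => \int[Pn n]_w (g (Yn n w))%:E)%E @ \oo --> (\int[P]_w (g (Y w))%:E)%E.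

Definition cvg_dist_seq {d} {Omega : measurableType d} (P : probability Omega R)
    (dn : nat -> measure_display) (Omegan : forall n, measurableType (dn n))
    (Pn : forall n, probability (Omegan n) R)
    (Wn : forall n, Omegan n -> nat -> R) (W : Omega -> nat -> R) : Prop :=
  forall G : {ptws nat -> R} -> R, continuous G -> (exists M : R, forall x, `|G x| <= M) ->
    (fun n => \int[Pn n]_w (G (Wn n w))%:E)%E @ \oo --> (\int[P]_w (G (W w))%:E)%E.

Definition weak_cvg_X (mun : nat -> probability XB R) (mu : probability XB R) : Prop :=
  forall f : X -> R, continuous f -> (exists M : R, forall x, `|f x| <= M) ->
    (fun n => \int[mun n]_x (f x)%:E)%E @ \oo --> (\int[mu]_x (f x)%:E)%E.

Definition weak_cvg_R (mun : nat -> probability R R) (mu : probability R R) : Prop :=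
  forall f : R -> R, continuous f -> (exists M : R, forall x, `|f x| <= M) ->
    (fun n => \int[mun n]_x (f x)%:E)%E @ \oo --> (\int[mu]_x (f x)%:E)%E.

End LMSB.

(* Main.v *)
Require Import Defs.
From HB Require Import structures.
From mathcomp Require Import all_boot all_order all_algebra.
From mathcomp Require Import all_classical all_reals all_analysis.
From mathcomp Require finmap.
From mathcomp Require Import measurable_realfun.
From mathcomp Require Import ring lra.
Import Order.TTheory GRing.Theory Num.Theory.
Import numFieldTopology.Exports numFieldNormedType.Exports.
Local Open Scope classical_set_scope.
Local Open Scope ring_scope.

(* Convergence.  In the coordinate [u = F_j(v_j)] every [Upsilon_j] becomes the
   identity, so the finite-dimensional probabilities of [v] on products of
   half-open intervals are iterated integrals over [0, 1] of functions depending
   continuously on [rho] and on the values of the distribution functions at the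
   endpoints.  Since [f] is bounded, the sequence
   [z = (v_j, f(theta_j))_j] takes values in a compact product of rectangles; a
   continuous functional of [z] is uniformly close to a step function on a
   finite grid avoiding the atoms of the law of [f(theta_0)], and expectations
   of such step functions converge.  The weights are a continuous functional of
   [z].  The integral of [f] is approximated by its first [k] terms, with an
   error controlled by the expected remaining stick, which tends to [0] with [k]
   because the limit process is proper.

   For [rho = 1] the monotone likelihood ratio of the beta laws gives
   [F_j <= F_(j+1)], hence [Upsilon_j x <= x] and [w] is non-increasing.

   Size-biased invariance.  For independent beta sticks,
   [(1 - v_j) dP] is invariant under the map of the sticks that exchanges [w_j]
   and [w_(j+1)]: in the variables [p = v_j], [q = (1 - v_j) v_(j+1)] it has a
   density symmetric in [p] and [q].  Repeated exchanges move the size-biased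
   pick to the first free place: with [r_n] the remaining mass [R_n / R_m] times
   the conditional probability given that [n] is picked, the invariance turns
   [r_n - r_(n+1)] into the contribution of picking [n], and the sum telescopes
   to [r_m]. *)

(** * Integration and distribution functions *)

(** The processes live on unrelated probability spaces, so no pointwise limit is available: every
    comparison goes through the finite-dimensional formula, which involves the parameters only. For
    [0 < rho] the law of [v] charges the graphs of the maps [Upsilon j], and weak convergence of the
    marginals says nothing directly about rectangles. In the coordinate [u] a rectangle becomes a
    product of indicators of intervals []F c, F d]], which converge except at two values of [u], and
    bounded convergence applies stage by stage. The infinite sum is not continuous for the product
    topology; the truncation level is read off the limit process and then serves for all large [n].

    No infinite random permutation is built for size-biased picks: one pick at a time is replaced by
    a deterministic index. The exchange of two sticks preserves only the law reweighted by
    [1 - v_n], and this weight is supplied by [R_(n+1) = R_n (1 - v_n)]; hence the remaining mass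
    [R_n], and not [w_n], is carried through the exchanges. *)

Section generic_integral.
Context {d} {T : measurableType d} {R : realType}.
Implicit Types mu nu : {measure set T -> \bar R}.
Local Open Scope ereal_scope.
Import HBNNSimple.

(** Neither [f] nor [g] has to be measurable, so integrands such as [sb_integral] can be replaced
    almost everywhere. The integral is a supremum over simple functions: one that lies below [f],
    cut off to [0] on [N], lies below [g] and keeps its integral. *)
Lemma ge0_integral_eq_off_null mu (N : set T) (f g : T -> \bar R) :
  measurable N -> mu N = 0 -> (forall x, 0 <= f x) -> (forall x, 0 <= g x) ->
  (forall x, ~ N x -> f x = g x) -> \int[mu]_x f x = \int[mu]_x g x.
Proof.
move=> mN N0.
suff H : forall f g : T -> \bar R, (forall x, 0 <= f x) -> (forall x, 0 <= g x) ->
    (forall x, ~ N x -> f x = g x) -> \int[mu]_x f x <= \int[mu]_x g x.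
  move=> f0 g0 fg; apply/eqP; rewrite eq_le !H// => x Nx; exact/esym/fg.
move=> {}f {}g f0 g0 fg.
rewrite !ge0_integralTE//; apply: ge_ereal_sup => _ [h /= hf <-].
apply: ereal_sup_ubound; exists (proj_nnsfun h (measurableC mN)) => /=.
  move=> x; rewrite mindicE; case: (boolP (x \in ~` N)) => [|_].
    by rewrite inE => /fg <-; rewrite mulr1.
  by rewrite mulr0.
rewrite -!integralT_nnsfun; apply: ge0_ae_eq_integral => //.
- exact/measurable_EFinP/measurable_funP.
- exact/measurable_EFinP/measurable_funP.
- by move=> x _; rewrite lee_fin; apply: fun_ge0.
- by move=> x _; rewrite lee_fin; exact: fun_ge0.
exists N; split => // x /=; apply: contra_notP => Nx _ /=.
by rewrite mindicE mem_set// mulr1.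
Qed.

Lemma integral_eq_off_null mu (N : set T) (f g : T -> \bar R) :
  measurable N -> mu N = 0 -> (forall x, ~ N x -> f x = g x) ->
  \int[mu]_x f x = \int[mu]_x g x.
Proof.
move=> mN N0 fg; rewrite integralE [RHS]integralE; congr (_ - _);
  by apply: (ge0_integral_eq_off_null mu N) => // x /fg fgx; rewrite ?funeposE ?funenegE fgx.
Qed.

Lemma integral_eq_ae mu (f g : T -> \bar R) :
  {ae mu, forall x, f x = g x} -> \int[mu]_x f x = \int[mu]_x g x.
Proof.
move=> [N [mN N0 sN]]; apply: (integral_eq_off_null mu N) => // x Nx.
by apply: contrapT => fg; apply: Nx; exact: sN.
Qed.

(** Additivity and homogeneity reach simple functions, monotone convergence reaches the rest: these
    properties extend an identity of functionals from indicators to all nonnegative measurable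
    functions. *)
Definition integral_like (L : (T -> \bar R) -> \bar R) : Prop :=
    [/\ forall f g, (forall x, 0 <= f x) -> (forall x, 0 <= g x) ->
          measurable_fun setT f -> measurable_fun setT g ->
          L (fun x => f x + g x) = L f + L g,
        forall (r : R) f, (0 <= r)%R -> (forall x, 0 <= f x) -> measurable_fun setT f ->
          L (fun x => r%:E * f x) = r%:E * L f &
        forall (F : nat -> T -> \bar R) (f : T -> \bar R), (forall n x, 0 <= F n x) ->
          (forall n, measurable_fun setT (F n)) ->
          (forall x, nondecreasing_seq (F ^~ x)) -> (forall x, F ^~ x @ \oo --> f x) ->
          measurable_fun setT f -> (L \o F) @ \oo --> L f].

Lemma ge0_mfun_ind (L1 L2 : (T -> \bar R) -> \bar R) :
  (forall A, measurable A -> L1 (fun x => (\1_A x)%:E) = L2 (fun x => (\1_A x)%:E)) ->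
  (forall L, L = L1 \/ L = L2 -> integral_like L) ->
  forall f, (forall x, 0 <= f x) -> measurable_fun setT f -> L1 f = L2 f.
Proof.
move=> LI HL f f0 mf.
have [D1 Z1 C1] := HL L1 (or_introl erefl).
have [D2 Z2 C2] := HL L2 (or_intror erefl).
pose f_ := nnsfun_approx measurableT mf.
have f_0 n x : 0 <= (f_ n x)%:E by rewrite lee_fin; exact: fun_ge0.
have mf_ n : measurable_fun setT (fun x => (f_ n x)%:E).
  exact/measurable_EFinP/measurable_funP.
have f_nd x : nondecreasing_seq (fun n => (f_ n x)%:E).
  by move=> m n mn; rewrite lee_fin; exact/lefP/nd_nnsfun_approx.
have f_c x : (fun n => (f_ n x)%:E) @ \oo --> f x.
  exact: (cvg_nnsfun_approx measurableT mf (fun x _ => f0 x) _).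
have := C1 (fun n x => (f_ n x)%:E) f f_0 mf_ f_nd f_c mf.
have := C2 (fun n x => (f_ n x)%:E) f f_0 mf_ f_nd f_c mf.
suff -> : L1 \o (fun n x => (f_ n x)%:E) = L2 \o (fun n x => (f_ n x)%:E).
  by move=> c2 c1; apply: cvg_unique c1 c2.
apply/funext => n /=; move: (f_ n) => h {f_ f_0 mf_ f_nd f_c}.
have -> : (fun x => (h x)%:E) =
    (fun x => \sum_(y <- finmap.enum_fset (fset_set (range h))) y%:E * (\1_(h @^-1` [set y]) x)%:E).
  apply/funext => x; rewrite fimfunE fsbig_finite//= -sumEFin.
  by apply: eq_bigr => y _; rewrite EFinM.
have : forall y, y \in finmap.enum_fset (fset_set (range h)) -> (0 <= y)%R.
  by move=> y; rewrite in_fset_set// inE => -[x _ <-]; exact: fun_ge0.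
elim: (finmap.enum_fset _) => [_|y s IH ys].
  under eq_fun do rewrite big_nil.
  rewrite (_ : (fun=> 0) = (fun x => 0%:E * (\1_(@set0 T) x)%:E)); last first.
    by apply/funext => x; rewrite mul0e.
  have m0 : measurable_fun setT (fun x : T => (\1_(@set0 T) x : R)%:E).
    exact/measurable_EFinP/measurable_indic.
  by rewrite Z1 ?Z2 ?mul0e.
under eq_fun do rewrite big_cons.
have mh z : measurable (h @^-1` [set z]) by exact: measurable_funPTI.
have mi z : measurable_fun setT (fun x => (\1_(h @^-1` [set z]) x : R)%:E).
  exact/measurable_EFinP/measurable_indic.
have i0 z x : 0 <= (\1_(h @^-1` [set z]) x : R)%:E by rewrite lee_fin.
have y0 : (0 <= y)%R by apply: ys; rewrite mem_head.
have s0 z : z \in s -> (0 <= z)%R by move=> zs; apply: ys; rewrite inE zs orbT.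
have ms : measurable_fun setT (fun x => \sum_(y <- s) y%:E * (\1_(h @^-1` [set y]) x : R)%:E).
  apply: emeasurable_sum => z.
  by apply: emeasurable_funM => //.
have z0 x : 0 <= \sum_(j <- s) j%:E * (\1_(h @^-1` [set j]) x)%:E.
  by rewrite big_seq; apply: sume_ge0 => z zs; rewrite mule_ge0// lee_fin s0.
rewrite D1 ?D2//; try by [apply: emeasurable_funM | move=> x; rewrite mule_ge0// lee_fin].
by rewrite Z1// Z2// LI// IH.
Qed.

Lemma integral_like_integral mu :
  integral_like (fun f => \int[mu]_x f x).
Proof.
split.
- by move=> f g f0 g0 mf mg; rewrite ge0_integralD.
- by move=> r f r0 f0 mf; rewrite ge0_integralZl.
move=> F f F0 mF ndF Ff mf.
have -> : f = (fun x => limn (F ^~ x)) by apply/funext => x; apply/esym/cvg_lim.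
exact: cvg_monotone_convergence.
Qed.

Lemma ge0_integral_density mu nu (p : T -> R) :
  (forall x, 0 <= p x)%R -> measurable_fun setT p ->
  (forall A, measurable A -> nu A = \int[mu]_(x in A) (p x)%:E) ->
  forall f, (forall x, 0 <= f x) -> measurable_fun setT f ->
    \int[nu]_x f x = \int[mu]_x (f x * (p x)%:E).
Proof.
move=> p0 mp nup.
have mpE : measurable_fun setT (EFin \o p) by exact/measurable_EFinP.
apply: (ge0_mfun_ind (fun f => \int[nu]_x f x) (fun f => \int[mu]_x (f x * (p x)%:E))).
  move=> A mA; rewrite integral_indic// setIT nup// integral_mkcond.
  by apply: eq_integral => x _; rewrite epatch_indic muleC.
move=> _ [->|->]; first exact: integral_like_integral.
have [D Z C] := integral_like_integral mu; split.
- move=> f g f0 g0 mf mg; rewrite -D;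
    try by [exact: emeasurable_funM | move=> x; rewrite mule_ge0// lee_fin].
  by apply: eq_integral => x _; rewrite ge0_muleDl.
- move=> r f r0 f0 mf; rewrite -Z//;
    [|by move=> x; rewrite mule_ge0// lee_fin|exact: emeasurable_funM].
  by apply: eq_integral => x _; rewrite muleA.
- move=> F f F0 mF ndF Ff mf.
  apply: (C (fun n x => F n x * (p x)%:E) (fun x => f x * (p x)%:E)).
  + by move=> n x; rewrite mule_ge0// lee_fin.
  + by move=> n; exact: emeasurable_funM.
  + by move=> x m n mn; rewrite lee_wpmul2r// ?lee_fin// ndF.
  + by move=> x; apply: cvgeZr => //; exact: Ff.
  + exact: emeasurable_funM.
Qed.
End generic_integral.

(** * Image laws *)

Section law.
Context {d d'} {T : measurableType d} {T' : measurableType d'} {R : realType}.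
Variable P : probability T R.
Variables (f : T -> T') (mf : measurable_fun setT f).

Definition law_mfun : {mfun T >-> T'} := HB.pack f (isMeasurableFun.Build _ _ _ _ f mf).

Definition law : probability T' R := distribution P law_mfun.

Lemma lawE A : law A = P (f @^-1` A). Proof. by []. Qed.

Lemma ge0_integral_law (g : T' -> \bar R) D : measurable D ->
  measurable_fun setT g -> (forall x, 0 <= g x)%E ->
  (\int[law]_(x in D) g x = \int[P]_(x in f @^-1` D) g (f x))%E.
Proof.
move=> mD mg g0; rewrite ge0_integral_pushforward//.
exact: measurable_funTS.
Qed.

Lemma integral_law_bounded (g : T' -> R) : measurable_fun setT g ->
  (exists M, forall x, `|g x| <= M) ->
  (\int[law]_x (g x)%:E = \int[P]_x (g (f x))%:E)%E.
Proof.
move=> mg [M gM]; rewrite integral_pushforward//; first exact/measurable_EFinP.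
rewrite preimage_setT; apply: (@le_integrable _ _ _ _ _ _ _ (EFin \o cst M)) => //.
- by apply/measurable_EFinP; exact: measurableT_comp.
- by move=> x _ /=; rewrite lee_fin (le_trans (gM _))// ler_norm.
- exact: finite_measure_integrable_cst.
Qed.
End law.

Lemma measurable_id_measurableTypeR {R : realType} :
  measurable_fun setT ((fun x => x) : measurableTypeR R -> R).
Proof. exact: measurable_id. Qed.

(* [uniform_prob] lives on [measurableTypeR R]: this is its transport to the
   canonical measurable type on [R]. *)
Definition unif01 {R : realType} : probability R R :=
  law (uniform_prob (@ltr01 R)) _ measurable_id_measurableTypeR.

(** * Distribution functions and their generalized inverses *)

Section cdf_theory.
Context {R : realType}.
Implicit Types pi : probability R R.
Local Notation F := Defs.cdf.

Lemma cdfE pi x : (F pi x)%:E = pi `]-oo, x]%classic.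
Proof. by rewrite /F fineK// fin_num_measure. Qed.

Lemma cdf_nd pi : nondecreasing_fun (F pi).
Proof.
move=> x y xy; rewrite -lee_fin !cdfE le_measure ?inE//.
by move=> z /=; rewrite !in_itv/= => /le_trans; exact.
Qed.

Lemma cdf_ge0 pi x : 0 <= F pi x.
Proof. by rewrite -lee_fin cdfE. Qed.

Lemma cdf_le1 pi x : F pi x <= 1.
Proof. by rewrite -lee_fin cdfE probability_le1. Qed.

Lemma measurable_cdf pi : measurable_fun setT (F pi).
Proof. apply: nondecreasing_measurable => //; exact: cdf_nd. Qed.

Lemma prob_itvoc pi (a b : R) : a <= b -> pi `]a, b]%classic = (F pi b - F pi a)%:E.
Proof.
move=> ab; have -> : `]a, b]%classic = `]-oo, b]%classic `\` `]-oo, a]%classic.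
  by apply/seteqP; split=> x /=; rewrite !in_itv/= ltNge;
     [move=> /andP[/negP xa ->]|move=> [-> /negP ->]].
rewrite measureD//= ?probability_fin_num//.
  rewrite EFinB !cdfE; congr (_ - pi _)%E.
  by apply/seteqP; split=> x /=; rewrite !in_itv/=; [case|move=> xa; split=> //; exact: le_trans ab].
by rewrite ltey_eq fin_num_measure.
Qed.

(** Half-open intervals generate the Borel sets, are stable under intersection, and are differences
    of half-lines; finiteness on half-lines lets the measures be subtracted. *)
Lemma measure_eq_cdf (m1 m2 : {measure set R -> \bar R}) :
  (forall x, m1 `]-oo, x]%classic = m2 `]-oo, x]%classic) ->
  (forall x, m1 `]-oo, x]%classic < +oo)%E ->
  forall A, measurable A -> m1 A = m2 A.
Proof.
move=> m12 moo A mA.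
have oc a b : m1 `]a, b]%classic = m2 `]a, b]%classic.
  have [ab|ba] := leP a b; last by rewrite set_itv_ge ?bnd_simp -?leNgt ?ltW// !measure0.
  have -> : `]a, b]%classic = `]-oo, b]%classic `\` `]-oo, a]%classic.
    by apply/seteqP; split=> x /=; rewrite !in_itv/= ltNge;
       [move=> /andP[/negP xa ->]|move=> [-> /negP ->]].
  have E : `]-oo, b]%classic `&` `]-oo, a]%classic = `]-oo, a]%classic.
    by apply/seteqP; split=> x /=; rewrite !in_itv/=; [case|move=> xa; split=> //; exact: le_trans ab].
  by rewrite !measureD//= ?E ?m12// -?m12.
apply: (measure_unique (@ocitv R) (fun n => `]- n%:R, n%:R]%classic)) => //.
- exact: ocitvI.
- by move=> n; exact: is_ocitv.
- rewrite -subTset => x _; exists (Num.bound `|x|).+1 => //=; rewrite in_itv/=.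
  have := archi_boundP (normr_ge0 `|x|); rewrite normr_id => xb.
  have {}xb : `|x| < (Num.bound `|x|).+1%:R by rewrite (lt_trans xb)// ltr_nat.
  by move: xb; rewrite ltr_norml => /andP[-> /ltW].
- by move=> _ [[a b] _ <-]; exact: oc.
- move=> k; apply: le_lt_trans (moo k%:R); rewrite le_measure ?inE// => x /=.
  by rewrite !in_itv/= => /andP[].
Qed.

Section nice.
Variable pi : probability R R.
Hypothesis npi : nice_prob pi.

Lemma nice_out (A : set R) : measurable A -> A `&` `[0, 1]%classic = set0 -> pi A = 0%E.
Proof.
move=> mA A0; have [p01 _] := npi.
have m01 : measurable (`[0, 1]%classic : set R) by [].
have : (pi A + pi (`[0%R, 1%R]%classic : set R) <= 1)%E.
  by rewrite -measureU// probability_le1//; exact: measurableU.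
rewrite p01 => h; apply/eqP; rewrite eq_le measure_ge0 andbT.
by rewrite -(leeD2rE (x := 1%E))// add0e.
Qed.

Lemma cdf_lt0 x : x < 0 -> F pi x = 0.
Proof.
move=> x0; apply: EFin_inj; rewrite cdfE nice_out//.
apply/seteqP; split=> y //=; rewrite !in_itv/= => -[yx /andP[y0 _]].
by move: x0; rewrite ltNge (le_trans y0).
Qed.

Lemma cdf_le0 x : x <= 0 -> F pi x = 0.
Proof.
rewrite le_eqVlt => /predU1P[->|]; last exact: cdf_lt0.
apply/eqP; rewrite eq_le cdf_ge0 andbT leNgt; apply/negP => F0.
have [_ [/(_ 0) cF _]] := npi.
have : \forall x \near (0:R), 0 < F pi x by exact: (cF _ (lt_nbhsr F0)).
move=> /nbhs_ballP[e /= e0 /(_ (- (e / 2)))].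
rewrite /ball/= sub0r opprK gtr0_norm ?divr_gt0// cdf_lt0 ?ltxx ?oppr_lt0 ?divr_gt0//.
by move=> /(_ _)/negP; apply; rewrite ?negbK // ltr_pdivrMr// ltr_pMr// ltr1n.
Qed.

Lemma cdf_ge1 x : 1 <= x -> F pi x = 1.
Proof.
move=> x1; apply/eqP; rewrite eq_le cdf_le1/= -lee_fin cdfE; have [p01 _] := npi.
rewrite -p01 le_measure ?inE// => y /=; rewrite !in_itv/= => /andP[_ y1].
exact: le_trans x1.
Qed.

Let S u := [set x | u <= F pi x].

Let has_inf_S u : 0 < u <= 1 -> has_inf (S u).
Proof.
move=> /andP[u0 u1]; split; first by exists 1; rewrite /S/= cdf_ge1.
exists 0 => x; rewrite /S/= leNgt => ux; rewrite leNgt; apply: contra ux => x0.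
by rewrite cdf_lt0.
Qed.

(** The set whose infimum is taken is empty for [u > 1] and the whole line for [u <= 0]; in both
    cases [inf] takes its default value [0]. *)
Lemma cdf_inv_out u : ~~ (0 < u <= 1) -> cdf_inv pi u = 0.
Proof.
move=> u01; rewrite /cdf_inv inf_out// => -[[x /= ux] [y lby]].
move: u01; rewrite (le_trans ux (cdf_le1 _ _)) andbT -leNgt => u0.
have : u <= F pi (y - 1) by rewrite (le_trans u0)// cdf_ge0.
by move/lby; rewrite leNgt ltrBlDr ltrDl ltr01.
Qed.

(** Continuity of [F] at the infimum [q] excludes both inequalities. If [u < F q], points slightly
    left of [q] still belong to the set; if [F q < u], no point slightly right of [q] does, although
    such points approach the infimum. *)
Lemma cdf_cdf_inv u : 0 < u <= 1 -> F pi (cdf_inv pi u) = u.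
Proof.
move=> u01; have [_ [/(_ (cdf_inv pi u)) cF _]] := npi.
apply/eqP; rewrite eq_le !leNgt; apply/andP; split; apply/negP => Fu.
- have : \forall x \near cdf_inv pi u, u < F pi x by exact: (cF _ (lt_nbhsr Fu)).
  move=> /nbhs_ballP[e /= e0 /(_ (cdf_inv pi u - e / 2))].
  rewrite /ball/= opprB addrC subrK gtr0_norm ?divr_gt0//.
  rewrite ltr_pdivrMr// ltr_pMr// ltr1n => /(_ isT) /ltW h.
  have : cdf_inv pi u <= cdf_inv pi u - e / 2 by apply: ge_inf => //; case: (has_inf_S u u01).
  by rewrite leNgt ltrBlDr ltrDl divr_gt0.
- have : \forall x \near cdf_inv pi u, F pi x < u by exact: (cF _ (lt_nbhsl Fu)).
  move=> /nbhs_ballP[e /= e0 eF].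
  have [x Sx xe] := inf_adherent e0 (has_inf_S u u01).
  have xi : cdf_inv pi u <= x by apply: ge_inf => //; case: (has_inf_S u u01).
  have := eF x; rewrite /ball/= distrC ger0_norm ?subr_ge0// ltrBlDl => /(_ xe).
  by rewrite ltNge => /negP; apply.
Qed.

Lemma cdf_inv_le u x : 0 < u <= 1 -> (cdf_inv pi u <= x) = (u <= F pi x).
Proof.
move=> u01; apply/idP/idP => [ux|ux].
  by rewrite -[leLHS](cdf_cdf_inv u u01) cdf_nd.
by apply: ge_inf => //; case: (has_inf_S u u01).
Qed.

Lemma cdf_inv_ge0 u : 0 <= cdf_inv pi u.
Proof.
have [u01|/cdf_inv_out -> //] := boolP (0 < u <= 1).
apply: lb_le_inf; first by case: (has_inf_S u u01).
move=> x ux; rewrite leNgt; apply/negP => x0; move: ux => /=.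
by rewrite cdf_lt0// leNgt; case/andP: u01 => ->.
Qed.

Lemma cdf_inv_le1 u : cdf_inv pi u <= 1.
Proof.
have [u01|/cdf_inv_out -> //] := boolP (0 < u <= 1).
by rewrite cdf_inv_le// cdf_ge1//; case/andP: u01.
Qed.

Lemma measurable_cdf_inv : measurable_fun setT (cdf_inv pi).
Proof.
apply: (measurability _ (RGenOInfty.measurableE R)) => _ [_ [x ->] <-]; rewrite setTI.
have -> : cdf_inv pi @^-1` `]x, +oo[%classic =
    (`]0, 1]%classic `&` `]F pi x, +oo[%classic) `|`
    (~` `]0, 1]%classic `&` [set _ | x < 0]).
  apply/seteqP; split=> u /=; rewrite !in_itv/= !andbT.
    have [u01|u01] := boolP (0 < u <= 1).
      by rewrite ltNge cdf_inv_le// -ltNge => ->; left.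
    by rewrite cdf_inv_out// => x0; right; split => //; apply/negP.
  move=> [[u01]|[/negP u01]]; last by rewrite cdf_inv_out.
  by rewrite ltNge -cdf_inv_le// -ltNge.
apply: measurableU; first exact: measurableI.
apply: measurableI; first exact: measurableC.
have [x0|x0] := boolP (x < 0).
  by rewrite (_ : [set _ | _] = setT)//; apply/seteqP; split.
by rewrite (_ : [set _ | _] = set0)//; apply/seteqP; split.
Qed.

Lemma uniform01E (A : set R) : measurable A ->
  @unif01 R A = lebesgue_measure (A `&` `[0, 1]%classic).
Proof.
move=> mA; transitivity (uniform_prob (@ltr01 R) A) => //; rewrite /uniform_prob integral_uniform_pdf.
rewrite (eq_integral (fun=> 1%:E)); last first.
  by move=> x; rewrite inE/= in_itv/= /uniform_pdf => -[_ ->]; rewrite subr0 invr1.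
by rewrite integral_cst ?mul1e//; exact: measurableI.
Qed.

Lemma uniform01_le x : 0 <= x <= 1 -> @unif01 R `]-oo, x]%classic = x%:E.
Proof.
move=> /andP[x0 x1]; rewrite uniform01E//.
rewrite (_ : _ `&` _ = `[0, x]%classic); last first.
  apply/seteqP; split=> y /=; rewrite !in_itv/=; first by move=> [-> /andP[->]].
  by move=> /andP[y0 yx]; rewrite yx y0 (le_trans yx).
rewrite lebesgue_measure_itv/= lte_fin; have [->|xn0] := eqVneq x 0; first by rewrite ltxx.
by rewrite lt_neqAle eq_sym xn0 x0/= oppr0 addr0.
Qed.

(** The quantile transform: [cdf_inv pi] applied to a uniform variable has law [pi]. It suffices to
    compare half-lines, through the equivalence [cdf_inv_le]. *)
Lemma nice_pushforward A : measurable A ->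
  pi A = unif01 (cdf_inv pi @^-1` A).
Proof.
move=> mA.
rewrite -(lawE unif01 _ measurable_cdf_inv).
apply: (measure_eq_cdf pi (law unif01 _ measurable_cdf_inv)) => // x; last first.
  by rewrite ltey_eq fin_num_measure.
transitivity (F pi x)%:E; first by rewrite cdfE.
transitivity (unif01 (cdf_inv pi @^-1` `]-oo, x]%classic)); last by [].
have m0 : @unif01 R [set 0 : R] = 0%E.
  rewrite uniform01E// (_ : _ `&` _ = [set 0]) ?lebesgue_measure_set1//.
  by apply/seteqP; split=> y /=; [case|move=> ->; rewrite in_itv/= lexx ler01].
have x01 : 0 <= F pi x <= 1 by rewrite cdf_ge0 cdf_le1.
rewrite -(uniform01_le _ x01) !uniform01E//; last first.
  by rewrite -[X in measurable X]setTI; exact: measurable_cdf_inv.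
have [x0|x0] := leP 0 x; last first.
  rewrite cdf_lt0// (_ : _ `&` _ = [set 0]); last first.
    apply/seteqP; split=> y /=; rewrite !in_itv/=.
      by move=> [y0 /andP[? _]]; apply/eqP; rewrite eq_le y0.
    by move=> ->; rewrite !lexx ler01.
  rewrite (_ : _ `&` _ = set0) ?measure0 ?lebesgue_measure_set1//.
  apply/seteqP; split=> y //=; rewrite !in_itv/= => -[yx _].
  by have := le_lt_trans yx x0; rewrite ltNge cdf_inv_ge0.
congr (lebesgue_measure _); apply/seteqP; split=> y /=; rewrite !in_itv/= => -[yx yu]; split => //.
  have [->|y0] := eqVneq y 0.
    by rewrite cdf_inv_out// ltxx.
  by rewrite cdf_inv_le// lt_neqAle eq_sym y0.
have [y0|y0] := eqVneq y 0; first by rewrite y0 cdf_ge0.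
by rewrite -cdf_inv_le// lt_neqAle eq_sym y0.
Qed.
End nice.
End cdf_theory.

(** * Weak convergence and distribution functions on the line *)

Section weak_cdf.
Context {R : realType}.
Local Notation F := Defs.cdf.

(** For [a < b], the continuous function equal to [1] up to [a], to [0] from [b] on, and affine in
    between. *)
Definition ramp (a b y : R) : R := Num.max 0 (Num.min 1 ((b - y) / (b - a))).

Lemma ramp_continuous a b : continuous (ramp a b).
Proof.
move=> y; apply: (@continuous_max _ _ (cst 0) (fun y => Num.min 1 ((b - y) / (b - a)))).
  exact: cvg_cst.
apply: (@continuous_min _ _ (cst 1) (fun y => (b - y) / (b - a))); first exact: cvg_cst.
apply: cvgM; last exact: cvg_cst.
by apply: cvgB; [exact: cvg_cst|exact: cvg_id].
Qed.

Lemma ramp_ge0 a b y : 0 <= ramp a b y.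
Proof. by rewrite /ramp le_max lexx. Qed.

Lemma ramp_le1 a b y : ramp a b y <= 1.
Proof. by rewrite /ramp ge_max ler01/= ge_min lexx. Qed.

Lemma ramp_indic_ge (a b y : R) : a < b -> \1_(`]-oo, a]) y <= ramp a b y.
Proof.
move=> ab; rewrite indicE; case: (boolP (y \in _)) => [|_]; last exact: ramp_ge0.
rewrite inE/= in_itv/= => ya; rewrite /ramp le_max le_min lexx/=; apply/orP; right.
by rewrite ler_pdivlMr ?subr_gt0// mul1r lerD2l lerN2.
Qed.

Lemma ramp_indic_le (a b y : R) : a < b -> ramp a b y <= \1_(`]-oo, b]) y.
Proof.
move=> ab; rewrite indicE; case: (boolP (y \in _)) => [_|]; first exact: ramp_le1.
rewrite notin_setE/= in_itv/= => /negP; rewrite -ltNge => yb.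
rewrite /ramp ge_max lexx/= ge_min; apply/orP; right.
by rewrite pmulr_lle0 ?invr_gt0 ?subr_gt0// subr_le0 ltW.
Qed.

Lemma ramp_cdf (mu : probability R R) a b : a < b ->
  (\int[mu]_y (ramp a b y)%:E)%E \is a fin_num /\
  F mu a <= fine (\int[mu]_y (ramp a b y)%:E) <= F mu b.
Proof.
move=> ab.
have mr : measurable_fun setT (fun y => (ramp a b y)%:E).
  by apply/measurable_EFinP; apply: continuous_measurable_fun; exact: ramp_continuous.
have mi (c : R) : measurable_fun setT (fun y : R => (\1_(`]-oo, c]) y : R)%:E).
  exact/measurable_EFinP/measurable_indic.
have fI (c : R) : (\int[mu]_y (\1_(`]-oo, c]) y)%:E = (F mu c)%:E)%E.
  by rewrite integral_indic// setIT cdfE.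
have h1 : ((F mu a)%:E <= \int[mu]_y (ramp a b y)%:E)%E.
  rewrite -fI; apply: ge0_le_integral => //.
  - by move=> y _; rewrite lee_fin ramp_indic_ge.
have h2 : (\int[mu]_y (ramp a b y)%:E <= (F mu b)%:E)%E.
  rewrite -fI; apply: ge0_le_integral => //.
  - by move=> y _; rewrite lee_fin ramp_ge0.
  - by move=> y _; rewrite lee_fin ramp_indic_le.
have ff : (\int[mu]_y (ramp a b y)%:E)%E \is a fin_num.
  by rewrite ge0_fin_numE ?(le_lt_trans h2) ?ltry// (le_trans _ h1)// lee_fin cdf_ge0.
split => //; apply/andP; split; rewrite -lee_fin (fineK ff); [exact: h1|exact: h2].
Qed.

(** Continuity of the distribution function at [x]. From the right it is continuity of the measure
    along decreasing half-lines; from the left the half-lines increase to []-oo, x[], which has the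
    mass of []-oo, x]] because [x] is not an atom. *)
Lemma cdf_near (mu : probability R R) x e : mu [set x] = 0%E -> 0 < e ->
  exists2 dl : R, 0 < dl & F mu (x + dl) < F mu x + e /\ F mu x - e < F mu (x - dl).
Proof.
move=> mx0 e0.
have c1 : (fun k => F mu (x + k.+1%:R^-1)) @ \oo --> F mu x.
  suff : (fun k => mu `]-oo, x + k.+1%:R^-1]%classic) @ \oo --> mu `]-oo, x]%classic.
    by rewrite -cdfE; under eq_fun do rewrite -cdfE; move/fine_cvg.
  have -> : `]-oo, x]%classic = \bigcap_k `]-oo, x + k.+1%:R^-1]%classic.
    apply/seteqP; split=> y /=.
      by rewrite in_itv/= => yx k _; rewrite /= in_itv/= (le_trans yx)// lerDl.
    move=> h; rewrite in_itv/= leNgt; apply/negP => xy.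
    have := h (Num.bound (y - x)^-1) I; rewrite /= in_itv/= -lerBlDl leNgt => /negP; apply.
    rewrite invf_plt ?posrE ?subr_gt0//.
    by rewrite (lt_trans (archi_boundP _))// ?ltr_nat// invr_ge0 subr_ge0 ltW.
  apply: nonincreasing_cvg_mu => //.
  - by rewrite ltey_eq fin_num_measure.
  - exact: bigcap_measurable.
  - move=> m n mn; apply/subsetPset => y /=; rewrite !in_itv/= => /le_trans; apply.
    by rewrite lerD2l lef_pV2 ?posrE ?ltr0n// ler_nat.
have c2 : (fun k => F mu (x - k.+1%:R^-1)) @ \oo --> F mu x.
  suff : (fun k => mu `]-oo, x - k.+1%:R^-1]%classic) @ \oo --> mu `]-oo, x[%classic.
    have -> : mu `]-oo, x[%classic = mu `]-oo, x]%classic.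
      have -> : `]-oo, x]%classic = `]-oo, x[%classic `|` [set x].
        apply/seteqP; split=> y /=; rewrite !in_itv/= le_eqVlt.
          by move=> /predU1P[|]; [right|left].
        by move=> [->|->]; rewrite ?eqxx ?orbT.
      rewrite measureU//=; first by rewrite mx0 adde0.
      by apply/seteqP; split=> y //=; rewrite in_itv/= => -[yx yE]; rewrite yE ltxx in yx.
    by rewrite -cdfE; under eq_fun do rewrite -cdfE; move/fine_cvg.
  have -> : `]-oo, x[%classic = \bigcup_k `]-oo, x - k.+1%:R^-1]%classic.
    apply/seteqP; split=> y /=; rewrite in_itv/=.
      move=> yx; exists (Num.bound (x - y)^-1) => //=; rewrite in_itv/= lerBrDr -lerBrDl.
      rewrite ltW// invf_plt ?posrE ?subr_gt0//.
      by rewrite (lt_trans (archi_boundP _))// ?ltr_nat// invr_ge0 subr_ge0 ltW.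
    by move=> [k _]; rewrite /= in_itv/= => /le_lt_trans; apply; rewrite ltrBlDr ltrDl.
  apply: nondecreasing_cvg_mu => //.
  - exact: bigcup_measurable.
  - move=> m n mn; apply/subsetPset => y /=; rewrite !in_itv/= => /le_trans; apply.
    by rewrite lerD2l lerN2 lef_pV2 ?posrE ?ltr0n// ler_nat.
have [N _ hN] : \forall k \near \oo, F mu (x + k.+1%:R^-1) < F mu x + e /\
    F mu x - e < F mu (x - k.+1%:R^-1).
  near=> k; split; near: k.
    apply: (cvgr_lt _ c1); by rewrite ltrDl.
  by apply: (cvgr_gt _ c2); rewrite ltrBlDr ltrDl.
by exists N.+1%:R^-1 => //; exact: hN N (leqnn N).
Unshelve. all: by end_near. Qed.

(** The indicator of []-oo, x]] lies between the ramps on [[x - dl, x]] and on [[x, x + dl]]. The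
    integrals of these ramps converge, and their limits are within [e / 2] of [F mu x] by continuity
    there. *)
Lemma weak_cvg_cdf (mun : nat -> probability R R) (mu : probability R R) x :
  weak_cvg_R mun mu -> mu [set x] = 0%E -> (fun n => F (mun n) x) @ \oo --> F mu x.
Proof.
move=> mumu mx0; apply/cvgrPdist_lt => e e0.
have [dl dl0 [h1 h2]] := cdf_near mu x _ mx0 (divr_gt0 e0 (ltr0Sn R 1)).
have rc a b : a < b -> (fun n => fine (\int[mun n]_y (ramp a b y)%:E)) @ \oo -->
    fine (\int[mu]_y (ramp a b y)%:E).
  move=> ab; apply: fine_cvg; have [fn _] := ramp_cdf mu _ _ ab; rewrite fineK//.
  apply: mumu; first exact: ramp_continuous.
  by exists 1 => y; rewrite ger0_norm ?ramp_ge0// ramp_le1.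
have xl : x - dl < x by rewrite ltrBlDr ltrDl.
have xr : x < x + dl by rewrite ltrDl.
have [_ /andP[_ u1]] := ramp_cdf mu _ _ xr.
have [_ /andP[l1 _]] := ramp_cdf mu _ _ xl.
near=> n.
have [_ /andP[u2 _]] := ramp_cdf (mun n) _ _ xr.
have [_ /andP[_ l2]] := ramp_cdf (mun n) _ _ xl.
have a1 : fine (\int[mun n]_y (ramp x (x + dl) y)%:E) < fine (\int[mu]_y (ramp x (x + dl) y)%:E) + e / 2.
  by near: n; apply: (cvgr_lt _ (rc _ _ xr)); rewrite ltrDl divr_gt0.
have a2 : fine (\int[mun n]_y (ramp (x - dl) x y)%:E) > fine (\int[mu]_y (ramp (x - dl) x y)%:E) - e / 2.
  by near: n; apply: (cvgr_gt _ (rc _ _ xl)); rewrite ltrBlDr ltrDl divr_gt0.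
rewrite ltr_norml; apply/andP; split; lra.
Unshelve. all: by end_near. Qed.
End weak_cdf.

(** * Bounded convergence *)

Section bounded_convergence.
Context {d} {T : measurableType d} {R : realType}.
Variable P : probability T R.

Lemma integrable_bounded (f : T -> R) (M : R) : measurable_fun setT f ->
  (forall x, `|f x| <= M) -> P.-integrable setT (EFin \o f).
Proof.
move=> mf fM; apply: (@le_integrable _ _ _ _ _ _ _ (EFin \o cst M)) => //.
- exact/measurable_EFinP.
- by move=> x _ /=; rewrite lee_fin (le_trans (fM _))// ler_norm.
- exact: finite_measure_integrable_cst.
Qed.

Lemma integral_bounded_fin (f : T -> R) (M : R) : measurable_fun setT f ->
  (forall x, `|f x| <= M) -> (\int[P]_x (f x)%:E)%E \is a fin_num.
Proof. by move=> mf fM; apply: integrable_fin_num => //; exact: integrable_bounded fM. Qed.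

Lemma bounded_cvg_integral (f_ : nat -> T -> R) (f : T -> R) (M : R) :
  (forall n, measurable_fun setT (f_ n)) -> measurable_fun setT f ->
  (forall n x, `|f_ n x| <= M) -> (forall x, `|f x| <= M) ->
  {ae P, forall x, f_ ^~ x @ \oo --> f x} ->
  (fun n => fine (\int[P]_x (f_ n x)%:E)) @ \oo --> fine (\int[P]_x (f x)%:E).
Proof.
move=> mf_ mf f_M fM f_f; apply: fine_cvg.
rewrite fineK; last exact: integral_bounded_fin fM.
have [] := @dominated_convergence _ _ _ P setT measurableT (fun n x => (f_ n x)%:E)
  (fun x => (f x)%:E) (cst M%:E).
- by move=> n; exact/measurable_EFinP.
- exact/measurable_EFinP.
- apply: filterS f_f => x h _; exact: cvg_comp h _.
- exact: finite_measure_integrable_cst.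
- by apply: aeW => x n _; rewrite lee_fin.
by [].
Qed.

End bounded_convergence.

(** * The chain in the uniform coordinate *)

Section cells.
Context {R : realType}.
Local Notation F := Defs.cdf.
Local Notation U := (@unif01 R).

Definition cell (pi : probability R R) (c d u : R) : R :=
  \1_(`]F pi c, F pi d]%classic : set R) u.

Lemma cell01 pi c d u : 0 <= cell pi c d u <= 1.
Proof. by rewrite /cell indicE; case: (_ \in _); rewrite /= ?ler01 ?lexx. Qed.

Lemma measurable_cell pi c d : measurable_fun setT (cell pi c d).
Proof. exact: measurable_indic. Qed.

Lemma uniform01_ae : {ae U, forall u : R, 0 < u <= 1}.
Proof.
exists (~` `]0, 1]%classic); split.
- exact: measurableC.
- rewrite uniform01E; last exact: measurableC.
  rewrite (_ : _ `&` _ = [set 0]) ?lebesgue_measure_set1//.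
  apply/seteqP; split=> y /=; rewrite !in_itv/=.
    move=> [/negP h /andP[y0 y1]]; apply/eqP; rewrite eq_le y0 andbT leNgt.
    by apply: contra h => ->.
  by move=> ->; rewrite ltxx lexx ler01.
- by move=> u /=; rewrite in_itv.
Qed.

Lemma uniform01_ae_neq (a : R) : {ae U, forall u : R, u != a}.
Proof.
exists [set a]; split => //.
- rewrite uniform01E//; apply/eqP; rewrite eq_le measure_ge0 andbT.
  rewrite -(lebesgue_measure_set1 a) le_measure ?inE//; exact: measurableI.
- by move=> u /= /negP; rewrite negbK => /eqP.
Qed.

Lemma cell_cdf_inv (pi : probability R R) (c d u : R) : nice_prob pi -> 0 < u <= 1 ->
  \1_(`]c, d]%classic : set R) (cdf_inv pi u) = cell pi c d u.
Proof.
move=> npi u01; rewrite /cell !indicE !mem_setE/= !in_itv/=.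
by rewrite !ltNge !cdf_inv_le.
Qed.

Lemma integral_cell (pi : probability R R) (c d : R) (h : R -> \bar R) (g : R -> R) :
  nice_prob pi -> measurable_fun setT h -> (forall x, 0 <= h x)%E ->
  (forall u, 0 < u <= 1 -> h (cdf_inv pi u) = (g u)%:E) ->
  (\int[pi]_(y in `]c, d]%classic) h y = \int[U]_u (cell pi c d u * g u)%:E)%E.
Proof.
move=> npi mh h0 hg.
rewrite (eq_measure_integral (law U _ (measurable_cdf_inv _ npi))); last first.
  by move=> A mA _; exact: nice_pushforward.
rewrite ge0_integral_law// integral_mkcond; apply: integral_eq_ae.
apply: filterS uniform01_ae => u u01; rewrite patchE -cell_cdf_inv// indicE/=.
rewrite (_ : (u \in _) = (cdf_inv pi u \in `]c, d]%classic)); last first.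
  by rewrite !mem_setE.
by case: ifPn => _; rewrite ?mul1r ?mul0r// hg.
Qed.

Section chain.
Variables (rho : R) (pis : nat -> probability R R).
Hypotheses (rho01 : 0 <= rho <= 1) (npis : forall j, nice_prob (pis j)).

Lemma measurable_Upsilon j : measurable_fun setT (Upsilon pis j).
Proof.
apply: measurableT_comp; last exact: measurable_cdf.
exact: measurable_cdf_inv.
Qed.

Let rho0 : 0 <= rho. Proof. by case/andP: rho01. Qed.
Let rho1 : 0 <= 1 - rho. Proof. by rewrite subr_ge0; case/andP: rho01. Qed.

Lemma mc_fdd_from_ge0 A m j x : (0 <= mc_fdd_from rho pis A m j x)%E.
Proof.
elim: m j x => [|m IH] j x /=; first by [].
apply: adde_ge0; apply: mule_ge0 => //; rewrite ?lee_fin ?mulr_ge0//.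
by apply: integral_ge0 => y _.
Qed.

Lemma measurable_mc_fdd_from A m j : (forall i, measurable (A i)) ->
  measurable_fun setT (mc_fdd_from rho pis A m j).
Proof.
move=> mA; elim: m j => [|m IH] j /=; first exact: measurable_cst.
apply: emeasurable_funD; last exact: measurable_cst.
apply: emeasurable_funM.
  apply/measurable_EFinP; apply: measurable_funM => //.
  apply: measurableT_comp; last exact: measurable_Upsilon.
  exact: measurable_indic.
apply: (measurableT_comp (IH _)); exact: measurable_Upsilon.
Qed.

Variables c d : nat -> R.
Local Notation A := (fun i => `]c i, d i]%classic : set R).

(* The conditional probability [mc_fdd_from] in the coordinate [u = F_j(x)], in
   which the deterministic moves [Upsilon] disappear. *)
Fixpoint hrec (m j : nat) (u : R) : R :=
  match m with
  | 0 => 1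
  | m'.+1 =>
    rho * (cell (pis j.+1) (c j.+1) (d j.+1) u * hrec m' j.+1 u) +
    (1 - rho) * fine (\int[U]_t (cell (pis j.+1) (c j.+1) (d j.+1) t * hrec m' j.+1 t)%:E)
  end.

(** The two claims need a joint induction: the integral inside [hrec] is finite and at most [1]
    because the previous stage is both measurable and bounded. *)
Lemma hrec_prop m j : measurable_fun setT (hrec m j) /\ (forall u, 0 <= hrec m j u <= 1).
Proof.
elim: m j => [|m IH] j /=.
  by split=> [|u]; [exact: measurable_cst|rewrite ler01 lexx].
have [mh h01] := IH j.+1.
have mc : measurable_fun setT
    (fun t => cell (pis j.+1) (c j.+1) (d j.+1) t * hrec m j.+1 t).
  by apply: measurable_funM => //; exact: measurable_cell.
have ch u : 0 <= cell (pis j.+1) (c j.+1) (d j.+1) u * hrec m j.+1 u <= 1.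
  have /andP[c0 c1] := cell01 (pis j.+1) (c j.+1) (d j.+1) u.
  by have /andP[h0 h1] := h01 u; rewrite mulr_ge0//= mulr_ile1.
have fi : (\int[U]_t (cell (pis j.+1) (c j.+1) (d j.+1) t * hrec m j.+1 t)%:E)%E \is a fin_num.
  apply: (integral_bounded_fin _ _ 1) => // x.
  by have /andP[h0 h1] := ch x; rewrite ger0_norm.
have i01 : 0 <= fine (\int[U]_t (cell (pis j.+1) (c j.+1) (d j.+1) t * hrec m j.+1 t)%:E) <= 1.
  apply/andP; split.
    by apply: fine_ge0; apply: integral_ge0 => x _; rewrite lee_fin; case/andP: (ch x).
  rewrite -lee_fin fineK// (@le_trans _ _ (\int[U]_t 1%:E)%E)//.
    apply: ge0_le_integral => //.
    - by move=> x _; rewrite lee_fin; case/andP: (ch x).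
    - exact/measurable_EFinP.
    - by move=> x _; rewrite lee_fin; case/andP: (ch x).
  by rewrite integral_cst// mul1e; exact: probability_le1.
split.
  by apply: measurable_funD => //; apply: measurable_funM.
move=> u; move: (ch u) i01 rho01; set a := cell _ _ _ _ * _; set b := fine _.
by move=> /andP[? ?] /andP[? ?] /andP[? ?]; apply/andP; split; nra.
Qed.

Lemma measurable_cell_hrec m j : measurable_fun setT
    (fun t => cell (pis j) (c j) (d j) t * hrec m j t).
Proof.
by apply: measurable_funM; [exact: measurable_cell|case: (hrec_prop m j)].
Qed.

Lemma cell_hrec01 m j t : `|cell (pis j) (c j) (d j) t * hrec m j t| <= 1.
Proof.
have /andP[c0 c1] := cell01 (pis j) (c j) (d j) t.
have [_ /(_ t)/andP[h0 h1]] := hrec_prop m j.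
by rewrite ger0_norm ?mulr_ge0// mulr_ile1.
Qed.

(** Since [F_j (cdf_inv (pis j) u) = u], the map [Upsilon pis j] sends [cdf_inv (pis j) u] to
    [cdf_inv (pis j.+1) u]: the deterministic move keeps [u], and a fresh draw is a new uniform
    variable. *)
Lemma mc_fdd_from_hrec m j u : 0 < u <= 1 ->
  mc_fdd_from rho pis A m j (cdf_inv (pis j) u) = (hrec m j u)%:E.
Proof.
elim: m j u => [//|m IH] j u u01 /=.
rewrite /Upsilon cdf_cdf_inv// cell_cdf_inv// IH//.
rewrite (integral_cell _ _ _ _ (hrec m j.+1))//.
- by rewrite -EFinM -mulrA [RHS]EFinD [in RHS](EFinM (1 - rho)) fineK//; apply: (integral_bounded_fin _ _ 1);
     [exact: measurable_cell_hrec|exact: cell_hrec01].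
- exact: measurable_mc_fdd_from.
- by move=> x; exact: mc_fdd_from_ge0.
- by move=> t t01; exact: IH.
Qed.

Lemma mc_fdd_hrec k :
  mc_fdd rho pis A k.+1 = (fine (\int[U]_t (cell (pis 0) (c 0) (d 0) t * hrec k 0 t)%:E))%:E.
Proof.
rewrite fineK; last by apply: (integral_bounded_fin _ _ 1);
     [exact: measurable_cell_hrec|exact: cell_hrec01].
apply: integral_cell => //.
- exact: measurable_mc_fdd_from.
- by move=> x; exact: mc_fdd_from_ge0.
- by move=> t t01; exact: mc_fdd_from_hrec.
Qed.

End chain.

(** Away from the two limit endpoints [F pi c] and [F pi d], both comparisons defining the indicator
    are strict in the limit, hence eventually constant in [n]. *)
Lemma cvg_cell (pin : nat -> probability R R) (pi : probability R R) (c d : R) :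
  (forall x, (fun n => F (pin n) x) @ \oo --> F pi x) ->
  {ae U, forall u, (fun n => cell (pin n) c d u) @ \oo --> cell pi c d u}.
Proof.
move=> Fn; apply: filterS2 (uniform01_ae_neq (F pi c)) (uniform01_ae_neq (F pi d)).
move=> u uc ud; apply: cvg_near_cst.
have nc : \forall n \near \oo, (F (pin n) c < u) = (F pi c < u).
  move: uc; rewrite neq_lt => /orP[uc|cu].
    near=> n; rewrite [RHS]ltNge (ltW uc); apply/negbTE; rewrite -leNgt ltW//.
    by near: n; exact: (cvgr_gt _ (Fn c)).
  near=> n; rewrite cu; near: n; exact: (cvgr_lt _ (Fn c)).
have nd : \forall n \near \oo, (u <= F (pin n) d) = (u <= F pi d).
  move: ud; rewrite neq_lt => /orP[ud|du].
    near=> n; rewrite (ltW ud) ltW//; near: n; exact: (cvgr_gt _ (Fn d)).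
  near=> n; rewrite [RHS]leNgt du/=; apply/negbTE; rewrite -ltNge.
  near: n; exact: (cvgr_lt _ (Fn d)).
near=> n; rewrite /cell !indicE !mem_setE /= !in_itv/=.
by rewrite (near nc n)// (near nd n).
Unshelve. all: by end_near. Qed.

Lemma cvg_mc_fdd (rhon : nat -> R) (pisn : nat -> nat -> probability R R)
    (rho : R) (pis : nat -> probability R R) (c d : nat -> R) k :
  (forall n, 0 <= rhon n <= 1) -> (forall n j, nice_prob (pisn n j)) ->
  0 <= rho <= 1 -> (forall j, nice_prob (pis j)) ->
  rhon @ \oo --> rho ->
  (forall j x, (fun n => F (pisn n j) x) @ \oo --> F (pis j) x) ->
  (fun n => fine (mc_fdd (rhon n) (pisn n) (fun i => `]c i, d i]%classic) k)) @ \oo -->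
  fine (mc_fdd rho pis (fun i => `]c i, d i]%classic) k).
Proof.
move=> rhon01 npisn rho01 npis crho cF.
case: k => [|k]; first exact: cvg_cst.
rewrite mc_fdd_hrec//.
under eq_fun => n do rewrite (mc_fdd_hrec _ _ (rhon01 n) (npisn n)).
rewrite /=.
(* The integral in [hrec] turns almost everywhere convergence of one stage into convergence of a
   number. With the convergence of the cells this gives almost everywhere convergence of the next
   stage, so the induction closes. *)
have step m j : {ae U, forall u, (fun n => hrec (rhon n) (pisn n) c d m j u) @ \oo -->
      hrec rho pis c d m j u} ->
    (fun n => fine (\int[U]_t (cell (pisn n j) (c j) (d j) t * hrec (rhon n) (pisn n) c d m j t)%:E))
    @ \oo --> fine (\int[U]_t (cell (pis j) (c j) (d j) t * hrec rho pis c d m j t)%:E).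
  move=> ch; apply: (bounded_cvg_integral _ _ _ 1).
  - by move=> n; exact: measurable_cell_hrec.
  - exact: measurable_cell_hrec.
  - by move=> n x; exact: cell_hrec01.
  - by move=> x; exact: cell_hrec01.
  - by apply: filterS2 ch (cvg_cell (pisn ^~ j) (pis j) (c j) (d j) (cF j)) => u h1 h2; exact: cvgM.
apply: (step); elim: k 0%N => [|k IH] j /=; first by apply: aeW => u; exact: cvg_cst.
apply: filterS2 (IH j.+1) (cvg_cell (pisn ^~ j.+1) (pis j.+1) (c j.+1) (d j.+1) (cF j.+1)) => u h1 h2.
apply: cvgD; apply: cvgM => //.
- exact: cvgM.
- by apply: cvgB => //; exact: cvg_cst.
- exact: step (IH j.+1).
Qed.

End cells.

(** * Convergence of continuous functionals of the sticks and atoms *)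

Section ptws.
Context {R : realType} {T : pseudoMetricType R}.

(** One index [k] measures both the number of coordinates and the radius, so the sets [B k] are
    nested and generate a filter. That filter converges to [x] in each coordinate, hence in the
    product topology, and so refines the neighbourhoods of [x]. *)
Lemma nbhs_ptws_ball (x : {ptws nat -> T}) (U : set {ptws nat -> T}) : nbhs x U ->
  exists k, forall y, (forall i, (i < k)%N -> ball (x i) k.+1%:R^-1 (y i)) -> U y.
Proof.
pose B k := [set y : {ptws nat -> T} | forall i, (i < k)%N -> ball (x i) k.+1%:R^-1 (y i)].
pose F := filter_from [set: nat] B.
have FF : Filter F.
  apply: filter_from_filter; first by exists 0%N.
  move=> i j _ _; exists (maxn i j) => // y By; split=> l lk; have lm : (l < maxn i j)%N.
  - by rewrite (leq_trans lk)// leq_maxl.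
  - apply: (le_ball _ (By _ lm)); rewrite lef_pV2 ?posrE ?ltr0n// ler_nat ltnS leq_maxl //.
  - by rewrite (leq_trans lk)// leq_maxr.
  - apply: (le_ball _ (By _ lm)); rewrite lef_pV2 ?posrE ?ltr0n// ler_nat ltnS leq_maxr //.
have Fx : {ptws, F --> x}.
  apply/pointwise_cvgP => t A /nbhs_ballP[e e0 eA].
  have [n ne] : exists n, n.+1%:R^-1 < e.
    exists (Num.bound e^-1); rewrite invf_plt ?posrE//.
    by rewrite (lt_trans (archi_boundP _))// ?ltr_nat// invr_ge0 ltW.
  exists (maxn n t.+1) => // y By; apply: eA; apply: (le_ball _ (By t _)).
    by rewrite (le_trans _ (ltW ne))// lef_pV2 ?posrE ?ltr0n// ler_nat ltnS leq_maxl.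
  exact: leq_maxr.
by move=> /Fx [k _ kU]; exists k.
Qed.

Lemma ptws_ball_nbhs (x : {ptws nat -> T}) (n : nat) (e : R) : 0 < e ->
  nbhs x [set y | forall i, (i < n)%N -> ball (x i) e (y i)].
Proof.
move=> e0; have FF : Filter (nbhs x) := nbhs_filter x; elim: n => [|n IH].
  by rewrite (_ : mkset _ = setT); [exact: filterT|apply/seteqP; split].
have h : nbhs x [set y : {ptws nat -> T} | ball (x n) e (y n)].
  exact: (@proj_continuous _ (fun _ : nat => T) n x) (nbhsx_ballx _ _ e0).
apply: (@filterS2 _ _ FF _ _ _ _ IH h) => y h1 h2 i; rewrite ltnS leq_eqVlt => /predU1P[->//|].
exact: h1.
Qed.

(** Uniform continuity on the compact product of copies of [K]. Only [x] is confined to the product: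
    [y] will be a corner of a grid cell, which may stick out of the box. *)
Lemma ptws_modulus (K : set T) (Psi : {ptws nat -> T} -> R) (e : R) :
  compact K -> continuous Psi -> 0 < e ->
  exists k, forall x y, (forall i, K (x i)) ->
    (forall i, (i < k)%N -> ball (x i) k.+1%:R^-1 (y i)) -> `|Psi x - Psi y| < e.
Proof.
move=> cK cPsi e0.
have := @tychonoff nat (fun=> T) (fun=> K) (fun=> cK).
(* Compactness in its near-covering form: a property holding near each [x] for all large [k] holds
   for all [x] at once for all large [k]. *)
move=> /compact_near_coveringP /(_ nat \oo (fun k x => forall y,
  (forall i, (i < k)%N -> ball (x i) k.+1%:R^-1 (y i)) -> `|Psi x - Psi y| < e)).
case.
- move=> x Kx.
  have e20 : 0 < e / 2 by rewrite divr_gt0.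
  have : nbhs (x : {ptws nat -> T}) [set y | `|Psi x - Psi y| < e / 2].
    have /cvgrPdist_lt /(_ _ e20) := cPsi x. exact.
  move=> /nbhs_ptws_ball[k0 hk0]; set r := k0.+1%:R^-1 in hk0.
  have r20 : 0 < r / 2 by rewrite divr_gt0// invr_gt0.
  (* With [r = 1 / (k0 + 1)], the bound [k >= 2 k0 + 1] is what makes [1 / (k + 1) <= r / 2]; the
     radii of the two hops, from [x] to [x'] and from [x'] to [y], then add up to at most [r]. *)
  exists ([set y | forall i, (i < k0)%N -> ball (x i) (r / 2) (y i)],
     [set k | (k0.*2.+1 <= k)%N]); first by split; [exact: ptws_ball_nbhs|exists k0.*2.+1].
  move=> [x' k] /= [x'x k0k] y x'y.
  have kr : k.+1%:R^-1 <= r / 2.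
    rewrite /r -invfM -natrM lef_pV2 ?posrE ?ltr0n ?muln_gt0// ler_nat.
    by rewrite muln2 doubleS ltnS.
  have kk i : (i < k0)%N -> (i < k)%N.
    by move=> /leq_trans; apply; rewrite (leq_trans _ k0k)// -addnn ltnW// ltnS leq_addr.
  have h1 : `|Psi x - Psi x'| < e / 2.
    apply: hk0 => i ik; have rr : r / 2 <= r by clearbody r; lra.
    exact: (le_ball rr (x'x i ik)).
  have h2 : `|Psi x - Psi y| < e / 2.
    apply: hk0 => i ik; rewrite (splitr r); apply: (ball_triangle (x'x i ik)).
    by apply: le_ball kr _ _; apply: x'y; exact: kk.
  rewrite (splitr e); rewrite distrC in h1.
  by apply: le_lt_trans (ltrD h1 h2); rewrite (le_trans _ (ler_normD _ _))// addrA subrK.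
- move=> N _ h; exists N => x y Kx xy; exact: (h N (leqnn N) x Kx y xy).
Qed.
End ptws.

(** * The weights as a continuous functional *)

Section weight_map.
Context {R : realType}.

Lemma cvg_sb_weight {T : Type} (F : set_system T) (FF : Filter F) (v : T -> nat -> R) v0 j :
  (forall i, (fun t => v t i) @ F --> v0 i) ->
  (fun t => sb_weight (v t) j) @ F --> sb_weight v0 j.
Proof.
move=> vv; apply: cvgM; first exact: vv.
elim: j => [|j IH].
  by under eq_fun do rewrite big_ord0; rewrite big_ord0; exact: cvg_cst.
under eq_fun do rewrite big_ord_recr/=; rewrite big_ord_recr/=.
by apply: cvgM => //; apply: cvgB => //; exact: cvg_cst.
Qed.

(** Applied to the pairs [(v_j, f(theta_j))] it gives the summands [w_j f(theta_j)] of the random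
    integral, and for the constant [f = 1] the weights: one continuous map serves both convergence
    statements. *)
Definition weight_map (z : {ptws nat -> (R * R)%type}) : {ptws nat -> R} :=
  fun j => sb_weight (fun i => (z i).1) j * (z j).2.

Lemma weight_map_continuous : continuous weight_map.
Proof.
move=> z; have FF : Filter (nbhs z) := nbhs_filter z.
apply/(@pointwise_cvgP nat R (fmap weight_map (nbhs z)) (weight_map z) (fmap_filter _ FF)) => j.
have p1 i : (fun z : {ptws nat -> (R * R)%type} => (z i).1) @ z --> (z i).1.
  apply: (@cvg_comp _ _ _ (fun z : {ptws nat -> (R * R)%type} => z i) fst _ (nbhs (z i))).
    exact: (@proj_continuous _ (fun _ : nat => (R * R)%type) i z).
  exact: cvg_fst.
have p2 i : (fun z : {ptws nat -> (R * R)%type} => (z i).2) @ z --> (z i).2.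
  apply: (@cvg_comp _ _ _ (fun z : {ptws nat -> (R * R)%type} => z i) snd _ (nbhs (z i))).
    exact: (@proj_continuous _ (fun _ : nat => (R * R)%type) i z).
  exact: cvg_snd.
exact: (@cvgM _ _ (nbhs z) FF _ _ _ _ (cvg_sb_weight _ FF _ _ j p1) (p2 j)).
Qed.

End weight_map.

(** * Grids avoiding the atoms of a law *)

Section grid.
Context {R : realType}.

(** The atoms form a countable set, hence a Lebesgue-null one, and []a, b[] has positive length. The
    atoms are obtained as the support of the mass function of the identity variable. *)
Lemma nonatom_between (mu : probability R R) (a b : R) : a < b ->
  exists2 c, a < c < b & mu [set c] = 0%E.
Proof.
move=> ab; pose X : {RV mu >-> R} := law_mfun (fun x : R => x) (@measurable_id _ _ setT).
apply: contrapT => h.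
have cX := pmf_gt0_countable X.
have := countable_lebesgue_measure0 (sub_countable (subset_card_le _) cX).
have sub : `]a, b[%classic `<=` [set r | 0 < pmf X r].
  move=> c; rewrite /= in_itv/= => acb; rewrite lt_neqAle fine_ge0 ?andbT//.
  apply/eqP => e; apply: h; exists c => //.
  by rewrite -(fineK (fin_num_measure mu _ (measurable_set1 c))) -[RHS]/(0%:E) e.
move=> /(_ _ sub); rewrite lebesgue_measure_itv/= lte_fin ab -EFinD => -[] /eqP.
by rewrite subr_eq0 gt_eqF.
Qed.

Lemma nonatom_grid (mu : probability R R) (B dl : R) : 0 < B -> 0 < dl ->
  exists g : nat -> R, exists L : nat, [/\ forall l, g l < g l.+1,
    forall l, g l.+1 - g l < dl, g 0%N < - B, B < g L & forall l, mu [set g l] = 0%E].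
Proof.
(* One grid point is chosen in each interval []a l, a l.+1[] of length [dl / 2]: consecutive points
   are less than [dl] apart, and the first one lies below [a 1 = - B]. *)
move=> B0 dl0; pose a l : R := - B - dl / 2 + l%:R * (dl / 2).
have aS l : a l.+1 = a l + dl / 2 by rewrite /a -natr1; ring.
have d20 : 0 < dl / 2 by rewrite divr_gt0.
have ha l : exists c, a l < c < a l.+1 /\ mu [set c] = 0%E.
  have [|c ac mc] := nonatom_between mu (a l) (a l.+1).
    by rewrite aS ltrDl.
  by exists c.
have [g hg] := choice ha.
have gl l : a l < g l by case: (hg l) => /andP[].
have gr l : g l < a l.+1 by case: (hg l) => /andP[].
exists g, (Num.bound ((B + B + dl / 2) / (dl / 2))).+1; split.
- by move=> l; apply: lt_trans (gr l) (gl l.+1).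
- move=> l; have := gr l.+1; have := gl l; rewrite !aS; lra.
- by have := gr 0%N; rewrite /a/=; lra.
- set n := Num.bound _; apply: lt_trans (gl _).
  have : (B + B + dl / 2) / (dl / 2) < n.+1%:R.
    by rewrite (lt_trans (archi_boundP _)) ?ltr_nat// divr_ge0// ltW// !addr_gt0.
  rewrite ltr_pdivrMr// /a; lra.
- by move=> l; case: (hg l).
Qed.

Lemma grid_cell (g : nat -> R) L x : g 0%N < x -> x <= g L ->
  exists2 l, (l < L)%N & g l < x <= g l.+1.
Proof.
move=> g0 gL; have ex : exists m, x <= g m by exists L.
case: (ex_minnP ex) => -[|m] xm hm; first by move: xm; rewrite leNgt g0.
exists m; first exact: hm.
by rewrite xm andbT ltNge; apply/negP => /hm; rewrite ltnn.
Qed.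

End grid.

(** * Support of the chain in the unit interval *)

Section mc_null.
Context {R : realType}.
Variables (rho : R) (pis : nat -> probability R R).
Hypothesis npis : forall j, nice_prob (pis j).

(** Both ways of reaching index [l] miss [A l]: the values of [Upsilon] lie in [[0, 1]], and a fresh
    draw from [pis l] falls in [A l] with probability [0]. *)
Lemma mc_fdd_null (A : nat -> set R) k l : (forall i, measurable (A i)) ->
  (l < k)%N -> A l `&` `[0, 1]%classic = set0 -> mc_fdd rho pis A k = 0%E.
Proof.
move=> mA lk A0.
have pA : pis l (A l) = 0%E by exact: nice_out.
have AU x j : l = j.+1 -> \1_(A l) (Upsilon pis j x) = 0 :> R.
  move=> lj; rewrite indicE; apply/eqP; rewrite pnatr_eq0 eqb0; apply/negP; rewrite inE => h.
  suff : set0 (Upsilon pis j x) by [].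
  by rewrite -A0; split => //=; rewrite in_itv/= cdf_inv_ge0// cdf_inv_le1.
have h m j x : (j < l)%N -> (l <= j + m)%N -> mc_fdd_from rho pis A m j x = 0%E.
  elim: m j x => [|m IH] j x jl lm /=; first by move: lm; rewrite addn0 leqNgt jl.
  have [lj|lj] := eqVneq l j.+1.
    rewrite -lj AU// mulr0 mul0e add0e null_set_integral ?mule0//.
    by apply: measurable_funTS; exact: measurable_mc_fdd_from.
  have jl' : (j.+1 < l)%N by rewrite ltn_neqAle eq_sym lj.
  rewrite IH// ?addSnnS// mule0 add0e integral0_eq ?mule0// => y _.
  by rewrite IH// addSnnS.
case: k lk => // k lk /=; case: l lk A0 pA AU h => [|l] lk A0 pA AU h.
  by rewrite null_set_integral//; apply: measurable_funTS; exact: measurable_mc_fdd_from.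
by rewrite integral0_eq// => x _; rewrite h.
Qed.

End mc_null.

Section process_support.
Context {R : realType} {X : completePseudoMetricType R}.
Context {d : measure_display} {Omega : measurableType d} (P : probability Omega R).
Variables (rho : R) (pis : nat -> probability R R) (P0 : probability (XB X) R)
    (v : nat -> Omega -> R) (th : nat -> Omega -> XB X).
Hypothesis H : lazy_msb P rho pis P0 v th.

Lemma lazy_msb_support : {ae P, forall w, forall j, 0 <= v j w <= 1}.
Proof.
have [rho01 npis dP0 mvth fdd] := H.
apply: ae_foralln => l.
pose A i : set R := if i == l then ~` `[0, 1]%classic else setT.
have mA i : measurable (A i).
  by rewrite /A; case: ifP => _ //; exact: measurableC.
exists (v l @^-1` ~` `[0, 1]%classic); split.
- rewrite -[X in measurable X]setTI; apply: (mvth l).1 => //; exact: measurableC.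
- have := fdd l.+1 A (fun=> setT) mA (fun=> measurableT).
  rewrite (mc_fdd_null _ _ npis A _ l)//; last first.
    by rewrite /A eqxx; apply/seteqP; split=> x //= [].
  rewrite mul0e => <-; congr (P _); apply/seteqP; split=> w /=.
    by move=> vw i _; split => //; rewrite /A; case: eqP => // ->.
  by move=> /(_ l (ltnSn l))[]; rewrite /A eqxx.
- by move=> w /=; rewrite in_itv.
Qed.

End process_support.

Section integral_dist.
Context {d} {T : measurableType d} {R : realType}.
Variable P : probability T R.

Lemma Rintegral_dist_le (F1 F2 F3 : T -> R) (M : R) :
  measurable_fun setT F1 -> measurable_fun setT F2 -> measurable_fun setT F3 ->
  (forall x, `|F1 x| <= M) -> (forall x, `|F2 x| <= M) -> (forall x, `|F3 x| <= M) ->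
  (forall x, `|F1 x - F2 x| <= F3 x) ->
  `|\int[P]_x F1 x - \int[P]_x F2 x| <= \int[P]_x F3 x.
Proof.
move=> m1 m2 m3 b1 b2 b3 h.
have i1 := integrable_bounded P _ _ m1 b1.
have i2 := integrable_bounded P _ _ m2 b2.
have i3 := integrable_bounded P _ _ m3 b3.
have m12 : measurable_fun setT (fun x => F1 x - F2 x) by exact: measurable_funB.
have b12 x : `|F1 x - F2 x| <= M + M by rewrite (le_trans (ler_normB _ _))// lerD.
have b12' x : `| `|F1 x - F2 x| | <= M + M by rewrite normr_id.
rewrite -RintegralB// (le_trans (le_normr_Rintegral _ _))//.
  exact: integrable_bounded b12.
apply: le_Rintegral => //.
  by apply: integrable_bounded b12'; exact: measurableT_comp.
Qed.

Lemma measurable_step (I : finType) (c : I -> R) (E : I -> set T) :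
  (forall i, measurable (E i)) -> measurable_fun setT (fun x => \sum_i c i * \1_(E i) x).
Proof.
move=> mE; apply: measurable_sum => i; exact: measurable_funM.
Qed.

Lemma Rintegral_sum_indic (I : finType) (c : I -> R) (E : I -> set T) :
  (forall i, measurable (E i)) ->
  \int[P]_x (\sum_i c i * \1_(E i) x) = \sum_i c i * fine (P (E i)).
Proof.
move=> mE.
have ii i : P.-integrable setT (fun x => (\1_(E i) x : R)%:E).
  apply: (integrable_bounded _ _ 1); first exact: measurable_indic.
  by move=> x; rewrite indicE; case: (_ \in _); rewrite ?normr1 ?normr0.
have ic i : P.-integrable setT (fun x => (c i * \1_(E i) x)%:E).
  by under eq_fun do rewrite EFinM; exact: integrableZl.
have e i : (\int[P]_x (c i * \1_(E i) x)%:E = (c i * fine (P (E i)))%:E)%E.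
  under eq_integral do rewrite EFinM.
  by rewrite integralZl// integral_indic// setIT EFinM fineK// fin_num_measure.
rewrite /Rintegral; under eq_integral do rewrite -sumEFin.
by rewrite integral_sum// (eq_bigr _ (fun i _ => e i)) sumEFin.
Qed.

End integral_dist.

Section clip.
Context {R : realType}.

Definition clip01 (x : R) : R := Num.max 0 (Num.min 1 x).

Lemma clip01_itv x : 0 <= clip01 x <= 1.
Proof. by rewrite /clip01 le_max lexx/= ge_max ler01/= ge_min lexx. Qed.

Lemma clip01_id x : 0 <= x <= 1 -> clip01 x = x.
Proof. by move=> /andP[x0 x1]; rewrite /clip01 (min_idPr x1) (max_idPr x0). Qed.

Lemma continuous_clip01 : continuous clip01.
Proof.
have -> : clip01 = (cst 0) \max ((cst 1) \min (fun x : R => x)) by [].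
move=> y; apply: (@continuous_max R R); first exact: cvg_cst.
by apply: (@continuous_min R R); [exact: cvg_cst|exact: cvg_id].
Qed.

Lemma measurable_clip01 : measurable_fun setT clip01.
Proof. exact: continuous_measurable_fun continuous_clip01. Qed.

End clip.

Lemma measurable_continuous_XB {R : realType} {X : completePseudoMetricType R}
  (f : X -> R) : continuous f -> measurable_fun setT (f : XB X -> R).
Proof.
move=> cf; apply: (measurability _ (RGenOInfty.measurableE R)) => _ [_ [x ->] <-].
rewrite setTI; apply: sub_sigma_algebra.
by move/continuousP : cf; apply; exact: interval_open.
Qed.

(** * Step functions on a finite grid *)

Section step_approximation.
Context {R : realType} {X : completePseudoMetricType R}.
Context {d : measure_display} {Omega : measurableType d} (P : probability Omega R).
Variables (v : nat -> Omega -> R) (th : nat -> Omega -> XB X).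
Hypothesis mv : forall j, measurable_fun setT (v j).
Hypothesis mth : forall j, measurable_fun setT (th j).
Variables (f : X -> R) (cf : continuous f) (B : R) (B1 : 1 <= B).
Hypothesis fB : forall x, `|f x| <= B.

(* The [v_j] lie in [0, 1] only almost surely: clipping keeps [zproc] in a
   compact box everywhere. *)
Definition zproc (w : Omega) : {ptws nat -> (R * R)%type} :=
  fun i => (clip01 (v i w), f (th i w)).

Definition zbox : set (R * R) := `[0, 1]%classic `*` `[- B, B]%classic.

Lemma compact_zbox : compact zbox.
Proof. by apply: compact_setX; exact: segment_compact. Qed.

Lemma zproc_box w i : zbox (zproc w i).
Proof. by split => /=; rewrite in_itv/= ?clip01_itv// -ler_norml. Qed.

Section fixed_grid.
Variables (k L : nat) (g : nat -> R).
Hypotheses (gS : forall l, g l < g l.+1) (g0 : g 0%N < - B) (gL : B < g L).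

(** Cells are labelled by a finite type so that they can be summed over, while the
    finite-dimensional formula wants sequences on [nat]: the label is extended by [(0, 0)] beyond
    [k]. The first [k] coordinates alone determine the cell. *)
Definition cell_index (ga : {ffun 'I_k -> 'I_L * 'I_L}) (i : nat) : nat * nat :=
  if insub i is Some i' then ((ga i').1 : nat, (ga i').2 : nat) else (0%N, 0%N).

Definition grid_interval (l : nat) : set R := `]g l, g l.+1]%classic.

Definition cell_corner ga : {ptws nat -> (R * R)%type} :=
  fun i => (g (cell_index ga i).1.+1, g (cell_index ga i).2.+1).

Definition cell_event ga : set Omega :=
  \bigcap_(i in `I_k) ([set w | grid_interval (cell_index ga i).1 (v i w)] `&`
                       [set w | (f @^-1` grid_interval (cell_index ga i).2) (th i w)]).

(** With clipped sticks these events partition [Omega] without exception, so [step] approximates at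
    every outcome. The unclipped [cell_event] has the same probability and is the one that the
    finite-dimensional formula computes. *)
Definition clip_cell_event ga : set Omega :=
  \bigcap_(i in `I_k) ([set w | grid_interval (cell_index ga i).1 (clip01 (v i w))] `&`
                       [set w | (f @^-1` grid_interval (cell_index ga i).2) (th i w)]).

Definition step (Psi : {ptws nat -> (R * R)%type} -> R) (w : Omega) : R :=
  \sum_ga Psi (cell_corner ga) * \1_(clip_cell_event ga) w.

Lemma grid_nd m n : (m <= n)%N -> g m <= g n.
Proof.
elim: n => [|n IH]; first by rewrite leqn0 => /eqP ->.
by rewrite leq_eqVlt => /predU1P[->//|/IH h]; rewrite (le_trans h)// ltW.
Qed.

Lemma grid_interval_inj l l' x : grid_interval l x -> grid_interval l' x -> l = l'.
Proof.
rewrite /grid_interval/= !in_itv/= => /andP[a b] /andP[a' b']; apply/eqP; rewrite eqn_leq.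
apply/andP; split; rewrite leqNgt; apply/negP => /grid_nd h.
- by move: (le_lt_trans (le_trans b' h) a); rewrite ltxx.
- by move: (le_lt_trans (le_trans b h) a'); rewrite ltxx.
Qed.

Lemma ex_grid_interval x : - B <= x <= B -> exists l : 'I_L, grid_interval l x.
Proof.
move=> /andP[x1 x2]; have [l lL lx] := grid_cell g L x (lt_le_trans g0 x1) (le_trans x2 (ltW gL)).
by exists (Ordinal lL); rewrite /grid_interval/= in_itv.
Qed.

Lemma clip_cell_event_ex w : exists ga, clip_cell_event ga w.
Proof.
have h (i : 'I_k) : exists p : 'I_L * 'I_L, grid_interval p.1 (clip01 (v i w)) /\
    grid_interval p.2 (f (th i w)).
  have [l1 h1] : exists l : 'I_L, grid_interval l (clip01 (v i w)).
    apply: ex_grid_interval; have /andP[c0 c1] := clip01_itv (v i w).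
    by rewrite (le_trans c1 B1) (le_trans _ c0)// oppr_le0 (le_trans ler01).
  have [l2 h2] : exists l : 'I_L, grid_interval l (f (th i w)).
    by apply: ex_grid_interval; rewrite -ler_norml.
  by exists (l1, l2).
have [ga hga] := fin_all_exists h.
exists (finfun ga) => i ik; have := hga (Ordinal ik).
by rewrite /cell_index insubT//= ffunE.
Qed.

Lemma clip_cell_event_inj ga ga' w : clip_cell_event ga w -> clip_cell_event ga' w -> ga = ga'.
Proof.
move=> h h'; apply/ffunP => i.
have [a b] := h i (ltn_ord i); have [a' b'] := h' i (ltn_ord i).
have E : insub (nat_of_ord i) = Some i :> option 'I_k := valK i.
move: a b a' b'; rewrite /= /cell_index !E/=.
move=> a b a' b'; rewrite [LHS]surjective_pairing [RHS]surjective_pairing; congr pair.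
- apply: val_inj; exact: grid_interval_inj a a'.
- apply: val_inj; exact: grid_interval_inj b b'.
Qed.

Lemma step_eq Psi w : exists2 ga, clip_cell_event ga w & step Psi w = Psi (cell_corner ga).
Proof.
have [ga hga] := clip_cell_event_ex w; exists ga => //.
rewrite /step (bigD1 ga)//= indicE mem_set// mulr1 big1 ?addr0// => ga' gan.
rewrite indicE memNset ?mulr0// => /clip_cell_event_inj /(_ hga) e.
by rewrite e eqxx in gan.
Qed.

Lemma step_close Psi e :
  (forall l, g l.+1 - g l < k.+1%:R^-1) ->
  (forall x y, (forall i, zbox (x i)) ->
    (forall i, (i < k)%N -> ball (x i) k.+1%:R^-1 (y i)) -> `|Psi x - Psi y| < e) ->
  forall w, `|Psi (zproc w) - step Psi w| < e.
Proof.
move=> gd hPsi w; have [ga hga ->] := step_eq Psi w.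
apply: hPsi; first exact: zproc_box.
have cl l x : grid_interval l x -> `|x - g l.+1| < k.+1%:R^-1.
  rewrite /grid_interval/= in_itv/= => /andP[h1 h2]; rewrite distrC ger0_norm ?subr_ge0//.
  by apply: le_lt_trans (gd l); rewrite lerD2l lerN2 ltW.
by move=> i ik; have [h1 h2] := hga i ik; split; exact: cl.
Qed.

Lemma measurable_grid_interval l : measurable (grid_interval l). Proof. exact: measurable_itv. Qed.

Lemma measurable_cell_event ga : measurable (cell_event ga).
Proof.
apply: fin_bigcap_measurable => [|i ik]; first exact: finite_II.
apply: measurableI.
- by rewrite -[X in measurable X]setTI; apply: mv => //; exact: measurable_grid_interval.
- rewrite -[X in measurable X]setTI.
  apply: (measurableT_comp (measurable_continuous_XB _ cf) (mth i)) => //; exact: measurable_grid_interval.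
Qed.

Lemma measurable_clip_cell_event ga : measurable (clip_cell_event ga).
Proof.
apply: fin_bigcap_measurable => [|i ik]; first exact: finite_II.
apply: measurableI.
- rewrite -[X in measurable X]setTI.
  by apply: (measurableT_comp measurable_clip01 (mv i)) => //; exact: measurable_grid_interval.
- rewrite -[X in measurable X]setTI.
  apply: (measurableT_comp (measurable_continuous_XB _ cf) (mth i)) => //; exact: measurable_grid_interval.
Qed.

Lemma measurable_step_fun Psi : measurable_fun setT (step Psi).
Proof. by apply: measurable_step => ga; exact: measurable_clip_cell_event. Qed.

Lemma prob_clip_cell_event ga : {ae P, forall w, forall j, 0 <= v j w <= 1} ->
  P (clip_cell_event ga) = P (cell_event ga).
Proof.
move=> v01; rewrite -(setIT (clip_cell_event ga)) -(setIT (cell_event ga)).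
rewrite -!integral_indic//; [|exact: measurable_cell_event|exact: measurable_clip_cell_event].
apply: integral_eq_ae; apply: filterS v01 => w w01; rewrite !indicE.
suff -> : (w \in clip_cell_event ga) = (w \in cell_event ga) by [].
by apply/asboolP/asboolP => h i ik; have [h1 h2] := h i ik; split => //=;
  move: h1 => /=; rewrite clip01_id.
Qed.

End fixed_grid.

(** A limit of the measurable functions [step], with error [1 / (n + 1)]. This bypasses any
    comparison of the Borel sets of the product topology with the product sigma-algebra. *)
Lemma measurable_zproc (Psi : {ptws nat -> (R * R)%type} -> R) : continuous Psi ->
  measurable_fun setT (fun w => Psi (zproc w)).
Proof.
move=> cPsi.
have h (n : nat) : exists S : Omega -> R, measurable_fun setT S /\ forall w, `|Psi (zproc w) - S w| < n.+1%:R^-1.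
  have [k hk] := ptws_modulus _ _ n.+1%:R^-1 compact_zbox cPsi ltac:(by rewrite invr_gt0).
  have [g [L [gS gd g0 gL _]]] := nonatom_grid unif01 B k.+1%:R^-1 (lt_le_trans ltr01 B1)
    ltac:(by rewrite invr_gt0).
  exists (step k L g Psi); split; first exact: measurable_step_fun.
  exact: step_close.
have [S hS] := choice h.
apply: (@measurable_fun_cvg _ _ _ setT S) => [m|w _]; first by case: (hS m).
apply/cvgrPdist_lt => e e0; near=> n.
have [_ /(_ w)] := hS n; move=> /lt_trans; apply.
near: n; exact: near_infty_natSinv_lt (PosNum e0).
Unshelve. all: by end_near. Qed.

End step_approximation.

Lemma Rintegral_prob_cst {d} {T : measurableType d} {R : realType}
  (P : probability T R) (r : R) : \int[P]_x r = r.
Proof.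
transitivity (r * fine (P setT)); first exact: Rintegral_cst.
by rewrite probability_setT mulr1.
Qed.

Lemma cvg_fin_sum {R : realType} {I : Type} (s : seq I) (u : I -> nat -> R) (l : I -> R) :
  (forall i, u i @ \oo --> l i) ->
  (fun n => \sum_(i <- s) u i n) @ \oo --> \sum_(i <- s) l i.
Proof.
move=> ul; elim: s => [|i s IH].
  by under eq_fun do rewrite big_nil; rewrite big_nil; exact: cvg_cst.
under eq_fun do rewrite big_cons; rewrite big_cons; exact: cvgD.
Qed.

Lemma cvg_fin_prod {R : realType} {I : Type} (s : seq I) (u : I -> nat -> R) (l : I -> R) :
  (forall i, u i @ \oo --> l i) ->
  (fun n => \prod_(i <- s) u i n) @ \oo --> \prod_(i <- s) l i.
Proof.
move=> ul; elim: s => [|i s IH].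
  by under eq_fun do rewrite big_nil; rewrite big_nil; exact: cvg_cst.
under eq_fun do rewrite big_cons; rewrite big_cons; exact: cvgM.
Qed.

Section expectation_approximation.
Context {R : realType} {X : completePseudoMetricType R}.
Context {d : measure_display} {Omega : measurableType d} (P : probability Omega R).
Variables (rho : R) (pis : nat -> probability R R) (P0 : probability (XB X) R).
Variables (v : nat -> Omega -> R) (th : nat -> Omega -> XB X).
Hypothesis H : lazy_msb P rho pis P0 v th.
Variables (f : X -> R) (cf : continuous f) (B : R) (B1 : 1 <= B).
Hypothesis fB : forall x, `|f x| <= B.
Variables (k L : nat) (g : nat -> R).
Hypotheses (gS : forall l, g l < g l.+1) (g0 : g 0%N < - B) (gL : B < g L).

(** Written with the parameters alone, not with [P]: in this form the probabilities of a cell under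
    processes on different spaces can be compared. *)
Definition cell_prob (ga : {ffun 'I_k -> 'I_L * 'I_L}) : R :=
  fine (mc_fdd rho pis (fun i => grid_interval g (cell_index k L ga i).1) k) *
  \prod_(i < k) fine (P0 (f @^-1` grid_interval g (cell_index k L ga i).2)).

Lemma fine_cell_event ga : fine (P (cell_event v th f k L g ga)) = cell_prob ga.
Proof.
have [rho01 npis _ _ fdd] := H.
rewrite /cell_event (fdd k (fun i => grid_interval g (cell_index k L ga i).1)
  (fun i => f @^-1` grid_interval g (cell_index k L ga i).2)); last 2 first.
- by move=> i; exact: measurable_grid_interval.
- move=> i; rewrite -[X in measurable X]setTI.
  by apply: (measurable_continuous_XB _ cf) => //; exact: measurable_grid_interval.
have mE : mc_fdd rho pis (fun i => grid_interval g (cell_index k L ga i).1) k =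
    (fine (mc_fdd rho pis (fun i => grid_interval g (cell_index k L ga i).1) k))%:E.
  by case: (k) ga => [//|k'] ga; rewrite /grid_interval mc_fdd_hrec.
rewrite mE (eq_bigr (fun i : 'I_k => (fine (P0 (f @^-1` grid_interval g (cell_index k L ga i).2)))%:E)).
  by rewrite prodEFin -EFinM.
move=> i _; rewrite fineK// fin_num_measure// -[X in measurable X]setTI.
by apply: (measurable_continuous_XB _ cf) => //; exact: measurable_grid_interval.
Qed.

(** The error depends only on the grid and on the modulus of [Psi], so the same grid serves the
    limit process and every approximating one. *)
Lemma expectation_approx (Psi : {ptws nat -> (R * R)%type} -> R) (M e : R) :
  continuous Psi -> (forall z, `|Psi z| <= M) -> 0 < e ->
  (forall l, g l.+1 - g l < k.+1%:R^-1) ->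
  (forall x y, (forall i, zbox B (x i)) ->
    (forall i, (i < k)%N -> ball (x i) k.+1%:R^-1 (y i)) -> `|Psi x - Psi y| < e) ->
  `|\int[P]_w Psi (zproc v th f w) - \sum_ga Psi (cell_corner k L g ga) * cell_prob ga| <= e.
Proof.
move=> cPsi PsiM e0 gd hPsi.
have [rho01 npis _ mvth fdd] := H.
have mv j := (mvth j).1. have mth j := (mvth j).2.
have -> : \sum_ga Psi (cell_corner k L g ga) * cell_prob ga =
    \int[P]_w step v th f k L g Psi w.
  rewrite /step Rintegral_sum_indic; last by move=> ga; exact: measurable_clip_cell_event.
  apply: eq_bigr => ga _; rewrite -fine_cell_event (prob_clip_cell_event P)//.
  exact: lazy_msb_support H.
have M0 : 0 <= M by rewrite (le_trans _ (PsiM point)).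
rewrite -[leRHS](_ : \int[P]_w e = e); last exact: Rintegral_prob_cst.
apply: (Rintegral_dist_le _ _ _ _ (M + e)) => //.
- exact: measurable_zproc fB _ cPsi.
- exact: measurable_step_fun.
- by move=> w; rewrite (le_trans (PsiM _))// lerDl ltW.
- move=> w; have [ga _ ->] := step_eq v th f _ B1 fB k L g gS g0 gL Psi w.
  by rewrite (le_trans (PsiM _))// lerDl ltW.
- by move=> w; rewrite gtr0_norm// lerDr.
- by move=> w; apply/ltW; exact: (step_close v th f _ B1 fB).
Qed.

End expectation_approximation.

(** * Passage to the limit for continuous functionals *)

Section limit.
Context {R : realType} {X : completePseudoMetricType R}.
Context {d : measure_display} {Omega : measurableType d} (PP : probability Omega R).
Variables (rho : R) (pis : nat -> probability R R) (P0 : probability (XB X) R).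
Variables (v : nat -> Omega -> R) (th : nat -> Omega -> XB X).
Variables (dn : nat -> measure_display) (Omegan : forall n, measurableType (dn n))
    (PPn : forall n, probability (Omegan n) R)
    (rhon : nat -> R) (pisn : nat -> nat -> probability R R)
    (P0n : nat -> probability (XB X) R)
    (vn : forall n, nat -> Omegan n -> R) (thn : forall n, nat -> Omegan n -> XB X).
Hypothesis H : lazy_msb PP rho pis P0 v th.
Hypothesis Hn : forall n, lazy_msb (PPn n) (rhon n) (pisn n) (P0n n) (vn n) (thn n).
Hypothesis crho : rhon @ \oo --> rho.
Hypothesis cP0 : weak_cvg_X (fun n => P0n n) P0.
Hypothesis cpi : forall j, weak_cvg_R (fun n => pisn n j) (pis j).

Lemma nice_atomless (pi : probability R R) x : nice_prob pi -> pi [set x] = 0%E.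
Proof.
move=> npi; have [_ [/(_ x) cF _]] := npi.
apply/eqP; rewrite eq_le measure_ge0 andbT; apply/lee_addgt0Pr => e e0; rewrite add0e.
have /cvgrPdist_lt /(_ _ e0) /nbhs_ballP[dl /= dl0 hd] := cF.
have dl20 : 0 < dl / 2 by rewrite divr_gt0.
apply: (@le_trans _ _ (pi `]x - dl / 2, x]%classic)).
  rewrite le_measure ?inE// => y /= ->.
  by rewrite in_itv/= lexx andbT ltrBlDr ltrDl.
rewrite prob_itvoc ?lee_fin; last by rewrite lerBlDr lerDl ltW.
apply/ltW; rewrite (le_lt_trans (ler_norm _))//; apply: hd.
by rewrite /ball/= opprB addrC subrK gtr0_norm// ltr_pdivrMr// ltr_pMr// ltr1n.
Qed.

Lemma cvg_Rintegral_zproc (f : X -> R) (B : R) (Psi : {ptws nat -> (R * R)%type} -> R) (M : R) :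
  continuous f -> 1 <= B -> (forall x, `|f x| <= B) ->
  continuous Psi -> (forall z, `|Psi z| <= M) ->
  (fun n => \int[PPn n]_w Psi (zproc (vn n) (thn n) f w)) @ \oo -->
  \int[PP]_w Psi (zproc v th f w).
Proof.
move=> cf B1 fB cPsi PsiM.
have [rho01 npis dP0 mvth fdd] := H.
apply/cvgrPdist_le => e e0.
have e30 : 0 < e / 3 by rewrite divr_gt0.
have [k hk] := ptws_modulus _ _ _ (compact_zbox B) cPsi e30.
have k0 : 0 < k.+1%:R^-1 :> R by rewrite invr_gt0.
have mf := measurable_continuous_XB _ cf.
pose lf (Q : probability (XB X) R) := law Q _ mf.
(* Convergence of distribution functions at a point asks that the limit law have no atom there, so
   the grid is adapted to the limit law of [f(theta_0)] only; the laws [pis j] have no atoms at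
   all. *)
have [g [L [gS gd g0 gL gat]]] := nonatom_grid (lf P0) B _ (lt_le_trans ltr01 B1) k0.
have h0 := expectation_approx PP _ _ _ _ _ H _ cf _ B1 fB k L g gS g0 gL Psi M _ cPsi PsiM e30 gd hk.
have hn n := expectation_approx (PPn n) _ _ _ _ _ (Hn n) _ cf _ B1 fB k L g gS g0 gL Psi M _ cPsi PsiM e30 gd hk.
have wlf : weak_cvg_R (fun n => lf (P0n n)) (lf P0).
  move=> h ch [Mh hM].
  have mh : measurable_fun setT h by exact: continuous_measurable_fun.
  rewrite integral_law_bounded//; last by exists Mh.
  under eq_fun => n do rewrite (integral_law_bounded _ _ mf h mh (ex_intro _ Mh hM)).
  apply: (cP0 (h \o f)); last by exists Mh => x; exact: hM.
  by move=> x; apply: continuous_comp; [exact: cf|exact: ch].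
have c1 ga : (fun n => cell_prob (rhon n) (pisn n) (P0n n) f k L g ga) @ \oo -->
    cell_prob rho pis P0 f k L g ga.
  apply: cvgM.
    apply: cvg_mc_fdd => //.
    - by move=> n; case: (Hn n).
    - by move=> n j; case: (Hn n).
    - by move=> j x; apply: weak_cvg_cdf; [exact: cpi|exact: nice_atomless].
  apply: cvg_fin_prod => i.
  have eQ (Q : probability (XB X) R) : fine (Q (f @^-1` grid_interval g (cell_index k L ga i).2)) =
      Defs.cdf (lf Q) (g (cell_index k L ga i).2.+1) - Defs.cdf (lf Q) (g (cell_index k L ga i).2).
    have -> : Q (f @^-1` grid_interval g (cell_index k L ga i).2) = lf Q (grid_interval g (cell_index k L ga i).2) by [].
    by rewrite /grid_interval prob_itvoc// ltW.
  by rewrite eQ; under eq_fun do rewrite eQ; apply: cvgB; apply: weak_cvg_cdf.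
have c2 : (fun n => \sum_ga Psi (cell_corner k L g ga) * cell_prob (rhon n) (pisn n) (P0n n) f k L g ga)
    @ \oo --> \sum_ga Psi (cell_corner k L g ga) * cell_prob rho pis P0 f k L g ga.
  by apply: cvg_fin_sum => ga; apply: cvgM => //; exact: cvg_cst.
have /cvgrPdist_le /(_ _ e30) := c2; apply: filterS => n hc.
have := hn n; move: h0 hc.
set a := \int[PP]_w _; set b := \sum_ga _; set c := \sum_ga _; set a' := \int[_]_w _.
rewrite !ler_norml => /andP[? ?] /andP[? ?] /andP[? ?]; apply/andP; split; lra.
Qed.

Lemma weight_zproc_ae {d'} {O : measurableType d'} (P : probability O R) r p Q
    (u : nat -> O -> R) (t : nat -> O -> XB X) (f : X -> R) :
  lazy_msb P r p Q u t ->
  {ae P, forall w, weight_map (zproc u t f w) = fun j => sb_weight (u ^~ w) j * f (t j w)}.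
Proof.
move=> /lazy_msb_support; apply: filterS => w u01; apply/funext => j.
rewrite /weight_map /zproc /=; congr (sb_weight _ _ * _).
by apply/funext => i; rewrite clip01_id.
Qed.

Lemma cvg_integral_weights (f : X -> R) (B : R) (G : {ptws nat -> R} -> R) (M : R) :
  continuous f -> 1 <= B -> (forall x, `|f x| <= B) ->
  continuous G -> (forall z, `|G z| <= M) ->
  (fun n => \int[PPn n]_w (G (fun j => sb_weight (vn n ^~ w) j * f (thn n j w)))%:E)%E @ \oo -->
  (\int[PP]_w (G (fun j => sb_weight (v ^~ w) j * f (th j w)))%:E)%E.
Proof.
move=> cf B1 fB cG GM.
pose Psi z := G (weight_map z).
have cPsi : continuous Psi.
  move=> z; apply: (@continuous_comp _ _ _ weight_map G); last exact: cG.
  exact: weight_map_continuous.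
have e : forall d' (O : measurableType d') (P : probability O R) r p Q u
    (t : nat -> O -> XB X), lazy_msb P r p Q u t -> (\int[P]_w (G (fun j => sb_weight (u ^~ w) j * f (t j w)))%:E)%E =
    (\int[P]_w Psi (zproc u t f w))%:E.
  move=> d' O P r p Q u t h; rewrite /Rintegral fineK; last first.
    apply: (integral_bounded_fin _ (fun w => Psi (zproc u t f w)) M); last by move=> w; apply: GM.
    have [_ _ _ mvth _] := h.
    exact: (measurable_zproc _ _ (fun j => (mvth j).1) (fun j => (mvth j).2) f cf B B1 fB Psi cPsi).
  apply: integral_eq_ae; have := weight_zproc_ae _ _ _ _ _ _ f h.
  by apply: filterS => w; rewrite /Psi => ->.
rewrite (e _ _ _ _ _ _ _ _ H); under eq_fun do rewrite (e _ _ _ _ _ _ _ _ (Hn _)).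
have c := cvg_Rintegral_zproc f B Psi M cf B1 fB cPsi (fun z => GM _).
exact: cvg_comp c _.
Qed.

End limit.

(** * Deterministic stick-breaking sums *)

Section stick_breaking_sums.
Context {R : realType}.
Implicit Types u t : nat -> R.

Definition sb_rem u (k : nat) : R := \prod_(i < k) (1 - u i).

Lemma sb_remS u k : sb_rem u k.+1 = sb_rem u k * (1 - u k).
Proof. by rewrite /sb_rem big_ord_recr. Qed.

Lemma sb_weightE u k : sb_weight u k = u k * sb_rem u k.
Proof. by []. Qed.

Lemma series_sb_weight u k : series (sb_weight u) k = 1 - sb_rem u k.
Proof.
elim: k => [|k IH]; first by rewrite /series/= big_geq// /sb_rem big_ord0 subrr.
by rewrite seriesSr IH sb_remS sb_weightE; ring.
Qed.

Section unit_interval.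
Variable u : nat -> R.
Hypothesis u01 : forall i, 0 <= u i <= 1.

Lemma sb_rem01 k : 0 <= sb_rem u k <= 1.
Proof.
elim: k => [|k]; first by rewrite /sb_rem big_ord0 ler01 lexx.
rewrite sb_remS => /andP[? ?]; have /andP[? ?] := u01 k; apply/andP; split; nra.
Qed.

Lemma sb_weight_ge0 k : 0 <= sb_weight u k.
Proof.
by rewrite sb_weightE mulr_ge0//; [case/andP: (u01 k)|case/andP: (sb_rem01 k)].
Qed.

Lemma sb_weight_rem k : sb_weight u k = sb_rem u k - sb_rem u k.+1.
Proof. by rewrite sb_weightE sb_remS; ring. Qed.

Variables (t : nat -> R) (B : R).
Hypothesis tB : forall i, `|t i| <= B.

(** Each weight is a difference of consecutive remaining sticks, so the weights from [k] to [m - 1]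
    add up to [sb_rem u k - sb_rem u m]. *)
Lemma series_sb_dist k m : (k <= m)%N ->
  `|series (fun j => sb_weight u j * t j) m - series (fun j => sb_weight u j * t j) k|
  <= B * (sb_rem u k - sb_rem u m).
Proof.
elim: m => [|m IH]; first by rewrite leqn0 => /eqP ->; rewrite !subrr normr0 mulr0.
rewrite leq_eqVlt => /predU1P[->|]; first by rewrite !subrr normr0 mulr0.
rewrite ltnS => /IH; rewrite seriesSr.
set S := series _ m; set S' := series _ k => h.
have -> : S + sb_weight u m * t m - S' = (S - S') + sb_weight u m * t m by ring.
rewrite (le_trans (ler_normD _ _))// normrM (ger0_norm (sb_weight_ge0 m)).
have -> : B * (sb_rem u k - sb_rem u m.+1) =
  B * (sb_rem u k - sb_rem u m) + sb_weight u m * B by rewrite sb_weight_rem; ring.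
by apply: lerD => //; apply: ler_wpM2l => //; exact: sb_weight_ge0.
Qed.

Lemma is_cvg_series_sb : cvgn (series (fun j => sb_weight u j * t j)).
Proof.
apply: normed_cvg.
have B0 : 0 <= B by rewrite (le_trans _ (tB 0)).
apply: nondecreasing_is_cvgn.
  by apply: nondecreasing_series => *; exact: normr_ge0.
exists B => _ [n _ <-].
apply: (@le_trans _ _ (series (fun j => sb_weight u j * B) n)).
  rewrite /series/=; apply: ler_sum => i _.
  by rewrite normrM ger0_norm ?sb_weight_ge0// ler_wpM2l// sb_weight_ge0.
rewrite /series/= -mulr_suml -[X in X * _]/(series (sb_weight u) n) series_sb_weight.
by have /andP[r0 r1] := sb_rem01 n; nra.
Qed.

Lemma lim_series_sb_dist k :
  `|limn (series (fun j => sb_weight u j * t j)) - series (fun j => sb_weight u j * t j) k|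
  <= B * sb_rem u k.
Proof.
have B0 : 0 <= B by rewrite (le_trans _ (tB 0)).
have c := is_cvg_series_sb.
have c2 : (fun m => `|series (fun j => sb_weight u j * t j) m -
    series (fun j => sb_weight u j * t j) k|) @ \oo -->
  `|limn (series (fun j => sb_weight u j * t j)) - series (fun j => sb_weight u j * t j) k|.
  by apply: cvg_norm; apply: cvgB => //; exact: cvg_cst.
rewrite -(cvg_lim _ c2)//; apply: limr_le; first by apply/cvg_ex; eexists; exact: c2.
near=> m; rewrite (le_trans (series_sb_dist k m _))//; first by near: m; exists k.
by rewrite ler_wpM2l// lerBlDr lerDl; case/andP: (sb_rem01 m).
Unshelve. all: by end_near. Qed.

End unit_interval.
End stick_breaking_sums.

Lemma cvg_partial_series {R : realType} {T : Type} (F : set_system T) (FF : Filter F)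
  (y : T -> nat -> R) y0 k : (forall i, (fun t => y t i) @ F --> y0 i) ->
  (fun t => series (y t) k) @ F --> series y0 k.
Proof.
move=> yy; rewrite /series/=; elim: k => [|k IH].
  by under eq_fun do rewrite big_geq//; rewrite big_geq//; exact: cvg_cst.
under eq_fun do rewrite big_nat_recr//=; rewrite big_nat_recr//=.
exact: cvgD.
Qed.

Lemma continuous_ptws_series {R : realType} k :
  continuous (fun y : {ptws nat -> R} => series (y : nat -> R) k).
Proof.
move=> y; apply: (cvg_partial_series (nbhs y) (nbhs_filter y) (fun y => y : nat -> R)) => i.
exact: (@proj_continuous _ (fun _ : nat => R) i y).
Qed.

(** The modulus of a functional that looks at coordinate [0] only, tested on constant sequences. As
    there, [y] may leave [[- B, B]]. *)
Lemma Heine_Cantor_itv {R : realType} (g : R -> R) (B e : R) : continuous g -> 0 < e ->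
  exists2 dl : R, 0 < dl & forall x y, `|x| <= B -> `|x - y| < dl -> `|g x - g y| < e.
Proof.
move=> cg e0.
have cG : continuous (fun z : {ptws nat -> R} => g (z 0%N)).
  move=> z; apply: (@continuous_comp _ _ _ (fun z : {ptws nat -> R} => z 0%N) g); last exact: cg.
  exact: (@proj_continuous _ (fun _ : nat => R) 0%N z).
have [k hk] := ptws_modulus _ _ _ (@segment_compact R (- B) B) cG e0.
exists k.+1%:R^-1; first by rewrite invr_gt0.
move=> x y xB xy; apply: (hk (fun=> x) (fun=> y)) => // i.
by rewrite /= in_itv/= -ler_norml.
Qed.

(** * Truncation of the random integral *)

Section truncation.
Context {R : realType} {X : completePseudoMetricType R}.
Context {d : measure_display} {Omega : measurableType d} (P : probability Omega R).
Variables (rho : R) (pis : nat -> probability R R) (P0 : probability (XB X) R).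
Variables (v : nat -> Omega -> R) (th : nat -> Omega -> XB X).
Hypothesis H : lazy_msb P rho pis P0 v th.
Hypothesis Hp : proper_sb P v.
Variables (f : X -> R) (cf : continuous f) (B : R) (B1 : 1 <= B).
Hypothesis fB : forall x, `|f x| <= B.

Definition clip_rem k w := sb_rem (fun i => clip01 (v i w)) k.

Definition clip_partial k w := series (weight_map (zproc v th f w) : nat -> R) k.

Definition clip_total w := limn (series (weight_map (zproc v th f w) : nat -> R) : R^nat).

Let mv j : measurable_fun setT (v j). Proof. by have [_ _ _ /(_ j)[]] := H. Qed.

Lemma measurable_clip_rem k : measurable_fun setT (clip_rem k).
Proof.
apply: measurable_prod => i _; apply: measurable_funB => //.
exact: (measurableT_comp measurable_clip01 (mv i)).
Qed.

Lemma clip_rem01 k w : 0 <= clip_rem k w <= 1.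
Proof. by apply: sb_rem01 => i; exact: clip01_itv. Qed.

Lemma clip_partial_cvg w : clip_partial ^~ w @ \oo --> clip_total w.
Proof.
exact: (is_cvg_series_sb (fun i => clip01 (v i w)) (fun i => clip01_itv _)
  (fun i => f (th i w)) B (fun i => fB _)).
Qed.

Lemma clip_total_dist k w : `|clip_total w - clip_partial k w| <= B * clip_rem k w.
Proof.
exact: (lim_series_sb_dist (fun i => clip01 (v i w)) (fun i => clip01_itv _)
  (fun i => f (th i w)) B (fun i => fB _)).
Qed.

Lemma clip_partial_bound k w : `|clip_partial k w| <= B.
Proof.
have := series_sb_dist (fun i => clip01 (v i w)) (fun i => clip01_itv _)
  (fun i => f (th i w)) B (fun i => fB _) 0%N k (leq0n k).
rewrite {2}/series/= big_geq// subr0 => /le_trans; apply.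
have /andP[r0 _] := clip_rem01 k w.
rewrite [X in X - _](_ : _ = 1); last by rewrite /sb_rem big_ord0.
by rewrite ler_piMr ?(le_trans ler01)// lerBlDr lerDl.
Qed.

Lemma measurable_clip_partial k : measurable_fun setT (clip_partial k).
Proof.
apply: measurable_sum => j; apply: measurable_funM.
  apply: measurable_funM; first exact: (measurableT_comp measurable_clip01 (mv j)).
  apply: measurable_prod => i _; apply: measurable_funB => //.
  exact: (measurableT_comp measurable_clip01 (mv i)).
have [_ _ _ /(_ j)[_ mth] _] := H.
exact: (measurableT_comp (measurable_continuous_XB _ cf) mth).
Qed.

Lemma measurable_clip_total : measurable_fun setT clip_total.
Proof.
apply: (@measurable_fun_cvg _ _ _ setT clip_partial).
  exact: measurable_clip_partial.
by move=> w _; exact: clip_partial_cvg.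
Qed.

(** Properness makes the coefficient of the [P0] term vanish almost surely, and almost surely
    clipping changes no stick. *)
Lemma sb_integral_ae : {ae P, forall w, sb_integral P0 v th f w = clip_total w}.
Proof.
apply: filterS2 (weight_zproc_ae P _ _ _ _ _ f H) Hp => w e p.
rewrite /sb_integral /clip_total (cvg_lim _ p)// subrr mul0r addr0.
by rewrite e.
Qed.

Lemma clip_rem_cvg0 : (fun k => \int[P]_w clip_rem k w) @ \oo --> (0 : R).
Proof.
have := bounded_cvg_integral P clip_rem (cst 0) 1.
rewrite /= -/(Rintegral _ _ _) Rintegral_prob_cst; apply.
- exact: measurable_clip_rem.
- exact: measurable_cst.
- by move=> k w; have /andP[r0 r1] := clip_rem01 k w; rewrite ger0_norm.
- by move=> w; rewrite normr0.
apply: filterS2 (lazy_msb_support P _ _ _ _ _ H) Hp => w v01 p.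
rewrite /clip_rem; have -> : (fun i => clip01 (v i w)) = v ^~ w.
  by apply/funext => i; rewrite clip01_id.
have -> : (fun k => sb_rem (v ^~ w) k) = (fun k => 1 - series (sb_weight (v ^~ w)) k).
  by apply/funext => k; rewrite series_sb_weight opprB addrC subrK.
by rewrite -(subrr 1); apply: cvgB => //; exact: cvg_cst.
Qed.

Variables (g : R -> R) (cg : continuous g) (M : R) (gM : forall x, `|g x| <= M).

(** A Markov-type bound. Where [B * clip_rem k w < dl], uniform continuity gives [e]; elsewhere the
    trivial bound [2 * M] is at most [2 * M * (B * clip_rem k w / dl)], which is the origin of the
    constant. *)
Lemma truncation_error (e dl : R) k : 0 < e -> 0 < dl ->
  (forall x y, `|x| <= B -> `|x - y| < dl -> `|g x - g y| < e) ->
  `|\int[P]_w g (clip_total w) - \int[P]_w g (clip_partial k w)| <=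
  e + (2 * M * B / dl) * \int[P]_w clip_rem k w.
Proof.
move=> e0 dl0 hg; set C := 2 * M * B / dl.
have M0 : 0 <= M by rewrite (le_trans _ (gM 0)).
have C0 : 0 <= C by rewrite /C divr_ge0 ?(ltW dl0)// mulr_ge0 ?(le_trans ler01 B1)// mulr_ge0.
have CE : C = 2 * M * B / dl by [].
clearbody C.
have mg := continuous_measurable_fun cg.
have mr : measurable_fun setT (fun w => C * clip_rem k w).
  by apply: measurable_funM => //; exact: measurable_clip_rem.
have rb w : `|C * clip_rem k w| <= C.
  have /andP[r0 r1] := clip_rem01 k w; rewrite ger0_norm ?mulr_ge0//.
  by rewrite ler_piMr.
apply: (@le_trans _ _ (\int[P]_w (e + C * clip_rem k w))); last first.
  rewrite RintegralD//; last exact: (integrable_bounded P _ C mr rb).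
    rewrite Rintegral_prob_cst RintegralZl//.
    apply: (integrable_bounded P _ 1); first exact: measurable_clip_rem.
    by move=> w; have /andP[r0 r1] := clip_rem01 k w; rewrite ger0_norm.
  by apply: (integrable_bounded P _ e) => // w; rewrite gtr0_norm.
apply: (Rintegral_dist_le P _ _ _ (M + (e + C))).
- exact: (measurableT_comp mg measurable_clip_total).
- exact: (measurableT_comp mg (measurable_clip_partial k)).
- exact: measurable_funD.
- by move=> w; rewrite (le_trans (gM _))// lerDl addr_ge0// ltW.
- by move=> w; rewrite (le_trans (gM _))// lerDl addr_ge0// ltW.
- move=> w; rewrite (le_trans (ler_normD _ _))// gtr0_norm//.
  by rewrite (le_trans (lerD (lexx _) (rb w)))// lerDr.
move=> w; have /andP[r0 r1] := clip_rem01 k w.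
have [small|big] := ltP (B * clip_rem k w) dl.
  apply/ltW; rewrite distrC; apply: (@lt_le_trans _ _ e); last by rewrite lerDl mulr_ge0.
  apply: hg; first exact: clip_partial_bound.
  by rewrite distrC (le_lt_trans (clip_total_dist _ _)).
apply: (@le_trans _ _ (M + M)); first by rewrite (le_trans (ler_normB _ _))// lerD.
rewrite ler_wpDl ?(ltW e0)//.
have -> : C * clip_rem k w = (M + M) * ((B * clip_rem k w) / dl) by rewrite CE; ring.
by rewrite ler_peMr ?addr_ge0// ler_pdivlMr// mul1r.
Qed.

End truncation.

(** * Convergence of the weights and of the random integrals *)

Section convergence.
Context {R : realType} {X : completePseudoMetricType R}.
Context {d : measure_display} {Omega : measurableType d} (PP : probability Omega R).
Variables (rho : R) (pis : nat -> probability R R) (P0 : probability (XB X) R).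
Variables (v : nat -> Omega -> R) (th : nat -> Omega -> XB X).
Variables (dn : nat -> measure_display) (Omegan : forall n, measurableType (dn n))
    (PPn : forall n, probability (Omegan n) R)
    (rhon : nat -> R) (pisn : nat -> nat -> probability R R)
    (P0n : nat -> probability (XB X) R)
    (vn : forall n, nat -> Omegan n -> R) (thn : forall n, nat -> Omegan n -> XB X).
Hypothesis H : lazy_msb PP rho pis P0 v th.
Hypothesis Hp : proper_sb PP v.
Hypothesis Hn : forall n, lazy_msb (PPn n) (rhon n) (pisn n) (P0n n) (vn n) (thn n).
Hypothesis Hpn : forall n, proper_sb (PPn n) (vn n).
Hypothesis crho : rhon @ \oo --> rho.
Hypothesis cP0 : weak_cvg_X (fun n => P0n n) P0.
Hypothesis cpi : forall j, weak_cvg_R (fun n => pisn n j) (pis j).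

Lemma cvg_dist_weights :
  cvg_dist_seq PP PPn (fun n w j => sb_weight (vn n ^~ w) j)
       (fun w j => sb_weight (v ^~ w) j).
Proof.
move=> G cG [M GM].
have f1 (x : X) : `|cst (1 : R) x| <= 1 by rewrite normr1.
have c1 : continuous (cst (1 : R) : X -> R) by move=> x; exact: cvg_cst.
have E d' (O : measurableType d') (P : probability O R) (u : nat -> O -> R) (t : nat -> O -> XB X) :
    (\int[P]_w (G (fun j => sb_weight (u ^~ w) j))%:E =
     \int[P]_w (G (fun j => sb_weight (u ^~ w) j * cst 1 (t j w)))%:E)%E.
  by apply: eq_integral => w _; congr ((G _)%:E); apply/funext => j; rewrite mulr1.
rewrite (E _ _ _ _ th); under eq_fun do rewrite (E _ _ _ _ (thn _)).
exact: (cvg_integral_weights PP _ _ _ _ _ _ _ _ _ _ _ _ _ H Hn crho cP0 cpi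
  (cst 1) 1 G M c1 (lexx _) f1 cG GM).
Qed.

Lemma cvg_clip_partial (f : X -> R) (B : R) (g : R -> R) (M : R) k :
  continuous f -> 1 <= B -> (forall x, `|f x| <= B) ->
  continuous g -> (forall x, `|g x| <= M) ->
  (fun n => \int[PPn n]_w g (clip_partial (vn n) (thn n) f k w)) @ \oo -->
  \int[PP]_w g (clip_partial v th f k w).
Proof.
move=> cf B1 fB cg gM.
apply: (cvg_Rintegral_zproc PP _ _ _ _ _ _ _ _ _ _ _ _ _ H Hn crho cP0 cpi
  f B (fun z => g (series (weight_map z : nat -> R) k)) M) => //.
move=> z; apply: (@continuous_comp _ _ _ weight_map (fun y : {ptws nat -> R} => g (series (y : nat -> R) k))).
  exact: weight_map_continuous.
apply: (@continuous_comp _ _ _ (fun y : {ptws nat -> R} => series (y : nat -> R) k) g).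
  exact: continuous_ptws_series.
exact: cg.
Qed.

(** The remaining stick is [1] minus a partial sum for the constant [f = 1]. The outer [clip01] does
    not change its value and makes the test function bounded on the whole line. *)
Lemma cvg_clip_rem k :
  (fun n => \int[PPn n]_w clip_rem (vn n) k w) @ \oo --> \int[PP]_w clip_rem v k w.
Proof.
have f1 (x : X) : `|cst (1 : R) x| <= 1 by rewrite normr1.
have c1 : continuous (cst (1 : R) : X -> R) by move=> x; exact: cvg_cst.
have cg : continuous (fun x : R => clip01 (1 - x)).
  move=> x; apply: (@continuous_comp _ _ _ (fun x : R => 1 - x) clip01).
    by apply: cvgB; [exact: cvg_cst|exact: cvg_id].
  exact: continuous_clip01.
have gM (x : R) : `|clip01 (1 - x)| <= 1.
  by have /andP[c0 c1'] := clip01_itv (1 - x); rewrite ger0_norm.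
have e d' (O : measurableType d') (u : nat -> O -> R) (t : nat -> O -> XB X) w :
    clip_rem u k w = clip01 (1 - clip_partial u t (cst (1 : R)) k w).
  rewrite /clip_partial /weight_map /=.
  under [X in series X]eq_fun do rewrite mulr1.
  rewrite series_sb_weight opprB addrC subrK clip01_id//.
  exact: clip_rem01.
have := cvg_clip_partial (cst 1) 1 _ 1 k c1 (lexx _) f1 cg gM.
rewrite (_ : (fun n => _) = (fun n => \int[PPn n]_w clip_rem (vn n) k w)); last first.
  by apply/funext => n; apply: eq_Rintegral => w _; rewrite (e _ _ _ (thn n)).
by rewrite (_ : \int[PP]_w _ = \int[PP]_w clip_rem v k w)//;
  apply: eq_Rintegral => w _; rewrite (e _ _ _ th).
Qed.

Lemma cvg_dist_sb_integral (f : X -> R) : continuous f -> (exists M : R, forall x, `|f x| <= M) ->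
  cvg_dist_R PP PPn (fun n => sb_integral (P0n n) (vn n) (thn n) f)
       (sb_integral P0 v th f).
Proof.
move=> cf [B' fB'] g cg [M gM].
(* With [1 <= B] a single grid covers both the sticks, in [[0, 1]], and the values of [f], in
   [[- B, B]]. *)
pose B := Num.max 1 B'.
have B1 : 1 <= B by rewrite le_max lexx.
have fB x : `|f x| <= B by rewrite (le_trans (fB' x))// le_max lexx orbT.
have M0 : 0 <= M by rewrite (le_trans _ (gM 0)).
have e : forall d' (O : measurableType d') (P : probability O R) r p Q u
    (t : nat -> O -> XB X), lazy_msb P r p Q u t -> proper_sb P u ->
    (\int[P]_w (g (sb_integral Q u t f w))%:E)%E = (\int[P]_w g (clip_total u t f w))%:E.
  move=> d' O P r p Q u t h hp; rewrite /Rintegral fineK; last first.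
    apply: (integral_bounded_fin _ _ M); last by move=> w; exact: gM.
    apply: (measurableT_comp (continuous_measurable_fun cg)).
    exact: (measurable_clip_total P _ _ _ _ _ h f cf B fB).
  apply: integral_eq_ae; have := sb_integral_ae P _ _ _ _ _ h hp f.
  by apply: filterS => w ->.
rewrite (e _ _ _ _ _ _ _ _ H Hp); under eq_fun do rewrite (e _ _ _ _ _ _ _ _ (Hn _) (Hpn _)).
suff c : (fun n => \int[PPn n]_w g (clip_total (vn n) (thn n) f w)) @ \oo -->
    \int[PP]_w g (clip_total v th f w) by exact: cvg_comp c _.
apply/cvgrPdist_le => e' e0.
(* Five errors: for each of the two truncations a continuity error and a remaining-stick error, plus
   the distance of the truncated expectations. The level [k] comes from the limit process, and the
   convergence of the expected remaining stick at that fixed [k] controls the [n]-th process. *)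
have e5 : 0 < e' / 5 by rewrite divr_gt0.
have [dl dl0 hdl] := Heine_Cantor_itv g B _ cg e5.
pose C := 2 * M * B / dl.
have C0 : 0 <= C by rewrite /C divr_ge0 ?(ltW dl0)// mulr_ge0 ?(le_trans ler01 B1)// mulr_ge0.
have [k hk] : exists k, C * \int[PP]_w clip_rem v k w < e' / 5.
  have : (fun k => C * \int[PP]_w clip_rem v k w) @ \oo --> C * 0.
    by apply: cvgM; [exact: cvg_cst|exact: (clip_rem_cvg0 PP _ _ _ _ _ H Hp)].
  rewrite mulr0 => /(cvgr_lt _) /(_ _ e5) [k _ hk].
  by exists k; exact: hk k (leqnn k).
have h0 := truncation_error PP _ _ _ _ _ H f cf B B1 fB g cg M gM _ _ k e5 dl0 hdl.
have hn n := truncation_error (PPn n) _ _ _ _ _ (Hn n) f cf B B1 fB g cg M gM _ _ k e5 dl0 hdl.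
have c1 := cvg_clip_partial f B g M k cf B1 fB cg gM.
have c2 : (fun n => C * \int[PPn n]_w clip_rem (vn n) k w) @ \oo --> C * \int[PP]_w clip_rem v k w.
  by apply: cvgM; [exact: cvg_cst|exact: cvg_clip_rem].
near=> n.
have h1 : C * \int[PPn n]_w clip_rem (vn n) k w < e' / 5.
  by near: n; exact: (cvgr_lt _ c2).
have h2 : `|\int[PP]_w g (clip_partial v th f k w) -
    \int[PPn n]_w g (clip_partial (vn n) (thn n) f k w)| <= e' / 5.
  by near: n; move/cvgrPdist_le : c1; apply.
have := hn n; have := hk; move: h0 h1 h2; rewrite -/C.
set a := \int[PP]_w g _; set b := \int[PP]_w g _; set c := C * _; set a' := \int[_]_w g _.
set b' := \int[_]_w g _; set c' := C * _ => + + + + h.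
move: h; rewrite !ler_norml => /andP[? ?] /andP[? ?] ? /andP[? ?] ?; apply/andP; split; lra.
Unshelve. all: by end_near. Qed.

End convergence.

(** * The cases rho = 0 and rho = 1 *)

Section extreme_rho.
Context {R : realType}.
Variable pis : nat -> probability R R.
Local Open Scope ereal_scope.

Lemma mc_fdd_from0 (A : nat -> set R) m j x : (forall i, measurable (A i)) ->
  mc_fdd_from 0 pis A m j x = \prod_(i < m) pis (j.+1 + i)%N (A (j.+1 + i)%N).
Proof.
move=> mA; elim: m j x => [|m IH] j x /=; first by rewrite big_ord0.
rewrite mul0r mul0e add0e subr0 mul1e big_ord_recl /= addn0.
under eq_integral do rewrite IH.
rewrite integral_cst// muleC; congr (_ * _).
by apply: eq_bigr => i _; rewrite /bump/= add1n addnS addSn.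
Qed.

Lemma mc_fdd0 (A : nat -> set R) k : (forall i, measurable (A i)) ->
  mc_fdd 0 pis A k = \prod_(i < k) pis i (A i).
Proof.
move=> mA; case: k => [|k] /=; first by rewrite big_ord0.
under eq_integral do rewrite mc_fdd_from0//.
by rewrite integral_cst// muleC big_ord_recl.
Qed.

Lemma mc_fdd_from1S (A : nat -> set R) m j x :
  mc_fdd_from 1 pis A m.+1 j x =
  (\1_(A j.+1) (Upsilon pis j x))%:E * mc_fdd_from 1 pis A m j.+1 (Upsilon pis j x).
Proof. by rewrite /= mul1r subrr mul0e adde0. Qed.

Lemma mc_fdd_from1_T (A : nat -> set R) m j x : (forall i, (0 < i)%N -> A i = setT) ->
  mc_fdd_from 1 pis A m j x = 1.
Proof.
move=> AT; elim: m j x => [//|m IH] j x.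
by rewrite mc_fdd_from1S IH AT// indicT mule1.
Qed.

(** For [rho = 1] every kernel is a Dirac mass at [Upsilon]: the constraints at [j] and [j.+1] meet
    no trajectory. *)
Lemma mc_fdd1_null (A : nat -> set R) j : (forall x, A j x -> ~ A j.+1 (Upsilon pis j x)) ->
  mc_fdd 1 pis A j.+2 = 0.
Proof.
move=> Aj.
have step m x : A j x -> mc_fdd_from 1 pis A m.+1 j x = 0.
  move=> /Aj h; rewrite mc_fdd_from1S indicE memNset// mul0e//.
have h m l x : (l < j)%N -> (j < l + m)%N -> mc_fdd_from 1 pis A m l x = 0.
  elim: m l x => [|m IH] l x lj jlm; first by move: jlm; rewrite addn0 ltnNge (ltnW lj).
  rewrite mc_fdd_from1S; have [e|e] := eqVneq l.+1 j.
    rewrite e indicE; case: (boolP (_ \in _)) => [|_]; last by rewrite mul0e.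
    rewrite inE => /step; case: m IH jlm => [|m] IH jlm; last by move=> ->; rewrite mule0.
    by move: jlm; rewrite addn1 e ltnn.
  rewrite IH ?mule0//; first by rewrite ltn_neqAle e.
  by rewrite addSnnS.
rewrite /mc_fdd; apply: integral0_eq => x A0x.
by case: j Aj step h => [|j] Aj step h; [exact: step|exact: h].
Qed.

End extreme_rho.

Section rho0.
Context {R : realType} {X : completePseudoMetricType R}.
Context {d : measure_display} {Omega : measurableType d} (P : probability Omega R).
Variables (pis : nat -> probability R R) (P0 : probability (XB X) R).
Variables (v : nat -> Omega -> R) (th : nat -> Omega -> XB X).
Hypothesis H : lazy_msb P 0 pis P0 v th.

Lemma lazy_msb0_indep : indep_with_laws P pis v.
Proof.
have [_ _ _ _ fdd] := H => k A mA.
have := fdd k A (fun=> setT) mA (fun=> measurableT).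
rewrite mc_fdd0// [X in (_ * X)%E]big1 ?mule1; last by move=> i _; rewrite probability_setT.
by move=> <-; congr (P _); apply/seteqP; split=> w h i ik; have := h i ik; [split|case].
Qed.

Lemma lazy_msb0_pitman_yor sig tht :
  (forall j, is_beta (pis j) (1 - sig) (tht + j.+1%:R * sig)) ->
  pitman_yor P sig tht P0 v th.
Proof.
have [_ _ _ mvth fdd] := H => hb; split; [by move=> j; case: (mvth j)..|].
move=> k A B mA mB; rewrite fdd// mc_fdd0//; congr (_ * _)%E.
by apply: eq_bigr => i _; rewrite hb.
Qed.

End rho0.

Section rho1.
Context {R : realType} {X : completePseudoMetricType R}.
Context {d : measure_display} {Omega : measurableType d} (P : probability Omega R).
Variables (pis : nat -> probability R R) (P0 : probability (XB X) R).
Variables (v : nat -> Omega -> R) (th : nat -> Omega -> XB X).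
Hypothesis H : lazy_msb P 1 pis P0 v th.

Lemma lazy_msb1_null j (C D : set R) : measurable C -> measurable D ->
  (forall x, C x -> ~ D (Upsilon pis j x)) ->
  P (v j @^-1` C `&` v j.+1 @^-1` D) = 0%E.
Proof.
move=> mC mD CD; have [_ _ _ mvth fdd] := H.
pose A i := if i == j then C else if i == j.+1 then D else setT.
have Aj : A j = C by rewrite /A eqxx.
have AjS : A j.+1 = D by rewrite /A eqxx gtn_eqF.
have mA i : measurable (A i) by rewrite /A; do 2!case: ifP => // _.
have := fdd j.+2 A (fun=> setT) mA (fun=> measurableT).
rewrite mc_fdd1_null ?mul0e; last by rewrite Aj AjS.
move=> <-; congr (P _); apply/seteqP; split=> w /=.
  move=> [h1 h2] i _; split => //=; rewrite /A; case: eqP => [->//|_].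
  by case: eqP => [->|].
by move=> h; split; [rewrite -Aj|rewrite -AjS]; apply: (h _ _).1 => /=.
Qed.

(** The finite-dimensional formula sees rectangles only. Two distinct reals are separated by a
    rational [q], so the exceptional event is covered by countably many rectangles [N q], each
    incompatible with the deterministic move and hence null. *)
Lemma lazy_msb1_Upsilon : {ae P, forall w, forall j, v j.+1 w = Upsilon pis j (v j w)}.
Proof.
have [rho01 npis dP0 mvth _] := H.
apply: ae_foralln => j; have mU := measurable_Upsilon _ npis j.
pose N (q : rat) : set Omega :=
  (v j @^-1` (Upsilon pis j @^-1` `[ratr q, +oo[%classic) `&` v j.+1 @^-1` `]-oo, ratr q[%classic) `|`
  (v j @^-1` (Upsilon pis j @^-1` `]-oo, ratr q[%classic) `&` v j.+1 @^-1` `[ratr q, +oo[%classic).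
have mN1 q : measurable (Upsilon pis j @^-1` `[ratr q, +oo[%classic).
  by rewrite -[X in measurable X]setTI; exact: mU.
have mN2 q : measurable (Upsilon pis j @^-1` `]-oo, ratr q[%classic).
  by rewrite -[X in measurable X]setTI; exact: mU.
have mv i A : measurable A -> measurable (v i @^-1` A).
  by move=> mA; rewrite -[X in measurable X]setTI; apply: (mvth i).1.
have nN q : P.-negligible (N q).
  apply: negligibleU; apply/negligibleP; try by apply: measurableI; apply: mv.
  - apply: lazy_msb1_null => // x /=; rewrite !in_itv/= andbT => h1 h2.
    by have := lt_le_trans h2 h1; rewrite ltxx.
  - apply: lazy_msb1_null => // x /=; rewrite !in_itv/= andbT => h1 h2.
    by have := lt_le_trans h1 h2; rewrite ltxx.
have nU : P.-negligible (\bigcup_n (if unpickle n is Some q then N q else set0)).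
  apply: negligible_bigcup => n; case: unpickle => [q|]; first exact: nN.
  exact: negligible_set0.
apply: negligibleS nU => w /= /eqP; rewrite neq_lt => /orP[vU|Uv].
- have [q] := rat_in_itvoo vU; rewrite in_itv/= => /andP[h1 h2].
  have a1 : Upsilon pis j (v j w) \in `[ratr q, +oo[ by rewrite in_itv/= andbT ltW.
  have a2 : v j.+1 w \in `]-oo, ratr q[ by rewrite in_itv.
  by exists (pickle q); [exact: I|rewrite pickleK; left].
- have [q] := rat_in_itvoo Uv; rewrite in_itv/= => /andP[h1 h2].
  have a1 : Upsilon pis j (v j w) \in `]-oo, ratr q[ by rewrite in_itv.
  have a2 : v j.+1 w \in `[ratr q, +oo[ by rewrite in_itv/= andbT ltW.
  by exists (pickle q); [exact: I|rewrite pickleK; right].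
Qed.

Lemma lazy_msb1_cd_sb : cd_sb P pis P0 v th.
Proof.
have [rho01 npis dP0 mvth fdd] := H.
split; [by move=> j; case: (mvth j)..|exact: lazy_msb1_Upsilon|].
move=> k A B mA mB.
pose A' i := if i is 0%N then A else setT.
have mA' i : measurable (A' i) by case: i => [|i]; [exact: mA|exact: measurableT].
have mc l : mc_fdd 1 pis A' l.+1 = pis 0%N A.
  have AT i : (0 < i)%N -> A' i = setT by case: i.
  rewrite /=; under eq_integral do rewrite (mc_fdd_from1_T _ _ _ _ _ AT).
  by rewrite integral_cst// mul1e.
case: k => [|k].
  have := fdd 1%N A' (fun=> setT) mA' (fun=> measurableT).
  rewrite mc big_ord_recl !big_ord0 probability_setT !mule1 => <-.
  congr (P _); apply/seteqP; split=> w.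
    by move=> [h _] [|//] _; split.
  by move=> /(_ 0%N isT)[h _]; split => // i; rewrite /= ltn0.
have := fdd k.+1 A' B mA' mB; rewrite mc => <-; congr (P _).
apply/seteqP; split=> w.
  by move=> [h1 h2] [|i] ik; split => //=; exact: h2.
by move=> h; split; [exact: (h 0%N isT).1|move=> i ik; exact: (h i ik).2].
Qed.

End rho1.

(** * Beta laws: densities and stochastic order *)

Section beta.
Context {R : realType}.
Local Notation leb := (@lebesgue_measure R).

Definition beta01 (a b x : R) : R := beta_dens a b x * \1_(`]0, 1[%classic : set R) x.

Lemma beta01_ge0 a b x : 0 <= beta01 a b x.
Proof. by rewrite /beta01 /beta_dens !mulr_ge0 ?powR_ge0// indicE. Qed.

Lemma measurable_beta01 a b : measurable_fun setT (beta01 a b).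
Proof.
apply: measurable_funM; last exact: measurable_indic.
apply: measurable_funM; first exact: measurable_powR.
apply: (@measurableT_comp _ _ _ _ _ _ (@powR R ^~ (b - 1))); first exact: measurable_powR.
by apply: measurable_funB.
Qed.

(** The normalising integral is neither [0] nor infinite: in both cases its [fine] would be [0], and
    division by [0] would give total mass [0] instead of [1]. *)
Lemma is_beta_density (pi : probability R R) a b : is_beta pi a b ->
  exists2 c : R, 0 < c &
    forall A, measurable A -> pi A = (\int[leb]_(x in A) (c * beta01 a b x)%:E)%E.
Proof.
move=> hb; pose I (A : set R) : \bar R :=
  (\int[leb]_(x in A `&` `]0%R, 1%R[%classic) (beta_dens a b x)%:E)%E.
have IE A : measurable A -> I A = (\int[leb]_(x in A) (beta01 a b x)%:E)%E.
  move=> mA; rewrite /I integral_mkcondr; apply: eq_integral => x _.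
  by rewrite patchE /beta01 indicE; case: (x \in _); rewrite /= ?mulr1 ?mulr0.
have mb : measurable_fun setT (fun x => (beta01 a b x)%:E).
  by apply/measurable_EFinP; exact: (measurable_beta01 a b).
have I1 : I setT = (\int[leb]_(x in `]0%R, 1%R[%classic) (beta_dens a b x)%:E)%E.
  by rewrite /I setTI.
have I0 A : (0 <= I A)%E.
  by apply: integral_ge0 => x _; rewrite lee_fin /beta_dens mulr_ge0 ?powR_ge0.
have f0 : fine (I setT) != 0.
  apply/eqP => f0; have := hb setT measurableT; rewrite /beta_law.
  by rewrite -I1 f0 invr0 mulr0 probability_setT => -[] /eqP; rewrite oner_eq0.
have c0 : 0 < (fine (I setT))^-1.
  by rewrite invr_gt0 lt_neqAle eq_sym f0 fine_ge0.
have IT : I setT \is a fin_num by move: f0; case: (I setT) => [r||]//=; rewrite eqxx.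
exists (fine (I setT))^-1 => // A mA.
rewrite hb// /beta_law -I1 -/(I A).
have IA : I A \is a fin_num.
  rewrite ge0_fin_numE// (@le_lt_trans _ _ (I setT))//; last by rewrite -ge0_fin_numE.
  by rewrite !IE//; apply: ge0_subset_integral => // x _; rewrite lee_fin beta01_ge0.
under eq_integral do rewrite EFinM.
rewrite ge0_integralZl//.
- by rewrite -IE// mulrC EFinM fineK.
- exact: measurable_funTS.
- by move=> x _; rewrite lee_fin beta01_ge0.
- by rewrite lee_fin ltW.
Qed.

Lemma beta_cdf_le (pi pi' : probability R R) a b s (x : R) : 0 <= s ->
  nice_prob pi -> nice_prob pi' -> is_beta pi a b -> is_beta pi' a (b + s) ->
  Defs.cdf pi x <= Defs.cdf pi' x.
Proof.
move=> s0 npi npi' hb hb'.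
have [x0|x0] := leP x 0; first by rewrite cdf_le0// cdf_ge0.
have [x1|x1] := leP 1 x; first by rewrite [leRHS]cdf_ge1// cdf_le1.
have [c c0 hc] := is_beta_density _ _ _ hb.
have [c' c'0 hc'] := is_beta_density _ _ _ hb'.
(* The ratio of the two densities is decreasing and equals [r] at [x]: compare
   them on both sides of [x]. *)
pose r := c' / c * (1 - x) `^ s.
have r0 : 0 <= r by rewrite /r mulr_ge0 ?powR_ge0// divr_ge0// ltW.
have bE y : c' * beta01 a (b + s) y = (c' / c * (1 - y) `^ s) * (c * beta01 a b y).
  rewrite /beta01 indicE /beta_dens; case: (boolP (y \in _)) => [|_]; last by rewrite !mulr0.
  rewrite inE/= in_itv/= => /andP[y0 y1].
  have -> : b + s - 1 = (b - 1) + s by ring.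
  have -> : (1 - y) `^ (b - 1 + s) = (1 - y) `^ (b - 1) * (1 - y) `^ s.
    by rewrite powRD//; apply/implyP => _; rewrite subr_eq0 eq_sym lt_eqF.
  have : c != 0 by rewrite gt_eqF.
  by move=> ?; field.
have mb A u v w : measurable_fun A (fun x => (u * beta01 v w x)%:E).
  apply: measurable_funTS; apply/measurable_EFinP; apply: measurable_funM => //.
  exact: measurable_beta01.
have b0 u v w y : 0 < u -> (0 <= (u * beta01 v w y)%:E)%E.
  by move=> u0; rewrite lee_fin mulr_ge0 ?(ltW u0)// beta01_ge0.
have rpi A : measurable A -> (r%:E * pi A = \int[leb]_(y in A) (r * (c * beta01 a b y))%:E)%E.
  move=> mA; rewrite hc// -ge0_integralZl//; last by move=> y _; exact: b0.
  exact: mb.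
have h1 : (r%:E * pi `]-oo, x]%classic <= pi' `]-oo, x]%classic)%E.
  rewrite rpi// hc'//; apply: ge0_le_integral => //.
  - by move=> y _; rewrite lee_fin mulr_ge0// -lee_fin b0.
  - by apply/measurable_EFinP; apply: measurable_funM => //; apply/measurable_EFinP; exact: mb.
  - exact: mb.
  move=> y; rewrite /= in_itv/= => yx; rewrite lee_fin bE ler_wpM2r//.
    by rewrite -lee_fin b0.
  rewrite ler_wpM2l ?divr_ge0 ?(ltW c0) ?(ltW c'0)//.
  by rewrite ge0_ler_powR// ?nnegrE ?subr_ge0 ?(ltW x1) ?(le_trans yx) ?(ltW x1)// lerD2l lerN2.
have h2 : (pi' `]x, +oo[%classic <= r%:E * pi `]x, +oo[%classic)%E.
  rewrite rpi// hc'//; apply: ge0_le_integral => //.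
  - by move=> y _; exact: b0.
  - exact: mb.
  - by apply/measurable_EFinP; apply: measurable_funM => //; apply/measurable_EFinP; exact: mb.
  move=> y; rewrite /= in_itv/= andbT => xy; rewrite lee_fin.
  have [y1|y1] := leP 1 y.
    rewrite /beta01 indicE memNset ?mulr0//= in_itv/= => /andP[_].
    by rewrite ltNge y1.
  rewrite bE ler_wpM2r//; first by rewrite -lee_fin b0.
  rewrite ler_wpM2l ?divr_ge0 ?(ltW c0) ?(ltW c'0)//.
  by rewrite ge0_ler_powR// ?nnegrE ?subr_ge0 ?(ltW x1) ?(ltW y1)// lerD2l lerN2 ltW.
have comp (p : probability R R) : p `]x, +oo[%classic = (1 - Defs.cdf p x)%:E.
  rewrite EFinB cdfE -(@probability_setC _ _ _ p)//; congr (p _).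
  by apply/seteqP; split=> y /=; rewrite !in_itv/= andbT ltNge => /negP.
move: h1 h2; rewrite !comp -!cdfE -!EFinM !lee_fin.
have := cdf_ge0 pi x; have := cdf_le1 pi x; have := cdf_ge0 pi' x; have := cdf_le1 pi' x.
(* From [r F <= F'] and [1 - F' <= r (1 - F)] follows [F (1 - F') <= r F (1 - F) <= F' (1 - F)],
   that is [F <= F']. *)
set F := Defs.cdf pi x; set F' := Defs.cdf pi' x => ? ? ? ? ? ?; nra.
Qed.

Lemma Upsilon_beta_le (pis : nat -> probability R R) sig tht j x :
  (forall j, nice_prob (pis j)) -> 0 <= sig ->
  (forall j, is_beta (pis j) (1 - sig) (tht + j.+1%:R * sig)) ->
  0 <= x -> Upsilon pis j x <= x.
Proof.
move=> npis s0 hb x0; rewrite /Upsilon.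
have [u01|u01] := boolP (0 < Defs.cdf (pis j) x <= 1); last by rewrite cdf_inv_out.
rewrite cdf_inv_le//; apply: (beta_cdf_le _ _ (1 - sig) (tht + j.+1%:R * sig) sig) => //.
have -> : tht + j.+1%:R * sig + sig = tht + j.+2%:R * sig by rewrite -[j.+2%:R]natr1; ring.
exact: hb.
Qed.

Lemma lazy_msb1_beta_nonincreasing {X : completePseudoMetricType R}
  {d : measure_display} {Omega : measurableType d} (P : probability Omega R)
  (pis : nat -> probability R R) (P0 : probability (XB X) R)
  (v : nat -> Omega -> R) (th : nat -> Omega -> XB X) sig tht :
  lazy_msb P 1 pis P0 v th -> 0 <= sig ->
  (forall j, is_beta (pis j) (1 - sig) (tht + j.+1%:R * sig)) ->
  as_nonincreasing P (fun j w => sb_weight (v ^~ w) j).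
Proof.
move=> H s0 hb; have [_ npis _ _ _] := H.
apply: filterS2 (lazy_msb1_Upsilon P _ _ _ _ H) (lazy_msb_support P _ _ _ _ _ H) => w vU v01 j.
rewrite !sb_weightE sb_remS.
have /andP[r0 r1] := sb_rem01 (v ^~ w) v01 j.
have /andP[a0 a1] := v01 j; have /andP[b0 b1] := v01 j.+1.
have : v j.+1 w <= v j w by rewrite vU; exact: (Upsilon_beta_le pis sig tht j (v j w) npis s0 hb a0).
set V := v j w in a0 a1 *; set V' := v j.+1 w in b0 b1 *; set r := sb_rem _ _ in r0 r1 *.
move=> VV; have h : V' * (1 - V) <= V by nra.
by have := ler_wpM2r r0 h; rewrite -mulrA [(1 - V) * r]mulrC.
Qed.

End beta.

(** * Size-biased invariance *)

Section image_measure.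
Context {d d'} {T : measurableType d} {T' : measurableType d'} {R : realType}.
Variables (mu : {measure set T -> \bar R}) (f : T -> T') (mf : measurable_fun setT f).

Definition image_measure : {measure set T' -> \bar R}.
Proof. by refine (pushforward mu f : {measure set T' -> \bar R}). Defined.

Lemma ge0_integral_image (g : T' -> \bar R) : measurable_fun setT g ->
  (forall x, 0 <= g x)%E -> (\int[image_measure]_x g x = \int[mu]_x g (f x))%E.
Proof. by move=> mg g0; rewrite ge0_integral_pushforward. Qed.

End image_measure.

Section lebesgue_scaling.
Context {R : realType}.
Local Notation leb := (@lebesgue_measure R).

(** The image of Lebesgue measure under [y |-> s y], multiplied by [s], gives half-open intervals
    their length, so it is Lebesgue measure. *)
Lemma ge0_integral_scale (s : R) (f : R -> \bar R) : 0 < s ->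
  measurable_fun setT f -> (forall x, 0 <= f x)%E ->
  (\int[leb]_y (f (s * (y : R))%R * s%:E) = \int[leb]_q f q)%E.
Proof.
move=> s0 mf f0.
have ms : measurable_fun setT ((fun y : R => s * y) : measurableTypeR R -> measurableTypeR R).
  by apply: measurable_funM.
pose sn : {nonneg R} := NngNum (ltW s0).
pose m := mscale sn (image_measure leb _ ms).
have H : forall A, measurable A -> leb A = m A.
  apply: lebesgue_measure_unique => _ [[a b] _ <-].
  transitivity (s%:E * leb ((fun y : R => (s * y)%R) @^-1` `]a, b]%classic))%E; last by [].
  have -> : (fun y : R => s * y) @^-1` `]a, b]%classic = `](s^-1 * a), (s^-1 * b)]%classic.
    apply/seteqP; split=> y /=; rewrite !in_itv/=.
      by rewrite ltr_pdivrMl// ler_pdivlMl.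
    by rewrite ltr_pdivrMl// ler_pdivlMl.
  rewrite /= !lebesgue_measure_itv/= !lte_fin ltr_pM2l ?invr_gt0//.
  case: ifPn => _; last by rewrite mule0.
  rewrite -!EFinD -EFinM; congr EFin.
  have sn0 : s != 0 by rewrite gt_eqF.
  by field.
transitivity (\int[m]_q f q)%E; last first.
  by apply/esym; apply: eq_measure_integral => A mA _; exact: H.
rewrite /m ge0_integral_mscale//= ge0_integral_image//.
rewrite -ge0_integralZl//.
- by apply: eq_integral => y _; rewrite muleC.
- exact: (measurableT_comp mf ms).
- by rewrite lee_fin ltW.
Qed.

End lebesgue_scaling.

Lemma measurable_inv {R : realType} : measurable_fun setT (@GRing.inv R).
Proof.
(* Positive and negative parts are inverted separately; the identity also holds at [0], whose
   inverse is [0] by convention. *)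
rewrite (_ : @GRing.inv R = fun x => Num.max 0 x `^ (-1) - Num.max 0 (- x) `^ (-1)).
  apply: measurable_funB; apply: (@measurableT_comp _ _ _ _ _ _ (@powR R ^~ (-1)));
    try exact: measurable_powR; apply: measurable_maxr => //.
apply/funext => x; rewrite !powR_inv1 ?le_max ?lexx//.
have [x0|x0] := leP 0 x.
  by rewrite max_l ?oppr_le0// invr0 subr0.
by rewrite max_r ?oppr_ge0 ?ltW// invr0 sub0r invrN opprK.
Qed.

(** * Exchange of two beta sticks *)

Section beta_swap.
Context {R : realType}.
Local Notation leb := (@lebesgue_measure R).
Variables (sig b : R).

(* With [x ~ Beta(1 - sig, b)] and [y ~ Beta(1 - sig, b + sig)] independent and
   [q = y (1 - x)], the Jacobian [1 / (1 - x)] of [y |-> q] cancels the weight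
   [1 - x] of the reweighted law, leaving this density up to a constant. *)
Definition beta_joint (x q : R) : R :=
  beta01 (1 - sig) b x * beta01 (1 - sig) (b + sig) (q / (1 - x)).

Lemma beta_jointE x q : beta_joint x q =
  if [&& 0 < x, 0 < q & x + q < 1] then
    x `^ (1 - sig - 1) * q `^ (1 - sig - 1) * (1 - x - q) `^ (b + sig - 1) else 0.
Proof.
have [x0|x0] /= := ltP 0 x; last first.
  by rewrite /beta_joint /beta01 indicE memNset ?mulr0 ?mul0r//= in_itv/= ltNge x0.
have [x1|x1] := ltP x 1; last first.
  rewrite /beta_joint {1}/beta01 indicE memNset ?mulr0 ?mul0r//=; last first.
    by rewrite in_itv/= [x < 1]ltNge x1 andbF.
  case: ifPn => // /andP[q0]; rewrite ltNge => /negP; case.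
  by rewrite (le_trans x1)// lerDl ltW.
have s0 : 0 < 1 - x by rewrite subr_gt0.
have [q0|q0] /= := ltP 0 q; last first.
  rewrite /beta_joint [X in _ * X]/beta01 indicE memNset ?mulr0//= in_itv/= => /andP[h _].
  by move: h; rewrite ltNge pmulr_lle0 ?invr_gt0// q0.
have [xq|xq] := ltP (x + q) 1; last first.
  rewrite /beta_joint [X in _ * X]/beta01 indicE memNset ?mulr0//= in_itv/= => /andP[_].
  by rewrite ltNge => /negP; apply; rewrite ler_pdivlMr// mul1r lerBlDl.
have h1 : 0 < q / (1 - x) by rewrite divr_gt0.
have h2 : q / (1 - x) < 1 by rewrite ltr_pdivrMr// mul1r ltrBrDl.
rewrite /beta_joint /beta01 !indicE !mem_set/= ?in_itv/= ?x0 ?x1 ?h1 ?h2// !mulr1 /beta_dens.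
have sn0 : 1 - x != 0 by rewrite gt_eqF.
have -> : q `^ (1 - sig - 1) = (q / (1 - x)) `^ (1 - sig - 1) * (1 - x) `^ (1 - sig - 1).
  by rewrite -powRM ?ltW// divfK.
have -> : (1 - x - q) `^ (b + sig - 1) =
    (1 - q / (1 - x)) `^ (b + sig - 1) * (1 - x) `^ (b + sig - 1).
  rewrite -powRM ?subr_ge0 ?(ltW h2) ?(ltW x1)//; congr (_ `^ _).
  by rewrite mulrBl mul1r divfK.
have -> : (1 - x) `^ (b - 1) = (1 - x) `^ (1 - sig - 1) * (1 - x) `^ (b + sig - 1).
  rewrite -powRD; last by apply/implyP.
  by congr (_ `^ _); ring.
by ring.
Qed.

Lemma beta_joint_sym x q : beta_joint x q = beta_joint q x.
Proof.
rewrite !beta_jointE [q + x]addrC andbCA; case: ifP => // _.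
by rewrite [_ `^ _ * _ `^ _]mulrC -!addrA [- x - q]addrC.
Qed.

Lemma beta_joint_ge0 x q : 0 <= beta_joint x q.
Proof. by rewrite mulr_ge0 ?beta01_ge0. Qed.

Lemma measurable_beta_joint : measurable_fun setT (fun z : R * R => beta_joint z.1 z.2).
Proof.
apply: measurable_funM.
  by apply: (measurableT_comp (measurable_beta01 (1 - sig) b)).
apply: (measurableT_comp (measurable_beta01 (1 - sig) (b + sig))).
apply: measurable_funM => //.
apply: (@measurableT_comp _ _ _ _ _ _ (@GRing.inv R)); first exact: measurable_inv.
by apply: measurable_funB.
Qed.

(* [1 - x], cut off at [0] so that the integrals below have nonnegative integrands. *)
Definition pospart1 (x : R) : R := Num.max 0 (1 - x).

Lemma measurable_pospart1 : measurable_fun setT pospart1.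
Proof. by apply: measurable_maxr => //; exact: measurable_funB. Qed.

Lemma pospart1_ge0 x : 0 <= pospart1 x. Proof. by rewrite /pospart1 le_max lexx. Qed.

Variables pi pi' : probability R R.
Hypotheses (hpi : is_beta pi (1 - sig) b) (hpi' : is_beta pi' (1 - sig) (b + sig)).

Lemma is_beta_integral (p : probability R R) u w : is_beta p u w ->
  exists2 c : R, 0 < c & forall f : R -> \bar R, (forall x, 0 <= f x)%E ->
    measurable_fun setT f ->
    (\int[p]_x f x = \int[leb]_x (f x * (c * beta01 u w x)%:E))%E.
Proof.
move=> /is_beta_density[c c0 hc]; exists c => // f f0 mf.
have mcb : measurable_fun setT (fun x => c * beta01 u w x).
  by apply: measurable_funM => //; exact: measurable_beta01.
have mcbE : measurable_fun setT (fun x : R => (c * beta01 u w x)%:E) by apply/measurable_EFinP.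
have cb0 x : 0 <= c * beta01 u w x by rewrite mulr_ge0 ?beta01_ge0// ltW.
pose lebR := image_measure leb _ (@measurable_id_measurableTypeR R).
have hp A : measurable A -> p A = (\int[lebR]_(x in A) (c * beta01 u w x)%:E)%E.
  move=> mA; rewrite hc// [LHS]integral_mkcond [RHS]integral_mkcond.
  rewrite ge0_integral_image//.
  - apply/(measurable_restrictT _ mA); exact: (measurable_funTS mcbE).
  - by move=> x; rewrite patchE; case: ifP => // _; rewrite lee_fin.
rewrite (ge0_integral_density lebR p _ cb0 mcb hp f f0 mf).
rewrite ge0_integral_image//.
- by apply: emeasurable_funM => //; exact/measurable_EFinP.
- by move=> x; rewrite mule_ge0// lee_fin.
Qed.

(** The inner variable is changed to [q = y (1 - x)]. The constant is uniform in [G], so the formula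
    can be used for a function and for the same function with its arguments exchanged. *)
Lemma beta_double_integral : exists2 K : R, 0 <= K & forall G : R * R -> \bar R,
  measurable_fun setT G -> (forall z, 0 <= G z)%E ->
  (\int[pi]_x \int[pi']_y ((pospart1 x)%:E * G (x, (y * (1 - x))%R)) =
   \int[leb]_x \int[leb]_q (G (x : R, q : R) * (K * beta_joint x q)%:E))%E.
Proof.
have [c c0 hc] := is_beta_integral _ _ _ hpi.
have [c' c'0 hc'] := is_beta_integral _ _ _ hpi'.
exists (c * c'); first by rewrite mulr_ge0 ?ltW.
move=> G mG G0.
have cb0 u v w x : 0 < u -> 0 <= u * beta01 v w x by move=> u0; rewrite mulr_ge0 ?beta01_ge0// ltW.
have mcb u v w : measurable_fun setT (fun x => u * beta01 v w x).
  by apply: measurable_funM => //; exact: measurable_beta01.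
have mH : measurable_fun setT (fun z : R * R => ((pospart1 z.1)%:E * G (z.1, (z.2 * (1 - z.1))%R))%E).
  apply: emeasurable_funM.
    by apply/measurable_EFinP; apply: (measurableT_comp measurable_pospart1).
  apply: (measurableT_comp mG); apply/measurable_fun_pair => //=.
  by apply: measurable_funM => //; exact: measurable_funB.
have H0 z : (0 <= (pospart1 z.1)%:E * G (z.1, (z.2 * (1 - z.1))%R))%E.
  by rewrite mule_ge0// lee_fin pospart1_ge0.
have mI := measurable_fun_fubini_tonelli_F (m2 := pi')
  (fun z : R * R => ((pospart1 z.1)%:E * G (z.1, (z.2 * (1 - z.1))%R))%E) mH H0.
rewrite hc//; last by move=> x; apply: integral_ge0 => y _; exact: (H0 (x, y)).
apply: eq_integral => x _.
have [x01|x01] := boolP (x \in `]0%R, 1%R[%classic); last first.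
  have bx : beta01 (1 - sig) b x = 0 by rewrite /beta01 indicE (negbTE x01) mulr0.
  rewrite bx mulr0 mule0; apply/esym; apply: integral0_eq => q _.
  by rewrite /beta_joint bx mul0r mulr0 mule0.
move: x01; rewrite inE/= in_itv/= => /andP[x0 x1].
have s0 : 0 < 1 - x by rewrite subr_gt0.
have sn0 : 1 - x != 0 by rewrite gt_eqF.
have px : pospart1 x = 1 - x by rewrite /pospart1 max_r// ltW.
pose f q := (G (x, q) * (c' * beta01 (1 - sig) (b + sig) (q / (1 - x)))%:E)%E.
have mf : measurable_fun setT f.
  apply: emeasurable_funM.
    apply: (measurableT_comp mG); exact: pair1_measurable.
  have mq : measurable_fun setT (fun q : R => q / (1 - x)) by apply: measurable_funM.
  apply/measurable_EFinP; exact: (measurableT_comp (mcb R c' (1 - sig) (b + sig)) mq).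
have f0 q : (0 <= f q)%E by rewrite mule_ge0// lee_fin cb0.
have -> : (\int[pi']_y ((pospart1 x)%:E * G (x, (y * (1 - x))%R)) = \int[leb]_q f q)%E.
  rewrite hc'//.
  - rewrite -(ge0_integral_scale (1 - x) f s0 mf f0); apply: eq_integral => y _.
    rewrite /f px [((1 - x) * y)%R]mulrC mulfK// [LHS]muleAC muleC.
    by rewrite muleA muleAC.
  - by move=> y; exact: (H0 (x, y)).
  - exact: (measurableT_comp mH (pair1_measurable x)).
rewrite -ge0_integralZr//; last first.
  by rewrite lee_fin cb0.
apply: eq_integral => q _; rewrite /f -muleA -EFinM; congr (_ * _%:E)%E.
by rewrite /beta_joint; ring.
Qed.

Lemma beta_swap (F : R * R -> \bar R) : measurable_fun setT F -> (forall z, 0 <= F z)%E ->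
  (\int[pi]_x \int[pi']_y ((pospart1 x)%:E * F (x, (y * (1 - x))%R)) =
   \int[pi]_x \int[pi']_y ((pospart1 x)%:E * F ((y * (1 - x))%R, x)))%E.
Proof.
move=> mF F0; have [K K0 hK] := beta_double_integral.
have mFs : measurable_fun setT (fun z : R * R => F (z.2, z.1)).
  by apply: (measurableT_comp mF); apply/measurable_fun_pair.
apply: (etrans (hK F mF F0)).
apply: (etrans _ (esym (hK (fun z => F (z.2, z.1)) mFs (fun z => F0 _)))).
pose f (z : measurableTypeR R * measurableTypeR R) := (F (z : R * R) * (K * beta_joint z.1 z.2)%:E)%E.
have mf : measurable_fun setT f.
  apply: emeasurable_funM => //; apply/measurable_EFinP; apply: measurable_funM => //.
  exact: measurable_beta_joint.
have f0 z : (0 <= f z)%E by rewrite mule_ge0// lee_fin mulr_ge0// beta_joint_ge0.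
rewrite [LHS](fubini_tonelli (m1 := leb) (m2 := leb) f mf f0).
by apply: eq_integral => x _; apply: eq_integral => q _; rewrite /f/= beta_joint_sym.
Qed.

End beta_swap.

(** * The space of stick sequences *)

Section sequence_space.
Context {R : realType}.

(** Only bases that are rectangles in an initial block of coordinates: they are stable under
    intersection, and [indep_with_laws] prescribes the law on exactly these sets. *)
Definition cylinders : set (set (nat -> R)) :=
  [set B | exists (n : nat) (A : nat -> set R), (forall i, measurable (A i)) /\
     B = [set u | forall i, (i < n)%N -> A i (u i)]].

Definition seqspace := g_sigma_algebraType cylinders.

Lemma measurable_seqspaceE : @measurable _ seqspace = <<s cylinders >>.
Proof. by []. Qed.

Lemma setI_closed_cylinders : setI_closed cylinders.
Proof.
move=> _ _ [n [A [mA ->]]] [m [B [mB ->]]].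
pose e (k i : nat) (C : nat -> set R) : set R := if (i < k)%N then C i else setT.
have me k i C : (forall i, measurable (C i)) -> measurable (e k i C).
  by move=> mC; rewrite /e; case: ifP.
exists (maxn n m), (fun i => e n i A `&` e m i B); split.
  by move=> i; apply: measurableI; exact: me.
apply/seteqP; split=> u /=.
  move=> [hA hB] i _; rewrite /e; split; case: ifPn => // ik; [exact: hA|exact: hB].
move=> h; split=> i ik.
  by have [+ _] := h i (leq_trans ik (leq_maxl _ _)); rewrite /e ik.
by have [_ +] := h i (leq_trans ik (leq_maxr _ _)); rewrite /e ik.
Qed.

Lemma measurable_coord i : measurable_fun setT (fun u : seqspace => u i : R).
Proof.
move=> _ B mB; rewrite setTI; apply: sub_sigma_algebra.
exists i.+1, (fun k => if k == i then B else setT); split.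
  by move=> k; case: ifP.
apply/seteqP; split=> u /=.
  by move=> Bu k _; case: eqP => [->|].
by move=> /(_ i (ltnSn i)); rewrite eqxx.
Qed.

Lemma measurable_seqspace {d} {T : measurableType d} (f : T -> seqspace) :
  (forall i, measurable_fun setT (fun x => f x i)) -> measurable_fun setT f.
Proof.
move=> mf; apply: (measurability _ measurable_seqspaceE) => _ [_ [n [A [mA ->]]] <-].
rewrite setTI (_ : _ @^-1` _ = \bigcap_(i in `I_n) ((fun x => f x i) @^-1` A i)).
  apply: fin_bigcap_measurable => [|i _]; first exact: finite_II.
  by rewrite -[X in measurable X]setTI; apply: mf.
by apply/seteqP; split=> x h i ik; exact: h.
Qed.

Lemma seqspace_measure_unique (m1 m2 : {measure set seqspace -> \bar R}) :
  (forall B, cylinders B -> m1 B = m2 B) -> (m1 setT < +oo)%E ->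
  forall B, measurable B -> m1 B = m2 B.
Proof.
move=> h fin B mB.
apply: (@measure_unique _ R seqspace cylinders (fun=> setT)) => //.
- exact: setI_closed_cylinders.
- move=> _; exists 0%N, (fun=> setT); split => //.
  by apply/seteqP; split.
- by rewrite -subTset => x _; exists 0%N.
Qed.

Definition upd (j : nat) (z : seqspace * (R * R)) : seqspace :=
  fun i => if i == j then z.2.1 else if i == j.+1 then z.2.2 else z.1 i.

Lemma measurable_upd j : measurable_fun setT (upd j).
Proof.
apply: measurable_seqspace => i; rewrite /upd.
case: (i == j); first exact: (measurableT_comp measurable_fst measurable_snd).
case: (i == j.+1); first exact: (measurableT_comp measurable_snd measurable_snd).
exact: (measurableT_comp (measurable_coord i) measurable_fst).
Qed.

(* In terms of the weights [w], this exchanges [w_j] and [w_(j+1)]. *)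
Definition swap_sticks (j : nat) (u : seqspace) : seqspace :=
  upd j (u, (u j.+1 * (1 - u j), u j / (1 - u j.+1 * (1 - u j)))).

Lemma measurable_swap_sticks j : measurable_fun setT (swap_sticks j).
Proof.
apply: (measurableT_comp (measurable_upd j)).
have mx := measurable_coord j. have my := measurable_coord j.+1.
have mq : measurable_fun setT (fun u : seqspace => u j.+1 * (1 - u j)).
  by apply: measurable_funM => //; exact: measurable_funB.
apply/measurable_fun_pair => //=; apply/measurable_fun_pair => //=.
apply: measurable_funM => //; apply: (measurableT_comp measurable_inv).
exact: measurable_funB.
Qed.

End sequence_space.

(** * Resampling two independent sticks *)

Section resampling.
Context {R : realType}.
Context {d : measure_display} {Omega : measurableType d} (P : probability Omega R).
Variables (pis : nat -> probability R R) (v : nat -> Omega -> R).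
Hypothesis mv : forall j, measurable_fun setT (v j).
Hypothesis iv : indep_with_laws P pis v.

Definition vseq (w : Omega) : @seqspace R := fun i => v i w.

Lemma measurable_vseq : measurable_fun setT vseq.
Proof. exact: measurable_seqspace. Qed.

Definition seqlaw : probability (@seqspace R) R := law P vseq measurable_vseq.

Lemma seqlaw_cyl n (A : nat -> set R) : (forall i, measurable (A i)) ->
  seqlaw [set u | forall i, (i < n)%N -> A i (u i)] = (\prod_(i < n) pis i (A i))%E.
Proof. by move=> mA; rewrite -iv. Qed.

Definition pair_law j : probability (R * R)%type R := (pis j \x pis j.+1)%E.

Definition resample_measure j : probability (@seqspace R * (R * R))%type R :=
  (seqlaw \x pair_law j)%E.

(** By independence, overwriting the sticks [j] and [j.+1] by a fresh pair with the same laws does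
    not change the law of the sequence. Two coordinates can thus be integrated out without splitting
    the infinite product. *)
Lemma seqlaw_resample j (B : set (@seqspace R)) : measurable B ->
  seqlaw B = image_measure (resample_measure j) (upd j) (measurable_upd j) B.
Proof.
move: B; apply: seqspace_measure_unique; last by rewrite ltey_eq fin_num_measure.
move=> _ [n [A [mA ->]]].
transitivity ((seqlaw \x pair_law j)%E
  (upd j @^-1` [set u | forall i, (i < n)%N -> A i (u i)])); last by [].
(* [A'] pads the cylinder so that it reaches index [j.+1] at least; [A''] then drops the constraints
   on the two overwritten coordinates. *)
pose A' i : set R := if (i < n)%N then A i else setT.
pose A'' i : set R := if (i == j) || (i == j.+1) then setT else A' i.
have mA' i : measurable (A' i) by rewrite /A'; case: ifP.
have mA'' i : measurable (A'' i) by rewrite /A''; case: ifP.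
pose N := maxn n j.+2.
have e1 : [set u : nat -> R | forall i, (i < n)%N -> A i (u i)] =
          [set u | forall i, (i < N)%N -> A' i (u i)].
  apply/seteqP; split=> u /= h i ik.
    by rewrite /A'; case: ifPn => // /h.
  by have := h i (leq_trans ik (leq_maxl _ _)); rewrite /A' ik.
have jN : (j < N)%N by rewrite /N leq_max (ltnW (ltnSn j.+1)) orbT.
have jN' : (j.+1 < N)%N by rewrite /N leq_max ltnSn orbT.
rewrite e1; transitivity (\prod_(i < N) pis i (A' i))%E; first exact: (seqlaw_cyl N A' mA').
have -> : upd j @^-1` [set u | forall i, (i < N)%N -> A' i (u i)] =
    [set u | forall i, (i < N)%N -> A'' i (u i)] `*` (A' j `*` A' j.+1).
  apply/seteqP; split=> -[u [x y]] /=.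
    move=> h; split.
      move=> i iN; rewrite /A''; case: ifPn => //; rewrite negb_or => /andP[/negbTE ij /negbTE ij'].
      by have := h i iN; rewrite /upd ij ij'.
    split; first by have := h j jN; rewrite /upd eqxx.
    by have := h j.+1 jN'; rewrite /upd eqxx gtn_eqF.
  move=> [hu [hx hy]] i iN; rewrite /upd /=; case: eqP => [->//|/eqP/negbTE ij].
  case: eqP => [->//|/eqP/negbTE ij'].
  by have := hu i iN; rewrite /A'' ij ij'.
rewrite product_measure1E//; last 2 first.
- apply: sub_sigma_algebra; exists N, A''; split => //.
- exact: measurableX.
transitivity ((\prod_(i < N) pis i (A'' i)) * (pis j (A' j) * pis j.+1 (A' j.+1)))%E; last first.
  congr (_ * _)%E; first exact/esym/(seqlaw_cyl N A'' mA'').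
  by rewrite /pair_law /= product_measure1E.
rewrite (bigD1 (Ordinal jN))//= (bigD1 (Ordinal jN'))/=; last first.
  by rewrite -val_eqE/= gtn_eqF.
rewrite [in RHS](bigD1 (Ordinal jN))//= [in RHS](bigD1 (Ordinal jN'))/=; last first.
  by rewrite -val_eqE/= gtn_eqF.
rewrite {1 2}/A'' !eqxx orbT !probability_setT !mul1e muleA muleC; congr (_ * _)%E.
apply: eq_bigr => i /andP[ij ij']; congr (pis i _).
by rewrite /A''; move: ij ij'; rewrite -!val_eqE/= => /negbTE -> /negbTE ->.
Qed.

Lemma integral_resample j (Psi : @seqspace R -> \bar R) : measurable_fun setT Psi ->
  (forall u, 0 <= Psi u)%E ->
  (\int[seqlaw]_u Psi u =
   \int[seqlaw]_u \int[pis j]_x \int[pis j.+1]_y Psi (upd j (u, (x, y))))%E.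
Proof.
move=> mPsi Psi0.
rewrite (eq_measure_integral (image_measure (resample_measure j) (upd j) (measurable_upd j))); last first.
  by move=> B mB _; exact: seqlaw_resample.
rewrite ge0_integral_image//.
have mU : measurable_fun setT (Psi \o upd j) by exact: (measurableT_comp mPsi (measurable_upd j)).
rewrite (fubini_tonelli1 (Psi \o upd j))//; last by move=> z /=.
apply: eq_integral => u _; rewrite /fubini_F.
rewrite (fubini_tonelli1 (fun z => Psi (upd j (u, z))))//.
by apply: (measurableT_comp mU); exact: pair1_measurable.
Qed.

Lemma seqlaw_swap j sig b (Phi : @seqspace R -> \bar R) :
  is_beta (pis j) (1 - sig) b -> is_beta (pis j.+1) (1 - sig) (b + sig) ->
  measurable_fun setT Phi -> (forall u, 0 <= Phi u)%E ->
  (\int[seqlaw]_u ((pospart1 (u j))%:E * Phi u) =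
   \int[seqlaw]_u ((pospart1 (u j))%:E * Phi (swap_sticks j u)))%E.
Proof.
move=> hb hb' mPhi Phi0.
have mp : measurable_fun setT (fun u : @seqspace R => (pospart1 (u j))%:E).
  by apply/measurable_EFinP; exact: (measurableT_comp measurable_pospart1 (measurable_coord j)).
have p0 (x : R) : (0 <= (pospart1 x)%:E)%E by rewrite lee_fin pospart1_ge0.
rewrite (integral_resample j); [|exact: emeasurable_funM|by move=> u; rewrite mule_ge0].
rewrite [RHS](integral_resample j); last 2 first.
- by apply: emeasurable_funM => //; exact: (measurableT_comp mPhi (measurable_swap_sticks j)).
- by move=> u; rewrite mule_ge0.
apply: eq_integral => u _.
(* [Phi] in the variables [x] and [q = y (1 - x)]. Dividing by [1 - x] recovers [y] except at
   [x = 1], where the weight [pospart1 x] is [0]. *)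
pose F (z : R * R) := Phi (upd j (u, (z.1, z.2 / (1 - z.1)))).
have mF : measurable_fun setT F.
  apply: (measurableT_comp mPhi); apply: (measurableT_comp (measurable_upd j)).
  apply/measurable_fun_pair => //=; apply/measurable_fun_pair => //=.
  apply: measurable_funM => //; apply: (measurableT_comp measurable_inv).
  exact: measurable_funB.
have F0 z : (0 <= F z)%E by exact: Phi0.
transitivity (\int[pis j]_x \int[pis j.+1]_y ((pospart1 x)%:E * F (x, (y * (1 - x))%R)))%E.
  apply: eq_integral => x _; apply: eq_integral => y _; rewrite /upd /= eqxx.
  have [->|x1] := eqVneq x 1; first by rewrite /pospart1 subrr maxxx !mul0e.
  by rewrite /F /= mulfK// subr_eq0 eq_sym.
apply: (etrans (beta_swap sig b (pis j) (pis j.+1) hb hb' F mF F0)).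
apply: eq_integral => x _; apply: eq_integral => y _.
have e1 : upd j (u, (x, y)) j = x by rewrite /upd eqxx.
have e2 : upd j (u, (x, y)) j.+1 = y by rewrite /upd /= gtn_eqF// eqxx.
rewrite e1 /F /swap_sticks e1 e2 /=; congr (_ * Phi _)%E.
by apply/funext => i; rewrite /upd /=; case: eqP => // _; case: eqP.
Qed.

End resampling.

(** * Size-biased picks for fixed weights *)

Section size_biased.
Context {R : realType}.

(** An inequality rather than total mass [1]: after clipping it holds at every outcome, whereas
    properness is almost sure. *)
Definition subprob_weights (w : nat -> R) : Prop :=
  (forall j, 0 <= w j) /\ (forall n, \sum_(0 <= j < n) w j <= 1).

Lemma subprob_uniq_le (w : nat -> R) (s : seq nat) : subprob_weights w -> uniq s ->
  \sum_(i <- s) w i <= 1.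
Proof.
move=> [w0 w1] us; pose n := (\max_(i <- s) i).+1.
apply: le_trans (w1 n).
have sn i : i \in s -> (i < n)%N by move=> is_; rewrite ltnS; exact: leq_bigmax_seq.
rewrite (perm_big [seq i <- index_iota 0 n | i \in s]); last first.
  apply: uniq_perm => //; first by rewrite filter_uniq// iota_uniq.
  move=> i; rewrite mem_filter mem_index_iota /=; case: (boolP (i \in s)) => //= /sn ->.
  by [].
rewrite big_filter big_mkcond/=; apply: ler_sum => i _.
by case: ifP.
Qed.

Lemma subprob_notin_le (w : nat -> R) (s : seq nat) n : subprob_weights w -> uniq s ->
  \sum_(0 <= j < n | j \notin s) w j <= 1 - \sum_(i <- s) w i.
Proof.
move=> sw us; rewrite lerBrDr addrC -[X in _ + X]big_filter -big_cat/=; apply: subprob_uniq_le => //.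
rewrite cat_uniq us filter_uniq ?iota_uniq// andbT -all_predC; apply/allP => i.
by rewrite mem_filter => /andP[].
Qed.

Local Open Scope ereal_scope.

Definition sbp_coef (s : seq nat) (A : nat -> set R) (w : nat -> R) (j : nat) : R :=
  ((w j / (1 - \sum_(i <- s) w i)) * \1_(A (size s)) (w j))%R.

Lemma sbp_fddS k s A (w : nat -> R) :
  sbp_fdd k.+1 s A w =
  \sum_(0 <= j <oo | j \notin s) ((sbp_coef s A w j)%:E * sbp_fdd k (rcons s j) A w).
Proof. by []. Qed.

Lemma sbp_coef_ge0 s A (w : nat -> R) j : subprob_weights w -> uniq s ->
  (0 <= sbp_coef s A w j)%R.
Proof.
move=> sw us; rewrite /sbp_coef mulr_ge0 ?indicE ?ler0n//.
by rewrite divr_ge0 ?subr_ge0 ?(subprob_uniq_le _ _ sw us)//; case: sw.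
Qed.

Lemma uniq_rcons_notin (s : seq nat) j : uniq s -> j \notin s -> uniq (rcons s j).
Proof. by move=> us js; rewrite rcons_uniq js us. Qed.

Lemma sbp_fdd_ge0 k s A (w : nat -> R) : subprob_weights w -> uniq s -> 0 <= sbp_fdd k s A w.
Proof.
move=> sw; elim: k s => [//|k IH] s us; rewrite sbp_fddS; apply: nneseries_ge0 => j _ js.
rewrite mule_ge0 ?lee_fin ?sbp_coef_ge0// IH//.
exact: uniq_rcons_notin.
Qed.

Lemma sbp_fdd_le1 k s A (w : nat -> R) : subprob_weights w -> uniq s -> sbp_fdd k s A w <= 1.
Proof.
move=> sw; elim: k s => [//|k IH] s us; rewrite sbp_fddS.
have p0 j : j \notin s -> 0 <= (sbp_coef s A w j)%:E * sbp_fdd k (rcons s j) A w.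
  move=> js; rewrite mule_ge0 ?lee_fin ?sbp_coef_ge0//.
  by apply: sbp_fdd_ge0 => //; exact: uniq_rcons_notin.
apply: lime_le; first by apply: is_cvg_nneseries => j _ js; exact: p0.
apply: nearW => n.
have S1 := subprob_uniq_le _ _ sw us.
apply: (@le_trans _ _ (\sum_(0 <= j < n | j \notin s) (w j / (1 - \sum_(i <- s) w i))%:E)).
  apply: lee_sum => j js; rewrite -[leRHS]mule1; apply: lee_pmul.
  - by rewrite lee_fin sbp_coef_ge0.
  - by apply: sbp_fdd_ge0 => //; exact: uniq_rcons_notin.
  - rewrite lee_fin /sbp_coef ler_piMr ?indicE ?lern1 ?leq_b1//.
    by rewrite divr_ge0 ?subr_ge0//; case: sw.
  - by apply: IH; exact: uniq_rcons_notin.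
rewrite sumEFin lee_fin -mulr_suml.
have := subprob_notin_le w s n sw us.
(* If the picked indices exhaust the mass, the quotient is [0] by the convention on inverses and the
   bound still holds. *)
have [->|S0] := eqVneq (1 - \sum_(i <- s) w i)%R 0%R; first by rewrite invr0 mulr0.
have Sp : (0 < 1 - \sum_(i <- s) w i)%R by rewrite lt_neqAle eq_sym S0 subr_ge0.
by rewrite ler_pdivrMr// mul1r.
Qed.

Lemma subprob_comp (w : nat -> R) (f : nat -> nat) : subprob_weights w -> injective f ->
  subprob_weights (w \o f).
Proof.
move=> sw fi; split=> [j|n]; first by case: sw => /= + _; exact.
have := subprob_uniq_le w (map f (index_iota 0 n)) sw; rewrite map_inj_uniq// iota_uniq big_map.
by apply.
Qed.

(** Relabelling the weights amounts to relabelling the picks. The sum over the unpicked indices has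
    nonnegative terms, so it is an unordered sum and can be reindexed by the involution [f]. *)
Lemma sbp_fdd_perm k s A (w : nat -> R) (f : nat -> nat) : subprob_weights w ->
  cancel f f -> uniq s -> sbp_fdd k s A (w \o f) = sbp_fdd k (map f s) A w.
Proof.
move=> sw ff; have fi := can_inj ff; elim: k s => [//|k IH] s us; rewrite !sbp_fddS.
have sw' := subprob_comp w f sw fi.
have us' : uniq (map f s) by rewrite map_inj_uniq.
rewrite nneseries_esum; last first.
  move=> j js; rewrite mule_ge0 ?lee_fin ?sbp_coef_ge0//.
  by apply: sbp_fdd_ge0 => //; exact: uniq_rcons_notin.
rewrite [RHS]nneseries_esum; last first.
  move=> j js; rewrite mule_ge0 ?lee_fin ?sbp_coef_ge0//.
  by apply: sbp_fdd_ge0 => //; exact: uniq_rcons_notin.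
rewrite [RHS](reindex_esum [set x | x \notin s] _ f); last first.
  split.
  - by move=> i /= is_; rewrite mem_map.
  - by move=> i j _ _; exact: fi.
  - move=> i /= is_; exists (f i) => //=.
    by rewrite -(mem_map fi) ff.
apply: eq_esum => j js; rewrite IH ?map_rcons//; last exact: uniq_rcons_notin.
congr (_%:E * _); rewrite /sbp_coef size_map big_map//.
Qed.

Lemma measurable_sbp_fdd {d} {T : measurableType d} (W : T -> nat -> R) k s A :
  (forall i, measurable_fun setT (fun x => W x i)) -> (forall x, subprob_weights (W x)) ->
  (forall i, measurable (A i)) -> uniq s ->
  measurable_fun setT (fun x => sbp_fdd k s A (W x)).
Proof.
move=> mW sW mA; elim: k s => [|k IH] s us; first exact: measurable_cst.
apply: (@ge0_emeasurable_sum _ _ _ setT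
  (fun j x => (sbp_coef s A (W x) j)%:E * sbp_fdd k (rcons s j) A (W x)) [pred j | j \notin s]).
  move=> j x _ js; rewrite mule_ge0 ?lee_fin ?sbp_coef_ge0//.
  by apply: sbp_fdd_ge0 => //; exact: uniq_rcons_notin.
move=> j js; apply: emeasurable_funM; last by apply: IH; exact: uniq_rcons_notin.
apply/measurable_EFinP; apply: measurable_funM.
  apply: measurable_funM => //; apply: (measurableT_comp measurable_inv).
  by apply: measurable_funB => //; exact: measurable_sum.
have mI : measurable_fun setT (\1_(A (size s)) : R -> R) by exact: measurable_indic.
exact: (measurableT_comp mI (mW j)).
Qed.

End size_biased.

(** * Effect of an exchange on the weights *)

Section swapped_weights.
Context {R : realType}.
Implicit Types u : nat -> R.

Definition transpose (j i : nat) : nat := if i == j then j.+1 else if i == j.+1 then j else i.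

Lemma transposeK j : cancel (transpose j) (transpose j).
Proof.
move=> i; rewrite /transpose; case: (eqVneq i j) => [->|ij]; first by rewrite gtn_eqF// eqxx.
case: (eqVneq i j.+1) => [->|ij']; first by rewrite eqxx.
by rewrite (negbTE ij) (negbTE ij').
Qed.

Lemma transpose_lt j i : (i < j)%N -> transpose j i = i.
Proof. by move=> ij; rewrite /transpose ltn_eqF// ltn_eqF// ltnW. Qed.

Lemma sb_rem_eq u u' k : (forall i, (i < k)%N -> u i = u' i) -> sb_rem u k = sb_rem u' k.
Proof. by move=> uu; rewrite /sb_rem; apply: eq_bigr => i _; rewrite uu. Qed.

Lemma swap_sticks_lt (u : @seqspace R) j i : (i < j)%N -> swap_sticks j u i = u i.
Proof. by move=> ij; rewrite /swap_sticks /upd ltn_eqF// ltn_eqF// ltnW. Qed.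

Lemma swap_sticks01 (u : @seqspace R) j : (forall i, 0 < u i < 1) ->
  forall i, 0 < swap_sticks j u i < 1.
Proof.
move=> u01 i; rewrite /swap_sticks /upd /=.
have /andP[x0 x1] := u01 j; have /andP[y0 y1] := u01 j.+1.
set x := u j in x0 x1 *; set y := u j.+1 in y0 y1 *.
have q0 : 0 < 1 - y * (1 - x) by nra.
case: eqP => _; first by apply/andP; split; nra.
case: eqP => _ //; rewrite divr_gt0//= ltr_pdivrMr// mul1r; nra.
Qed.

(** Write [x], [y] for the two sticks and [q = y (1 - x)]. The new sticks [q] and [x / (1 - q)] cut
    the former second piece first and the former first piece next. The mass left after both is [(1 -
    q) (1 - x / (1 - q)) = (1 - x) (1 - y)] times the mass before, as it was, so later weights do
    not move. *)
Lemma sb_weight_swap (u : @seqspace R) j : (forall i, 0 < u i < 1) ->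
  sb_weight (swap_sticks j u) = sb_weight u \o transpose j.
Proof.
move=> u01; apply/funext => i; rewrite /= !sb_weightE.
have /andP[x0 x1] := u01 j; have /andP[y0 y1] := u01 j.+1.
have remj k : (k <= j)%N -> sb_rem (swap_sticks j u) k = sb_rem u k.
  by move=> kj; apply: sb_rem_eq => l lk; rewrite swap_sticks_lt// (leq_trans lk).
have sj : swap_sticks j u j = u j.+1 * (1 - u j) by rewrite /swap_sticks /upd eqxx.
have sj' : swap_sticks j u j.+1 = u j / (1 - u j.+1 * (1 - u j)).
  by rewrite /swap_sticks /upd gtn_eqF// eqxx.
have q0 : 1 - u j.+1 * (1 - u j) != 0.
  by rewrite gt_eqF//; move: x0 x1 y0 y1; set x := u j; set y := u j.+1 => *; nra.
have [ij|ij|->] := ltngtP i j.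
- by rewrite transpose_lt// swap_sticks_lt// remj// ltnW.
- have [->|ij'] := eqVneq i j.+1.
    rewrite /transpose gtn_eqF// eqxx sj' sb_remS remj// sj.
    by rewrite [sb_rem u j * _]mulrC mulrA divfK.
  rewrite /transpose gtn_eqF// (negbTE ij').
  have -> : swap_sticks j u i = u i by rewrite /swap_sticks /upd gtn_eqF// (negbTE ij').
  congr (_ * _).
  have : (j.+2 <= i)%N by rewrite ltn_neqAle eq_sym ij'.
  elim: i {ij ij'} => // i IH; rewrite leq_eqVlt => /predU1P[<-|].
    rewrite !sb_remS remj// sj sj' -!mulrA; congr (_ * _).
    by field.
  rewrite ltnS => ji; rewrite !sb_remS IH//; congr (_ * (1 - _)).
  rewrite /swap_sticks /upd gtn_eqF ?gtn_eqF//.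
  by rewrite (leq_trans _ ji).
- by rewrite /transpose eqxx sj remj// sb_remS; ring.
Qed.

End swapped_weights.

Lemma integral_eq_aeS {d} {T : measurableType d} {R : realType}
  (mu : {measure set T -> \bar R}) (Q : T -> Prop) (f g : T -> \bar R) :
  {ae mu, forall x, Q x} -> (forall x, Q x -> f x = g x) ->
  (\int[mu]_x f x = \int[mu]_x g x)%E.
Proof. by move=> aQ fg; apply: integral_eq_ae; apply: filterS aQ => x /fg. Qed.

Section clipped_weights.
Context {R : realType}.

Definition clip_seq (u : @seqspace R) : nat -> R := fun i => clip01 (u i).

Definition cweight (u : @seqspace R) : nat -> R := sb_weight (clip_seq u).

Definition crem (u : @seqspace R) (n : nat) : R := sb_rem (clip_seq u) n.

Lemma clip_seq01 u i : 0 <= clip_seq u i <= 1. Proof. exact: clip01_itv. Qed.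

Lemma clip_seq_id (u : @seqspace R) : (forall i, 0 <= u i <= 1) -> clip_seq u = u.
Proof. by move=> u01; apply/funext => i; rewrite /clip_seq clip01_id. Qed.

Lemma subprob_cweight u : subprob_weights (cweight u).
Proof.
split=> [j|n]; first exact: (sb_weight_ge0 _ (clip_seq01 u)).
rewrite -[leLHS]/(series (sb_weight (clip_seq u)) n) series_sb_weight.
by have /andP[r0 _] := sb_rem01 _ (clip_seq01 u) n; rewrite lerBlDr lerDl.
Qed.

Lemma measurable_crem n : measurable_fun setT (crem ^~ n).
Proof.
apply: measurable_prod => i _; apply: measurable_funB => //.
exact: (measurableT_comp measurable_clip01 (measurable_coord i)).
Qed.

Lemma measurable_cweight i : measurable_fun setT (cweight ^~ i).
Proof.
apply: measurable_funM; last exact: measurable_crem.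
exact: (measurableT_comp measurable_clip01 (measurable_coord i)).
Qed.

Lemma crem01 u n : 0 <= crem u n <= 1.
Proof. exact: sb_rem01 (clip_seq01 u) n. Qed.

Lemma crem_split u n : crem u n = cweight u n + crem u n.+1.
Proof. by rewrite /cweight sb_weight_rem subrK. Qed.

Lemma crem_gt0 (u : @seqspace R) n : (forall i, 0 < u i < 1) -> 0 < crem u n.
Proof.
move=> u01; rewrite /crem clip_seq_id; last first.
  by move=> i; have /andP[/ltW -> /ltW ->] := u01 i.
apply: prodr_gt0 => i _; rewrite subr_gt0; by case/andP: (u01 i).
Qed.

Lemma crem_le u m n : (m <= n)%N -> crem u n <= crem u m.
Proof.
elim: n => [|n IH]; first by rewrite leqn0 => /eqP ->.
rewrite leq_eqVlt => /predU1P[->//|]; rewrite ltnS => /IH h.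
apply: le_trans h; rewrite [leRHS]crem_split lerDr.
by case: (subprob_cweight u).
Qed.

Lemma crem_ratio01 u m n : (m <= n)%N -> 0 <= crem u n / crem u m <= 1.
Proof.
move=> mn; have /andP[a0 _] := crem01 u n; have /andP[b0 _] := crem01 u m.
rewrite divr_ge0//=; have [->|b1] := eqVneq (crem u m) 0.
  by rewrite invr0 mulr0 ler01.
by rewrite ler_pdivrMr ?mul1r ?crem_le// lt_neqAle eq_sym b1.
Qed.

End clipped_weights.

(** * Replacing size-biased picks by consecutive indices *)

Section size_biased_invariance.
Context {R : realType}.
Context {d : measure_display} {Omega : measurableType d} (P : probability Omega R).
Variables (pis : nat -> probability R R) (v : nat -> Omega -> R).
Hypothesis mv : forall j, measurable_fun setT (v j).
Hypothesis iv : indep_with_laws P pis v.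
Hypothesis Hp : proper_sb P v.
Variables (sig tht : R).
Hypothesis hb : forall j, is_beta (pis j) (1 - sig) (tht + j.+1%:R * sig).
Local Notation mu := (seqlaw P v mv).
Local Open Scope ereal_scope.

Lemma seqlaw_open01 : {ae mu, forall u, forall i, (0 < u i < 1)%R}.
Proof.
apply: ae_foralln => i.
have m01 : measurable (~` `]0%R, 1%R[%classic : set R) by exact: measurableC.
exists [set u : @seqspace R | (~` `]0%R, 1%R[%classic) (u i)]; split.
- by rewrite -[X in measurable X]setTI; exact: measurable_coord.
- pose A k : set R := if k == i then ~` `]0%R, 1%R[%classic else setT.
  have mA k : measurable (A k) by rewrite /A; case: ifP.
  transitivity (mu [set u | forall k, (k < i.+1)%N -> A k (u k)]).
    congr (mu _); apply/seteqP; split=> u /=.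
      by move=> h k _; rewrite /A; case: eqP => [->|].
    by move=> /(_ i (ltnSn i)); rewrite /A eqxx.
  transitivity (\prod_(k < i.+1) pis k (A k)); first exact: (seqlaw_cyl P pis v mv iv).
  rewrite big_ord_recr/= [X in _ * X](_ : _ = 0) ?mule0//.
  by rewrite /A eqxx hb// /beta_law setICl integral_set0 /= mul0r.
- by move=> u /= h hu; apply: h; move: hu; rewrite in_itv.
Qed.

Lemma ae_v01 : {ae P, forall w, forall i, (0 < v i w < 1)%R}.
Proof.
have [N [mN N0 sN]] := seqlaw_open01.
exists (vseq v @^-1` N); split.
- by rewrite -[X in measurable X]setTI; exact: (measurable_vseq v mv).
- exact: N0.
- by move=> w h; apply: sN.
Qed.

Variable A : nat -> set R.
Hypothesis mA : forall i, measurable (A i).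

Definition prefix_indic (m : nat) (u : @seqspace R) : R := (\prod_(i < m) \1_(A i) (cweight u i))%R.

Lemma prefix_indic01 m u : (0 <= prefix_indic m u <= 1)%R.
Proof.
elim: m => [|m /andP[h0 h1]]; first by rewrite /prefix_indic big_ord0 ler01 lexx.
have -> : prefix_indic m.+1 u = (prefix_indic m u * \1_(A m) (cweight u m))%R by rewrite /prefix_indic big_ord_recr.
by rewrite indicE; case: (_ \in _); rewrite /= ?mulr1 ?mulr0 ?h0 ?h1 ?lexx ?ler01.
Qed.

Lemma measurable_prefix_indic m : measurable_fun setT (prefix_indic m).
Proof.
apply: measurable_prod => i _.
have mI : measurable_fun setT (\1_(A i) : R -> R) by exact: measurable_indic.
exact: (measurableT_comp mI (measurable_cweight i)).
Qed.

Section one_step.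
Variables k m : nat.

(** What the choice of [j] after the picks [0, ..., m-1] contributes, apart from the probability of
    that choice: the constraint on the picked weight and the conditional probability for the [k]
    further picks. *)
Definition pick_ind (j : nat) (u : @seqspace R) : \bar R :=
  (\1_(A m) (cweight u j))%:E * sbp_fdd k (rcons (iota 0 m) j) A (cweight u).

Lemma uniq_rcons_iota j : (m <= j)%N -> uniq (rcons (iota 0 m) j).
Proof. by move=> mj; rewrite rcons_uniq iota_uniq andbT mem_iota/= add0n -leqNgt. Qed.

Lemma pick_ind_ge0 j u : (m <= j)%N -> 0 <= pick_ind j u.
Proof.
move=> mj; rewrite mule_ge0// ?lee_fin//; apply: sbp_fdd_ge0; first exact: subprob_cweight.
exact: uniq_rcons_iota.
Qed.

Lemma pick_ind_le1 j u : (m <= j)%N -> pick_ind j u <= 1.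
Proof.
move=> mj; rewrite -[leRHS]mule1; apply: lee_pmul.
- by rewrite lee_fin.
- by apply: sbp_fdd_ge0; [exact: subprob_cweight|exact: uniq_rcons_iota].
- by rewrite lee_fin indicE lern1 leq_b1.
- by apply: sbp_fdd_le1; [exact: subprob_cweight|exact: uniq_rcons_iota].
Qed.

Lemma measurable_pick_ind j : (m <= j)%N -> measurable_fun setT (pick_ind j).
Proof.
move=> mj; apply: emeasurable_funM.
  apply/measurable_EFinP.
  have mI : measurable_fun setT (\1_(A m) : R -> R) by exact: measurable_indic.
  exact: (measurableT_comp mI (measurable_cweight j)).
apply: measurable_sbp_fdd => //; [exact: measurable_cweight|exact: subprob_cweight|].
exact: uniq_rcons_iota.
Qed.

(* The contribution of picking [j] at step [m], with the factor
   [w_j] of the pick replaced by [c], given that the first [m] picks are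
   [0, ..., m-1]. *)
Definition jterm (c : @seqspace R -> R) (j : nat) (u : @seqspace R) : \bar R :=
  (prefix_indic m u * (c u / crem u m))%:E * pick_ind j u.

Lemma jterm_ge0 c j u : (forall u, (0 <= c u)%R) -> (m <= j)%N -> 0 <= jterm c j u.
Proof.
move=> c0 mj; rewrite mule_ge0 ?pick_ind_ge0// lee_fin mulr_ge0//.
  by case/andP: (prefix_indic01 m u).
by rewrite divr_ge0//; case/andP: (crem01 u m).
Qed.

Lemma measurable_jterm c j : measurable_fun setT c -> (m <= j)%N ->
  measurable_fun setT (jterm c j).
Proof.
move=> mc mj; apply: emeasurable_funM; last exact: measurable_pick_ind.
apply/measurable_EFinP; apply: measurable_funM; first exact: measurable_prefix_indic.
apply: measurable_funM => //; apply: (measurableT_comp measurable_inv).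
exact: measurable_crem.
Qed.

(** At [j = m] the quotient in [rterm] is almost surely [1]: [rterm m] is the expectation in which
    the pick is forced to be [m]. *)
Definition aterm j := \int[mu]_u jterm (cweight ^~ j) j u.
Definition rterm j := \int[mu]_u jterm (crem ^~ j) j u.

Let cw0 j (u : @seqspace R) : (0 <= cweight u j)%R. Proof. by case: (subprob_cweight u). Qed.
Let cr0 j (u : @seqspace R) : (0 <= crem u j)%R. Proof. by case/andP: (crem01 u j). Qed.

(* Exchanging [w_n] and [w_(n+1)] turns a pick of [n] into a pick of [n+1]. *)
Lemma jterm_swap n : (m <= n)%N ->
  \int[mu]_u jterm (crem ^~ n.+1) n u = rterm n.+1.
Proof.
move=> mn.
have mP := measurable_jterm _ _ (measurable_crem n) mn.
have hb' : is_beta (pis n.+1) (1 - sig) (tht + n.+1%:R * sig + sig).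
  have -> : (tht + n.+1%:R * sig + sig = tht + n.+2%:R * sig)%R by rewrite -[n.+2%:R%R]natr1; ring.
  exact: hb.
(* The factorisation [R_(n+1) = R_n (1 - v_n)] produces the weight under which the exchange
   preserves integrals. *)
transitivity (\int[mu]_u ((pospart1 (u n))%:E * jterm (crem ^~ n) n u)).
  apply: (integral_eq_aeS _ _ _ _ seqlaw_open01) => u u01.
  have /andP[u0 u1] := u01 n.
  rewrite /jterm [RHS]muleA -EFinM; congr (_%:E * _).
  have -> : pospart1 (u n) = (1 - u n)%R by rewrite /pospart1 max_r// subr_ge0 ltW.
  have -> : crem u n.+1 = (crem u n * (1 - u n))%R.
    by rewrite /crem sb_remS /clip_seq clip01_id// !ltW.
  by rewrite /=; ring.
rewrite (seqlaw_swap P pis v mv iv n sig _ _ (hb n) hb' mP (fun u => jterm_ge0 _ _ u (cr0 n) mn)).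
clear mP hb'; apply: (integral_eq_aeS _ _ _ _ seqlaw_open01) => u u01.
have /andP[u0 u1] := u01 n.
have s01 := swap_sticks01 u n u01.
have cu : clip_seq u = u by apply: clip_seq_id => i; have /andP[/ltW -> /ltW ->] := u01 i.
have cs : clip_seq (swap_sticks n u) = swap_sticks n u.
  by apply: clip_seq_id => i; have /andP[/ltW -> /ltW ->] := s01 i.
have ws : cweight (swap_sticks n u) = cweight u \o transpose n.
  by rewrite /cweight cs cu; exact: sb_weight_swap.
have rs i : (i <= n)%N -> crem (swap_sticks n u) i = crem u i.
  move=> i_n; rewrite /crem cs cu; apply: sb_rem_eq => l li.
  by rewrite swap_sticks_lt// (leq_trans li).
rewrite /jterm !rs//.
have -> : prefix_indic m (swap_sticks n u) = prefix_indic m u.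
  apply: eq_bigr => i _; rewrite ws /= transpose_lt//.
  exact: leq_trans (ltn_ord i) mn.
(* As [m <= n], the transposition fixes the earlier picks [0, ..., m-1] and moves only the last one,
   from [n] to [n.+1]. *)
have -> : pick_ind n (swap_sticks n u) = pick_ind n.+1 u.
  rewrite /pick_ind ws /= {1}/transpose eqxx; congr (_ * _).
  rewrite sbp_fdd_perm//; [|exact: subprob_cweight|exact: transposeK|exact: uniq_rcons_iota].
  congr (sbp_fdd _ _ _ _); rewrite map_rcons {2}/transpose eqxx; congr rcons.
  rewrite -[RHS]map_id; apply/eq_in_map => i; rewrite mem_iota add0n => /andP[_ im].
  by rewrite transpose_lt// (leq_trans im).
rewrite [LHS]muleA -EFinM; congr (_%:E * _).
have -> : pospart1 (u n) = (1 - u n)%R by rewrite /pospart1 max_r// subr_ge0 ltW.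
have -> : crem u n.+1 = (crem u n * (1 - u n))%R.
  by rewrite /crem sb_remS /clip_seq clip01_id// !ltW.
by ring.
Qed.

(** Split [R_n = w_n + R_(n+1)]: the first part is the pick of [n], and the exchange turns the
    second into the next remaining term. *)
Lemma rterm_step n : (m <= n)%N -> rterm n = aterm n + rterm n.+1.
Proof.
move=> mn; rewrite -jterm_swap// /rterm /aterm -ge0_integralD//.
- apply: eq_integral => u _; rewrite /jterm -ge0_muleDl ?lee_fin.
  + by rewrite -EFinD; congr (_%:E * _); rewrite {1}crem_split; ring.
  + by rewrite mulr_ge0 ?divr_ge0//; case/andP: (prefix_indic01 m u).
  + by rewrite mulr_ge0 ?divr_ge0//; case/andP: (prefix_indic01 m u).
- by move=> u _; exact: jterm_ge0.
- by apply: measurable_jterm => //; exact: measurable_cweight.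
- by move=> u _; exact: jterm_ge0.
- by apply: measurable_jterm => //; exact: measurable_crem.
Qed.

Lemma rterm_sum n : rterm m = \sum_(0 <= i < n) aterm (m + i) + rterm (m + n).
Proof.
elim: n => [|n ->]; first by rewrite big_geq// add0e addn0.
by rewrite big_nat_recr//= -addeA addnS -rterm_step// leq_addr.
Qed.

(** The other factors are at most [1], so the term is bounded by the expectation of [R_(m+n) / R_m].
    This ratio stays in [[0, 1]] and tends to [0] almost surely, by properness. *)
Lemma rterm_cvg0 : (fun n => rterm (m + n)) @ \oo --> 0.
Proof.
pose f n (w : Omega) : R := (crem (vseq v w) (m + n) / crem (vseq v w) m)%R.
have f01 n w : (0 <= f n w <= 1)%R by apply: crem_ratio01; exact: leq_addr.
have mf n : measurable_fun setT (f n).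
  have mq : measurable_fun setT (fun u : @seqspace R => crem u (m + n) / crem u m)%R.
    apply: measurable_funM; first exact: measurable_crem.
    by apply: (measurableT_comp measurable_inv); exact: measurable_crem.
  exact: (measurableT_comp mq (measurable_vseq v mv)).
have fn n w : (`|f n w| <= 1)%R by have /andP[f0 f1] := f01 n w; rewrite ger0_norm.
have c : (fun n => fine (\int[P]_w (f n w)%:E)) @ \oo --> fine (\int[P]_w (cst 0%R w)%:E).
  apply: (bounded_cvg_integral P f (cst 0%R) 1) => //; first by move=> w; rewrite normr0.
  apply: filterS2 ae_v01 Hp => w v01 p.
  have cv : clip_seq (vseq v w) = v ^~ w.
    by apply: clip_seq_id => i; have /andP[/ltW -> /ltW ->] := v01 i.
  rewrite /cst -(mul0r (crem (vseq v w) m)^-1%R); apply: cvgM; last exact: cvg_cst.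
  have : (crem (vseq v w)) @ \oo --> 0%R.
    rewrite /crem cv; have -> : sb_rem (v ^~ w) = (fun k => 1 - series (sb_weight (v ^~ w)) k)%R.
      by apply/funext => i; rewrite series_sb_weight opprB addrC subrK.
    by rewrite -[X in _ --> X](subrr 1%R); apply: cvgB => //; exact: cvg_cst.
  exact: (cvg_comp _ _ (cvg_addnl m)).
move: c; under [X in _ --> fine X]eq_integral do rewrite /cst.
rewrite integral0 /= => c.
have cE : (fun n => \int[P]_w (f n w)%:E) @ \oo --> 0.
  have -> : (fun n => \int[P]_w (f n w)%:E) = EFin \o (fun n => fine (\int[P]_w (f n w)%:E)).
    by apply/funext => n /=; rewrite fineK//; exact: (integral_bounded_fin P _ 1).
  exact: cvg_comp c _.
apply: (squeeze_cvge _ (@cvg_cst _ 0 _ \oo _) cE).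
apply: nearW => n; apply/andP; split.
  by apply: integral_ge0 => u _; apply: jterm_ge0 => //; exact: leq_addr.
pose q (u : @seqspace R) := (crem u (m + n) / crem u m)%:E.
have mq : measurable_fun setT q.
  apply/measurable_EFinP; apply: measurable_funM; first exact: measurable_crem.
  by apply: (measurableT_comp measurable_inv); exact: measurable_crem.
have q0 u : 0 <= q u by rewrite lee_fin; case/andP: (crem_ratio01 u m _ (leq_addr n m)).
apply: (@le_trans _ _ (\int[mu]_u q u)).
  apply: ge0_le_integral => //.
  - by move=> u _; apply: jterm_ge0 => //; exact: leq_addr.
  - by apply: measurable_jterm; [exact: measurable_crem|exact: leq_addr].
  move=> u _; rewrite /jterm -[leRHS]mule1; apply: lee_pmul.
  - by rewrite lee_fin mulr_ge0 ?divr_ge0//; case/andP: (prefix_indic01 m u).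
  - by apply: pick_ind_ge0; exact: leq_addr.
  - rewrite lee_fin ler_piMl//; last by case/andP: (prefix_indic01 m u).
    by rewrite divr_ge0.
  - by apply: pick_ind_le1; exact: leq_addr.
by rewrite ge0_integral_law.
Qed.

Lemma sbp_term u : (prefix_indic m u)%:E * sbp_fdd k.+1 (iota 0 m) A (cweight u) =
  \sum_(0 <= i <oo) jterm (cweight ^~ (m + i)%N) (m + i) u.
Proof.
have E : (1 - \sum_(i <- iota 0 m) cweight u i)%R = crem u m.
  have := series_sb_weight (clip_seq u) m.
  by rewrite /series/= /index_iota subn0 /cweight /crem => ->; rewrite opprB addrC subrK.
have p0 j : j \notin iota 0 m -> (m <= j)%N by rewrite mem_iota add0n/= -leqNgt.
have t0 j : j \notin iota 0 m ->
    0 <= (sbp_coef (iota 0 m) A (cweight u) j)%:E * sbp_fdd k (rcons (iota 0 m) j) A (cweight u).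
  move=> /p0 mj; rewrite mule_ge0//.
    by rewrite lee_fin sbp_coef_ge0 ?iota_uniq//; exact: subprob_cweight.
  by apply: sbp_fdd_ge0; [exact: subprob_cweight|exact: uniq_rcons_iota].
rewrite sbp_fddS -nneseriesZl; [|exact: t0].
rewrite [LHS]nneseries_esum; [|by move=> j jm; rewrite mule_ge0 ?t0// lee_fin; case/andP: (prefix_indic01 m u)].
rewrite [RHS]nneseries_esumT; last by move=> i; apply: jterm_ge0 => //; exact: leq_addr.
rewrite (reindex_esum [set: nat] _ (addn m)); last first.
  split.
  - by move=> i _ /=; rewrite mem_iota add0n/= -leqNgt leq_addr.
  - by move=> i j _ _ /addnI.
  - by move=> j /= /p0 mj; exists (j - m)%N => //; rewrite subnKC.
apply: eq_esum => i _; rewrite /jterm /pick_ind /sbp_coef E size_iota !muleA -!EFinM.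
by congr (_%:E * _); ring.
Qed.

(** In expectation, the size-biased pick following [0, ..., m-1] may be taken to be [m]: summing
    over all possible picks gives the series of the [aterm], which telescopes to [rterm m]. *)
Lemma sbp_step :
  \int[mu]_u ((prefix_indic m u)%:E * sbp_fdd k.+1 (iota 0 m) A (cweight u)) =
  \int[mu]_u ((prefix_indic m.+1 u)%:E * sbp_fdd k (iota 0 m.+1) A (cweight u)).
Proof.
have -> : \int[mu]_u ((prefix_indic m.+1 u)%:E * sbp_fdd k (iota 0 m.+1) A (cweight u)) = rterm m.
  apply: (integral_eq_aeS _ _ _ _ seqlaw_open01) => u u01.
  rewrite /jterm divff ?gt_eqF ?crem_gt0// mulr1 /pick_ind muleA -EFinM.
  rewrite /prefix_indic big_ord_recr; congr (_ * sbp_fdd _ _ _ _).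
  by rewrite -cats1 -[m.+1]addn1 iotaD add0n.
under eq_integral do rewrite sbp_term.
have j0 i u : 0 <= jterm (cweight ^~ (m + i)%N) (m + i) u.
  by apply: jterm_ge0 => //; exact: leq_addr.
rewrite integral_nneseries//; last first.
  by move=> i; apply: measurable_jterm; [exact: measurable_cweight|exact: leq_addr].
have c1 : (fun n => \sum_(0 <= i < n) aterm (m + i)) @ \oo --> \sum_(0 <= i <oo) aterm (m + i).
  by apply: is_cvg_nneseries => i _ _; apply: integral_ge0.
have c2 : (fun n => \sum_(0 <= i < n) aterm (m + i) + rterm (m + n)) @ \oo -->
    \sum_(0 <= i <oo) aterm (m + i) + 0.
  by apply: cvgeD => //; [exact: fin_num_adde_defl|exact: rterm_cvg0].
have c3 : (fun n => \sum_(0 <= i < n) aterm (m + i) + rterm (m + n)) @ \oo --> rterm m.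
  by under eq_fun do rewrite -rterm_sum; exact: cvg_cst.
by rewrite (cvg_unique _ c3 c2)// adde0.
Qed.

End one_step.

Lemma sbp_all_steps k m :
  \int[mu]_u ((prefix_indic m u)%:E * sbp_fdd k (iota 0 m) A (cweight u)) =
  \int[mu]_u (prefix_indic (m + k) u)%:E.
Proof.
elim: k m => [|k IH] m; first by rewrite addn0; apply: eq_integral => u _; rewrite mule1.
by rewrite sbp_step IH addSnnS.
Qed.

Lemma beta_sbp_invariant k :
  \int[P]_w sbp_fdd k [::] A (sb_weight (v ^~ w)) =
  P (\bigcap_(i in `I_k) [set w | A i (sb_weight (v ^~ w) i)]).
Proof.
have cv w : (forall i, (0 < v i w < 1)%R) -> cweight (vseq v w) = sb_weight (v ^~ w).
  move=> v01; rewrite /cweight clip_seq_id// => i.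
  by have /andP[/ltW -> /ltW ->] := v01 i.
have mw i : measurable_fun setT (fun w => sb_weight (v ^~ w) i).
  apply: measurable_funM => //; apply: measurable_prod => j _.
  exact: measurable_funB.
have ms : measurable_fun setT (fun u : @seqspace R => sbp_fdd k [::] A (cweight u)).
  by apply: measurable_sbp_fdd => //; [exact: measurable_cweight|exact: subprob_cweight].
have s0 (u : @seqspace R) : 0 <= sbp_fdd k [::] A (cweight u).
  by apply: sbp_fdd_ge0 => //; exact: subprob_cweight.
transitivity (\int[mu]_u sbp_fdd k [::] A (cweight u)).
  rewrite [RHS]ge0_integral_law//; apply: (integral_eq_aeS _ _ _ _ ae_v01) => w v01.
  by rewrite cv.
transitivity (\int[mu]_u (prefix_indic k u)%:E).
  have := sbp_all_steps k 0; rewrite add0n => <-; apply: eq_integral => u _.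
  by rewrite /prefix_indic big_ord0 mul1e.
rewrite [LHS]ge0_integral_law//; last 2 first.
- by apply/measurable_EFinP; exact: measurable_prefix_indic.
- by move=> u; rewrite lee_fin; case/andP: (prefix_indic01 k u).
rewrite -[X in P X]setIT -integral_indic//; last first.
  apply: fin_bigcap_measurable => [|i _]; first exact: finite_II.
  by rewrite -[X in measurable X]setTI; exact: mw.
apply: (integral_eq_aeS _ _ _ _ ae_v01) => w v01; congr (_%:E).
rewrite /prefix_indic indicE; case: (boolP (w \in _)) => [|].
  rewrite inE => h; rewrite big1// => i _; rewrite indicE mem_set// cv//.
  exact: (h _ (ltn_ord i)).
rewrite notin_setE => h.
have [i iA] : exists i : 'I_k, ~ A i (sb_weight (v ^~ w) i).
  apply: contrapT => hn; apply: h => i ik; apply: contrapT => Ai; apply: hn.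
  by exists (Ordinal ik).
by rewrite (bigD1 i)//= indicE memNset ?mul0r// cv.
Qed.

End size_biased_invariance.

Theorem mainTheorem15 (R : realType) (X : completePseudoMetricType R)
    (* limit process P on (Omega, PP) *)
    (d : measure_display) (Omega : measurableType d) (PP : probability Omega R)
    (rho : R) (pis : nat -> probability R R) (P0 : probability (XB X) R)
    (v : nat -> Omega -> R) (th : nat -> Omega -> XB X)
    (* processes P^(n) on (Omegan n, PPn n) *)
    (dn : nat -> measure_display) (Omegan : forall n, measurableType (dn n))
    (PPn : forall n, probability (Omegan n) R)
    (rhon : nat -> R) (pisn : nat -> nat -> probability R R)
    (P0n : nat -> probability (XB X) R)
    (vn : forall n, nat -> Omegan n -> R) (thn : forall n, nat -> Omegan n -> XB X) :
  polish X ->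
  lazy_msb PP rho pis P0 v th -> proper_sb PP v ->
  (forall n, lazy_msb (PPn n) (rhon n) (pisn n) (P0n n) (vn n) (thn n)) ->
  (forall n, proper_sb (PPn n) (vn n)) ->
  rhon @ \oo --> rho ->
  weak_cvg_X (fun n => P0n n) P0 ->
  (forall j, weak_cvg_R (fun n => pisn n j) (pis j)) ->
  (* P^(n) -> P weakly in distribution *)
  (forall f : X -> R, continuous f -> (exists M : R, forall x, `|f x| <= M) ->
     cvg_dist_R PP PPn (fun n => sb_integral (P0n n) (vn n) (thn n) f)
       (sb_integral P0 v th f))
  (* w^(n) -> w in distribution *)
  /\ cvg_dist_seq PP PPn (fun n w j => sb_weight (vn n ^~ w) j)
       (fun w j => sb_weight (v ^~ w) j)
  (* (i) *)
  /\ (rho = 0 ->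
      indep_with_laws PP pis v /\
      forall sig tht : R, 0 <= sig < 1 -> - sig < tht ->
        (forall j, is_beta (pis j) (1 - sig) (tht + j.+1%:R * sig)) ->
        pitman_yor PP sig tht P0 v th /\
        sbp_invariant PP (fun j w => sb_weight (v ^~ w) j))
  (* (ii) *)
  /\ (rho = 1 ->
      cd_sb PP pis P0 v th /\
      forall sig tht : R, 0 <= sig < 1 -> - sig < tht ->
        (forall j, is_beta (pis j) (1 - sig) (tht + j.+1%:R * sig)) ->
        as_nonincreasing PP (fun j w => sb_weight (v ^~ w) j)).
Proof.
move=> polishX H Hp Hn Hpn crho cP0 cpi.
split; first by move=> f cf bf; apply: (cvg_dist_sb_integral PP rho pis P0 v th dn Omegan PPn rhon pisn P0n vn thn H Hp Hn Hpn crho cP0 cpi).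
split; first exact: (cvg_dist_weights PP rho pis P0 v th dn Omegan PPn rhon pisn P0n vn thn H Hn crho cP0 cpi).
split=> rhoE; rewrite {}rhoE in H crho.
  have iv := lazy_msb0_indep PP pis P0 v th H.
  split=> // sig tht sig01 thts hb; split; first exact: (lazy_msb0_pitman_yor PP pis P0 v th H).
  have mv j : measurable_fun setT (v j) by case: H => _ _ _ m _; case: (m j).
  by move=> k A mA; apply: (beta_sbp_invariant PP pis v mv iv Hp sig tht hb A mA).
split; first exact: (lazy_msb1_cd_sb PP pis P0 v th H).
move=> sig tht /andP[sig0 _] _ hb.
exact: (lazy_msb1_beta_nonincreasing PP pis P0 v th sig tht H sig0 hb).
Qed.
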